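(* Let $n\ge 0$ be an integer and $w\in\mathbb{C}$ with $\Re w>0$. Then $$\mathbf{S}_n(w)=(-1)^{n+1}n!\left(\int_0^{+\infty}\frac{1}{t^n}\left(\frac{1}{1-e^{-t}}-\sum_{k=-1}^{n}b_kt^k\right)\frac{e^{-wt}\,dt}{t}+\hat{\mathbf r}_n(w)\right),$$ where the rational numbers $(b_k)_{k\ge -1}$ are given by the Laurent expansion at $t=0$ $$\frac{1}{1-e^{-t}}=\sum_{k=-1}^{+\infty}b_kt^k=\frac1t+\frac12+\frac{1}{12}t-\frac{1}{720}t^3+\cdots$$ and $$\hat{\mathbf r}_n(w)=\sum_{\ell=1}^{n+1}b_{n-\ell}\frac{(-1)^\ell}{\ell!}w^\ell H_\ell+\left(\sum_{\ell=0}^{n+1}b_{n-\ell}\frac{(-1)^{\ell+1}}{\ell!}w^\ell\right)\log w,$$ with $H_\ell=1+\frac12+\cdots+\frac1\ell$ the harmonic numbers ($H_0=0$).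
   Context: Logarithms are principal branches. For an integer $n\ge 0$ and $\Re w>0$, the partial sum $\sum_{k=0}^{s-1}(k+w)^n\log(k+w)$ has, as the integer $s\to+\infty$, a unique asymptotic expansion in the family of functions $s^m\log s$ ($m\ge 0$) and $s^m$ ($m\in\mathbb{Z}$), with finitely many terms not tending to $0$. The General Stirling-Ramanujan constant $\mathbf{S}_n(w)$ is defined as the constant term (the coefficient of $s^0$) of this expansion. *)

(* Defs.v *)
(* Classical real numbers of the Stdlib, with Coquelicot's complex numbers,
   limits and integrals. *)
From Stdlib Require Import Reals ZArith QArith Qreals ClassicalEpsilon.
From Coquelicot Require Import Coquelicot.

Open Scope C_scope.

Definition Csum (f : nat -> C) (m n : nat) : C :=
  sum_n_m (G := C_AbelianMonoid) f m n.

Definition Cexp (z : C) : C :=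
  ((exp (Re z) * cos (Im z))%R, (exp (Re z) * sin (Im z))%R).

(* Principal argument, with values in (-PI, PI] for z <> 0. *)
Definition Carg (z : C) : R :=
  if Rle_dec 0 (Im z) then acos (Re z / Cmod z) else (- acos (Re z / Cmod z))%R.

Definition Clog (z : C) : C := (ln (Cmod z), Carg z).

(* [f] has, as s -> +oo, the full (Poincare) asymptotic expansion
     f(s) ~ sum_{0 <= m <= N} a_m s^m log s + sum_{m <= N} c_m s^m,   m in Z,
   i.e. for every M, truncating the second sum at m = -M leaves o(s^(-M));
   the index j below stands for m + M. *)
Definition is_log_power_expansion
    (f : nat -> C) (N : nat) (a : nat -> C) (c : Z -> C) : Prop :=
  forall M : nat,
    filterlim
      (fun s : nat =>
         (f s
          - Csum (fun m => a m * RtoC (INR s ^ m * ln (INR s))) 0 N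
          - Csum (fun j => let m := (Z.of_nat j - Z.of_nat M)%Z in
                           c m * RtoC (powerRZ (INR s) m)) 0 (M + N))
         * RtoC (INR s ^ M))
      eventually (locally (RtoC 0)).

Definition is_constant_term (f : nat -> C) (x : C) : Prop :=
  exists (N : nat) (a : nat -> C) (c : Z -> C),
    is_log_power_expansion f N a c /\ c 0%Z = x.

(* [iota] is Coquelicot's definite description: the expansion is unique. *)
Definition constant_term (f : nat -> C) : C :=
  iota (T := C_R_CompleteNormedModule) (is_constant_term f).

(* sum_{k=0}^{s-1}; the value at s = 0 is irrelevant to the asymptotics. *)
Definition log_power_sum (n : nat) (w : C) (s : nat) : C :=
  Csum (fun k => (RtoC (INR k) + w) ^ n * Clog (RtoC (INR k) + w)) 0 (pred s).

Definition stirling_ramanujan (n : nat) (w : C) : C :=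
  constant_term (log_power_sum n w).

(* Laurent expansion of 1/(1-e^(-t)) in a punctured neighbourhood of 0; the
   summation index k starts at -1, hence the shift by one. *)
Definition is_laurent_expansion (b : Z -> Q) : Prop :=
  exists r : R, (0 < r)%R /\
    forall t : R, (0 < Rabs t < r)%R ->
      is_series
        (fun j : nat => let k := (Z.of_nat j - 1)%Z in
                        (Q2R (b k) * powerRZ t k)%R)
        (/ (1 - exp (- t)))%R.

(* Only the values at k >= -1 are meaningful. *)
Definition laurent_coef_rat : Z -> Q :=
  epsilon (inhabits (fun _ => 0%Q)) is_laurent_expansion.

Definition laurent_coef (k : Z) : R := Q2R (laurent_coef_rat k).

(* sum_{k=-1}^{n} b_k t^k *)
Definition laurent_trunc (n : nat) (t : R) : R :=
  sum_n_m (fun j : nat => let k := (Z.of_nat j - 1)%Z in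
                          (laurent_coef k * powerRZ t k)%R) 0 (n + 1).

Definition SR_integrand (n : nat) (w : C) (t : R) : C :=
  RtoC (1 / t ^ n * (1 / (1 - exp (- t)) - laurent_trunc n t))
  * (Cexp (- w * RtoC t) / RtoC t).

Definition harmonic (l : nat) : R := sum_n_m (fun i : nat => (/ INR i)%R) 1 l.

Definition r_hat (n : nat) (w : C) : C :=
  Csum (fun l => RtoC (laurent_coef (Z.of_nat n - Z.of_nat l)
                       * ((-1) ^ l / INR (fact l)))
                 * w ^ l * RtoC (harmonic l)) 1 (n + 1)
  + Csum (fun l => RtoC (laurent_coef (Z.of_nat n - Z.of_nat l)
                         * ((-1) ^ (l + 1) / INR (fact l)))
                   * w ^ l) 0 (n + 1)
    * Clog w.

(* Main.v *)
(** Write [L_j v = (-v)^j / j! * (H_j - log v)]. Up to a multiple of Euler's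
    constant that cancels below, this is the finite part of the integral of
    [t^(-j-1) exp (-v t)] over the positive half-line: it follows by parts from
    the case [j = 0], which is Frullani's integral. Hence whenever a linear combination of such
    functions is o(1/t) at 0, its integral is the same combination of the [L_j v].

    Let [1 / (1 - e^(-t)) = sum b_k t^k] and
    [e^(-wt) / (1 - e^(-t)) = sum B_k t^k]. Subtract the partial sums up to
    [k = n], multiply by [t^(-n-1) e^(-wt)] and [t^(-n-1) e^(-st)] respectively,
    and take the difference of the two products: only exponentials
    [t^(-j-1) e^(-vt)] remain, among them the geometric sum of the
    [e^(-(w+k)t)], [k < s]. Integrating gives
      [sum_(k<s) L_n (w+k) = I + r_hat - sum_(k<=n) B_k L_(n-k) s - R s],
    where [I] is the integral of the theorem and [R s] is a Laplace integral,
    which by Watson's lemma expands in negative powers of [s]. As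
    [L_0 s = - log s], the constant term of the right-hand side is [I + r_hat].
    Finally [(w+k)^n log (w+k)] is a multiple of [L_n (w+k)] plus [H_n (w+k)^n],
    and power sums are polynomials in [s] without constant term. *)
Require Import Defs.
From Stdlib Require Import Reals Factorial Lra Lia ClassicalEpsilon Qreals QArith.
From Coquelicot Require Import Coquelicot.

Open Scope C_scope.

(** The integrals of [t^(-j-1) e^(-vt)] diverge at 0, so the finite part must become a linear
    functional before combinations can be integrated. A function is split into an integrable part
    that is o(1/t) at 0 and a part in the span of [e^(-t) / t], [t^(-2)], [t^(-3)], ..., whose
    integral is declared to be 0. This is consistent because a member of the span that is o(1/t)
    vanishes. Taking [e^(-t) / t] as the member of order one makes the case [j = 0] exactly
    Frullani's integral, with value [- log v]; this is how Euler's constant drops out. For complex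
    [v] that integral is obtained without contours, by moving the parameter along the segment from 1
    to [v]. All expansions are multiplied by [t]: [t / (1 - e^(-t))] has a power series, so
    [b_(j-1)] is indexed by a natural number [j], and the truncation [k <= n] becomes [j <= n + 1].
    Two facts then control every integral: a remainder of the expected order at 0, and at most
    linear growth at infinity against an exponential. *)

(** * Finite sums and the complex exponential *)

Lemma Csum_O (f : nat -> C) : Csum f 0 0 = f O.
Proof. exact (sum_n_n f O). Qed.

Lemma Csum_S (f : nat -> C) (m n : nat) :
  (m <= S n)%nat -> Csum f m (S n) = Csum f m n + f (S n).
Proof. intros H. exact (sum_n_Sm f m n H). Qed.

Lemma Csum_ext (f g : nat -> C) (n : nat) :
  (forall k, (k <= n)%nat -> f k = g k) -> Csum f 0 n = Csum g 0 n.
Proof. intros H. apply sum_n_m_ext_loc. intros k Hk. apply H. lia. Qed.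

Lemma Csum_plus (f g : nat -> C) (n : nat) :
  Csum (fun k => f k + g k) 0 n = Csum f 0 n + Csum g 0 n.
Proof. exact (sum_n_m_plus (G := C_AbelianMonoid) f g 0 n). Qed.

Lemma Csum_scal (c : C) (f : nat -> C) (n : nat) :
  Csum (fun k => c * f k) 0 n = c * Csum f 0 n.
Proof.
  induction n as [|n IH].
  - rewrite !Csum_O. reflexivity.
  - rewrite !Csum_S, IH by lia. ring.
Qed.

Lemma Csum_0 (f : nat -> C) (n : nat) :
  (forall k, (k <= n)%nat -> f k = 0) -> Csum f 0 n = 0.
Proof.
  intros H. induction n as [|n IH].
  - rewrite Csum_O. apply H. lia.
  - rewrite Csum_S, IH, H by (intros; try apply H; lia). ring.
Qed.

Lemma Csum_shift (f : nat -> C) (n : nat) :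
  Csum f 0 (S n) = f O + Csum (fun k => f (S k)) 0 n.
Proof.
  induction n as [|n IH].
  - rewrite Csum_S, !Csum_O by lia. reflexivity.
  - rewrite Csum_S, IH, (Csum_S _ 0 n) by lia. ring.
Qed.

Lemma Csum_rev (f : nat -> C) (n : nat) :
  Csum (fun k => f (n - k)%nat) 0 n = Csum f 0 n.
Proof.
  revert f. induction n as [|n IH]; intros f.
  - rewrite !Csum_O. reflexivity.
  - rewrite Csum_shift, Csum_S by lia.
    rewrite (Csum_ext _ (fun k => f (n - k)%nat)).
    + rewrite (IH f). simpl. apply Cplus_comm.
    + intros k Hk. reflexivity.
Qed.

Lemma Csum_first (f : nat -> C) (n : nat) :
  Csum f 0 (S n) = f O + Csum f 1 (S n).
Proof.
  induction n as [|n IH].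
  - rewrite Csum_S, Csum_O by lia. f_equal. symmetry. exact (sum_n_n f 1).
  - rewrite Csum_S, IH, (Csum_S f 1 (S n)) by lia. ring.
Qed.

Lemma RtoC_pow (x : R) (n : nat) : RtoC (x ^ n) = RtoC x ^ n.
Proof.
  induction n as [|n IH]; [reflexivity|].
  simpl. rewrite RtoC_mult, IH. reflexivity.
Qed.

Lemma Cexp_plus (a b : C) : Cexp (a + b) = Cexp a * Cexp b.
Proof.
  destruct a as [a1 a2], b as [b1 b2]. unfold Cexp, Cmult; simpl.
  rewrite exp_plus, cos_plus, sin_plus. f_equal; ring.
Qed.

Lemma Cexp_0 : Cexp 0 = 1.
Proof. unfold Cexp; simpl. rewrite exp_0, cos_0, sin_0. unfold RtoC. f_equal; ring. Qed.

Lemma Cexp_RtoC (x : R) : Cexp (RtoC x) = RtoC (exp x).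
Proof. unfold Cexp; simpl. rewrite cos_0, sin_0. unfold RtoC. f_equal; ring. Qed.

Lemma Cmod_Cexp (z : C) : Cmod (Cexp z) = exp (Re z).
Proof.
  unfold Cmod, Cexp; simpl.
  replace (_ + _)%R with ((exp (Re z))² * ((sin (Im z))² + (cos (Im z))²))%R
    by (unfold Rsqr; ring).
  rewrite sin2_cos2, Rmult_1_r. apply sqrt_Rsqr. left; apply exp_pos.
Qed.

Lemma Cmod_RtoC (x : R) : (0 <= x)%R -> Cmod (RtoC x) = x.
Proof. intros H. rewrite Cmod_R. apply Rabs_pos_eq, H. Qed.

Lemma Cmod_pow (z : C) (n : nat) : Cmod (z ^ n) = (Cmod z ^ n)%R.
Proof.
  induction n as [|n IH]; simpl; [apply Cmod_1|]. rewrite Cmod_mult, IH. reflexivity.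
Qed.

Lemma Cmod_Cexp_le_1 (v : C) (t : R) :
  (0 <= Re v)%R -> (0 <= t)%R -> (Cmod (Cexp (- v * RtoC t)) <= 1)%R.
Proof.
  intros Hv Ht. rewrite Cmod_Cexp. rewrite <- exp_0.
  assert (E : Re (- v * RtoC t) = (- (Re v * t))%R) by (destruct v; simpl; ring).
  rewrite E. apply Rnot_lt_le. intros H. apply exp_lt_inv in H. nra.
Qed.

(** * Calculus of complex functions of a real variable *)

(** Componentwise, so that [auto_derive] and the real fundamental theorem apply to each
    coordinate. *)
Definition Cder (f : R -> C) (x : R) (l : C) : Prop :=
  is_derive (fun t => Re (f t)) x (Re l) /\ is_derive (fun t => Im (f t)) x (Im l).

Lemma Cder_ext_loc (f g : R -> C) (x : R) (l : C) :
  locally x (fun t => f t = g t) -> Cder f x l -> Cder g x l.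
Proof.
  intros H [H1 H2]; split.
  - apply (is_derive_ext_loc (fun t => Re (f t))); [|exact H1].
    revert H. apply filter_imp. intros t E. rewrite E. reflexivity.
  - apply (is_derive_ext_loc (fun t => Im (f t))); [|exact H2].
    revert H. apply filter_imp. intros t E. rewrite E. reflexivity.
Qed.

Lemma Cder_eq (f : R -> C) (x : R) (l l' : C) : Cder f x l -> l = l' -> Cder f x l'.
Proof. intros H <-. exact H. Qed.

Lemma Cder_const (c : C) (x : R) : Cder (fun _ => c) x 0.
Proof. split; exact (is_derive_const _ x). Qed.

Lemma Cder_RtoC (f : R -> R) (x l : R) : is_derive f x l -> Cder (fun t => RtoC (f t)) x (RtoC l).
Proof. intros H; split; [exact H|exact (is_derive_const _ x)]. Qed.

Lemma Cder_id (x : R) : Cder (fun t => RtoC t) x 1.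
Proof. apply Cder_RtoC. apply (is_derive_id x). Qed.

Lemma Cder_plus (f g : R -> C) (x : R) (l m : C) :
  Cder f x l -> Cder g x m -> Cder (fun t => f t + g t) x (l + m).
Proof.
  intros [H1 H2] [H3 H4]; split.
  - exact (is_derive_plus _ _ x _ _ H1 H3).
  - exact (is_derive_plus _ _ x _ _ H2 H4).
Qed.

Lemma is_derive_eqv (f : R -> R) (x l l' : R) : is_derive f x l -> l = l' -> is_derive f x l'.
Proof. intros H <-. exact H. Qed.

Lemma Cder_mult (f g : R -> C) (x : R) (l m : C) :
  Cder f x l -> Cder g x m -> Cder (fun t => f t * g t) x (l * g x + f x * m).
Proof.
  intros [H1 H2] [H3 H4].
  assert (M : forall f g l m, is_derive f x l -> is_derive g x m ->
             is_derive (fun t : R => (f t * g t)%R) x (l * g x + f x * m)%R).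
  { intros a b c d Ha Hb. exact (is_derive_mult a b x c d Ha Hb Rmult_comm). }
  split.
  - eapply is_derive_eqv.
    + exact (is_derive_minus _ _ x _ _ (M _ _ _ _ H1 H3) (M _ _ _ _ H2 H4)).
    + unfold minus, plus, opp, Re, Im; simpl. ring.
  - eapply is_derive_eqv.
    + exact (is_derive_plus _ _ x _ _ (M _ _ _ _ H1 H4) (M _ _ _ _ H2 H3)).
    + unfold plus, Re, Im; simpl. ring.
Qed.

Lemma Cder_scal (c : C) (f : R -> C) (x : R) (l : C) :
  Cder f x l -> Cder (fun t => c * f t) x (c * l).
Proof.
  intros H. apply Cder_eq with (1 := Cder_mult _ _ _ _ _ (Cder_const c x) H). simpl. ring.
Qed.

Lemma Cder_minus (f g : R -> C) (x : R) (l m : C) :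
  Cder f x l -> Cder g x m -> Cder (fun t => f t - g t) x (l - m).
Proof.
  intros [H1 H2] [H3 H4]; split.
  - exact (is_derive_minus _ _ x _ _ H1 H3).
  - exact (is_derive_minus _ _ x _ _ H2 H4).
Qed.

Lemma Cder_Cexp (v : C) (x : R) :
  Cder (fun t => Cexp (- v * RtoC t)) x (- v * Cexp (- v * RtoC x)).
Proof.
  destruct v as [a b]; split; unfold Re, Im, Cexp; simpl;
    (auto_derive; [easy|unfold Rminus; ring]).
Qed.

(** Serves as a certificate of continuity, hence of integrability on compact intervals, that is
    easily propagated through the operations in use. *)
Definition Cdiff (f : R -> C) (x : R) : Prop := exists l, Cder f x l.

Lemma Cdiff_cont (f : R -> C) (x : R) :
  Cdiff f x -> continuous (U := C_R_NormedModule) f x.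
Proof.
  intros [l [H1 H2]].
  assert (E : forall P, locally (f x) P -> locally x (fun t => P (f t))).
  2: exact E.
  intros P [e He].
  assert (K1 := ex_derive_continuous _ x (ex_intro _ _ H1)).
  assert (K2 := ex_derive_continuous _ x (ex_intro _ _ H2)).
  specialize (K1 _ (locally_ball (Re (f x)) e)).
  specialize (K2 _ (locally_ball (Im (f x)) e)).
  change (locally x (fun t => ball (Re (f x)) e (Re (f t)))) in K1.
  change (locally x (fun t => ball (Im (f x)) e (Im (f t)))) in K2.
  generalize (filter_and _ _ K1 K2). apply filter_imp. intros t [A B].
  apply He. split; [exact A|exact B].
Qed.

Lemma Cdiff_mult (f g : R -> C) (x : R) :
  Cdiff f x -> Cdiff g x -> Cdiff (fun t => f t * g t) x.
Proof. intros [l Hl] [m Hm]. eexists. apply Cder_mult; eassumption. Qed.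

Lemma Cdiff_plus (f g : R -> C) (x : R) :
  Cdiff f x -> Cdiff g x -> Cdiff (fun t => f t + g t) x.
Proof. intros [l Hl] [m Hm]. eexists. apply Cder_plus; eassumption. Qed.

Lemma Cdiff_minus (f g : R -> C) (x : R) :
  Cdiff f x -> Cdiff g x -> Cdiff (fun t => f t - g t) x.
Proof. intros [l Hl] [m Hm]. eexists. apply Cder_minus; eassumption. Qed.

Lemma Cdiff_RtoC (f : R -> R) (x : R) : ex_derive f x -> Cdiff (fun t => RtoC (f t)) x.
Proof. intros [l Hl]. exists (RtoC l). apply Cder_RtoC, Hl. Qed.

Lemma Cdiff_const (c : C) (x : R) : Cdiff (fun _ => c) x.
Proof. exists (RtoC 0). apply Cder_const. Qed.

Lemma Cdiff_sum (f : nat -> R -> C) (x : R) (n : nat) :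
  (forall k, Cdiff (f k) x) -> Cdiff (fun t => Csum (fun k => f k t) 0 n) x.
Proof.
  intros H. induction n as [|n [l IH]].
  - destruct (H O) as [l Hl]. exists l. refine (Cder_ext_loc _ _ _ _ _ Hl).
    apply filter_forall. intros t. rewrite Csum_O. reflexivity.
  - destruct (H (S n)) as [m Hm]. exists (l + m).
    refine (Cder_ext_loc _ _ _ _ _ (Cder_plus _ _ _ _ _ IH Hm)).
    apply filter_forall. intros t. rewrite Csum_S by lia. reflexivity.
Qed.

(* The real mean value theorem for the real part of [conj (h y - h x) * h]. *)
Lemma Cmod_mean_value (h dh : R -> C) (D x y : R) :
  (x <= y)%R ->
  (forall t, (x <= t <= y)%R -> Cder h t (dh t) /\ (Cmod (dh t) <= D)%R) ->
  (Cmod (h y - h x) <= D * (y - x))%R.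
Proof.
  intros Hxy H. set (d := h y - h x).
  destruct (Req_dec (Cmod d) 0) as [E|E].
  { rewrite E. assert (0 <= D)%R.
    { apply Rle_trans with (1 := Cmod_ge_0 (dh x)). apply H. lra. }
    apply Rmult_le_pos; lra. }
  assert (Hd : (0 < Cmod d)%R) by (pose proof (Cmod_ge_0 d); lra).
  set (phi := fun t => Re (Cconj d * h t)).
  set (dphi := fun t => Re (Cconj d * dh t)).
  assert (A : forall t, (x <= t <= y)%R -> is_derive phi t (dphi t)).
  { intros t Ht. apply (Cder_scal (Cconj d) h t (dh t)), H, Ht. }
  destruct (MVT_gen phi x y dphi) as [c [Hc Ec]].
  { intros t. rewrite Rmin_left, Rmax_right by lra. intros Ht. apply A. lra. }
  { intros t. rewrite Rmin_left, Rmax_right by lra. intros Ht.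
    apply derivable_continuous_pt. exists (dphi t). apply is_derive_Reals, A, Ht. }
  rewrite Rmin_left, Rmax_right in Hc by lra.
  assert (B : (phi y - phi x = Cmod d * Cmod d)%R).
  { unfold Cmod. rewrite sqrt_sqrt by nra.
    unfold phi, d. destruct (h y), (h x). simpl. ring. }
  assert (K : (dphi c <= Cmod d * D)%R).
  { unfold dphi. apply Rle_trans with (1 := Rle_abs _).
    apply Rle_trans with (1 := re_le_Cmod _). rewrite Cmod_mult, Cmod_conj.
    apply Rmult_le_compat_l; [apply Cmod_ge_0|]. apply H. lra. }
  apply Rmult_le_reg_l with (1 := Hd). rewrite <- B, Ec.
  rewrite <- Rmult_assoc. apply Rmult_le_compat_r; lra.
Qed.

(** * Limits *)

(** The balls of the product uniform structure on [C] are squares. Limits are phrased with [Cmod]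
    instead, for its multiplicativity and the triangle inequality; [Cmod_lt_ball] and [ball_Cmod_lt]
    translate. *)
Definition Ctends {T : Type} (F : (T -> Prop) -> Prop) (f : T -> C) (l : C) : Prop :=
  forall eps : R, (0 < eps)%R -> F (fun t => (Cmod (f t - l) < eps)%R).

Section Ctends.
Context {T : Type} {F : (T -> Prop) -> Prop} {FF : Filter F}.

Lemma Ctends_ext (f g : T -> C) (l : C) :
  F (fun t => f t = g t) -> Ctends F f l -> Ctends F g l.
Proof.
  intros E H eps He. generalize (filter_and _ _ E (H eps He)).
  apply filter_imp. intros t [<- A]. exact A.
Qed.

Lemma Ctends_eq (f : T -> C) (l l' : C) : Ctends F f l -> l = l' -> Ctends F f l'.
Proof. intros H <-. exact H. Qed.

Lemma Ctends_squeeze (f : T -> C) (g : T -> R) (l : C) :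
  F (fun t => (Cmod (f t - l) <= g t)%R) -> filterlim g F (locally 0%R) -> Ctends F f l.
Proof.
  intros E H eps He.
  specialize (H _ (locally_ball 0%R (mkposreal eps He))).
  change (F (fun t => ball 0%R eps (g t))) in H.
  generalize (filter_and _ _ E H). apply filter_imp. intros t [A B].
  apply Rle_lt_trans with (1 := A).
  apply Rle_lt_trans with (1 := Rle_abs _).
  change (Rabs (g t - 0) < eps)%R in B. rewrite Rminus_0_r in B. exact B.
Qed.

Lemma Ctends_const (c : C) : Ctends F (fun _ => c) c.
Proof.
  intros eps He. apply filter_forall. intros _.
  replace (c - c) with (RtoC 0) by ring. rewrite Cmod_0. exact He.
Qed.

Lemma Ctends_plus (f g : T -> C) (l m : C) :
  Ctends F f l -> Ctends F g m -> Ctends F (fun t => f t + g t) (l + m).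
Proof.
  intros Hf Hg eps He.
  assert (He2 : (0 < eps / 2)%R) by lra.
  generalize (filter_and _ _ (Hf _ He2) (Hg _ He2)). apply filter_imp. intros t [A B].
  replace (f t + g t - (l + m)) with ((f t - l) + (g t - m)) by ring.
  apply Rle_lt_trans with (1 := Cmod_triangle _ _). lra.
Qed.

Lemma Ctends_scal (c : C) (f : T -> C) (l : C) :
  Ctends F f l -> Ctends F (fun t => c * f t) (c * l).
Proof.
  intros Hf eps He.
  assert (Hc := Cmod_ge_0 c).
  assert (He2 : (0 < eps / (Cmod c + 1))%R) by (apply Rdiv_lt_0_compat; lra).
  generalize (Hf _ He2). apply filter_imp. intros t A.
  replace (c * f t - c * l) with (c * (f t - l)) by ring. rewrite Cmod_mult.
  apply Rle_lt_trans with ((Cmod c) * (eps / (Cmod c + 1)))%R.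
  - apply Rmult_le_compat_l; lra.
  - apply Rlt_le_trans with ((Cmod c + 1) * (eps / (Cmod c + 1)))%R.
    + apply Rmult_lt_compat_r; lra.
    + right. field. lra.
Qed.

Lemma Ctends_minus (f g : T -> C) (l m : C) :
  Ctends F f l -> Ctends F g m -> Ctends F (fun t => f t - g t) (l - m).
Proof.
  intros Hf Hg. apply Ctends_ext with (fun t => f t + (- (1)) * g t).
  - apply filter_forall. intros t. ring.
  - apply Ctends_eq with (l + (- (1)) * m); [|ring].
    apply Ctends_plus; [exact Hf|apply Ctends_scal, Hg].
Qed.

Lemma Ctends_sum (f : nat -> T -> C) (l : nat -> C) (n : nat) :
  (forall k, (k <= n)%nat -> Ctends F (f k) (l k)) ->
  Ctends F (fun t => Csum (fun k => f k t) 0 n) (Csum l 0 n).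
Proof.
  intros H. induction n as [|n IH].
  - rewrite Csum_O. apply Ctends_ext with (f O); [|apply H; lia].
    apply filter_forall. intros t. rewrite Csum_O. reflexivity.
  - rewrite Csum_S by lia.
    apply Ctends_ext with (fun t => Csum (fun k => f k t) 0 n + f (S n) t).
    + apply filter_forall. intros t. rewrite Csum_S by lia. reflexivity.
    + apply Ctends_plus; [apply IH; intros; apply H; lia|apply H; lia].
Qed.

Lemma Ctends_RtoC (f : T -> R) (l : R) :
  filterlim f F (locally l) -> Ctends F (fun t => RtoC (f t)) (RtoC l).
Proof.
  intros H eps He.
  specialize (H _ (locally_ball l (mkposreal eps He))).
  change (F (fun t => ball l eps (f t))) in H. revert H. apply filter_imp. intros t A.
  rewrite <- RtoC_minus, Cmod_R. exact A.
Qed.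

Lemma Ctends_mult_0 (f g : T -> C) (D : R) :
  F (fun t => (Cmod (g t) <= D)%R) -> Ctends F f 0 -> Ctends F (fun t => f t * g t) 0.
Proof.
  intros HD Hf eps He.
  assert (He2 : (0 < eps / (Rabs D + 1))%R).
  { apply Rdiv_lt_0_compat; [exact He|]. pose proof (Rabs_pos D). lra. }
  generalize (filter_and _ _ HD (Hf _ He2)). apply filter_imp. intros t [A B].
  replace (f t * g t - 0) with (f t * g t) by ring. rewrite Cmod_mult.
  replace (f t - 0) with (f t) in B by ring.
  pose proof (Cmod_ge_0 (f t)). pose proof (Cmod_ge_0 (g t)).
  pose proof (Rle_abs D). pose proof (Rabs_pos D).
  apply Rle_lt_trans with (Cmod (f t) * (Rabs D + 1))%R.
  { apply Rmult_le_compat_l; lra. }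
  replace eps with (eps / (Rabs D + 1) * (Rabs D + 1))%R by (field; lra).
  apply Rmult_lt_compat_r; lra.
Qed.

End Ctends.

Lemma Ctends_unique {T : Type} {F : (T -> Prop) -> Prop} {FF : ProperFilter F}
  (f : T -> C) (l m : C) : Ctends F f l -> Ctends F f m -> l = m.
Proof.
  intros Hl Hm.
  destruct (Req_dec (Cmod (l - m)) 0) as [E|E].
  - apply Cmod_eq_0 in E. replace l with (l - m + m) by ring. rewrite E. ring.
  - assert (Hd : (0 < Cmod (l - m) / 2)%R) by (pose proof (Cmod_ge_0 (l - m)); lra).
    destruct (filter_ex _ (filter_and _ _ (Hl _ Hd) (Hm _ Hd))) as [t [A B]].
    exfalso. pose proof (Cmod_triangle (f t - m) (- (f t - l))) as K.
    rewrite Cmod_opp in K. replace (f t - m + - (f t - l)) with (l - m) in K by ring. lra.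
Qed.

(** * Improper integrals of complex functions over the positive half-line *)

Definition CRInt (f : R -> C) (a b : R) (l : C) : Prop :=
  is_RInt (V := C_R_NormedModule) f a b l.

Definition CInt (f : R -> C) (l : C) : Prop :=
  is_RInt_gen (V := C_R_CompleteNormedModule) f (at_right 0) (Rbar_locally p_infty) l.

Lemma CRInt_pair (f : R -> C) (a b : R) (l : C) :
  is_RInt (fun t => Re (f t)) a b (Re l) -> is_RInt (fun t => Im (f t)) a b (Im l) ->
  CRInt f a b l.
Proof.
  intros H1 H2. destruct l as [l1 l2].
  exact (is_RInt_fct_extend_pair (U := R_NormedModule) (V := R_NormedModule) f a b l1 l2 H1 H2).
Qed.

Lemma CRInt_re (f : R -> C) (a b : R) (l : C) :
  CRInt f a b l -> is_RInt (fun t => Re (f t)) a b (Re l).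
Proof. exact (is_RInt_fct_extend_fst (U := R_NormedModule) (V := R_NormedModule) f a b l). Qed.

Lemma CRInt_im (f : R -> C) (a b : R) (l : C) :
  CRInt f a b l -> is_RInt (fun t => Im (f t)) a b (Im l).
Proof. exact (is_RInt_fct_extend_snd (U := R_NormedModule) (V := R_NormedModule) f a b l). Qed.

Lemma CRInt_scal (c : C) (f : R -> C) (a b : R) (l : C) :
  CRInt f a b l -> CRInt (fun t => c * f t) a b (c * l).
Proof.
  intros H. pose proof (CRInt_re _ _ _ _ H) as H1. pose proof (CRInt_im _ _ _ _ H) as H2.
  apply CRInt_pair.
  - exact (is_RInt_minus _ _ a b _ _ (is_RInt_scal _ a b (Re c) _ H1) (is_RInt_scal _ a b (Im c) _ H2)).
  - exact (is_RInt_plus _ _ a b _ _ (is_RInt_scal _ a b (Re c) _ H2) (is_RInt_scal _ a b (Im c) _ H1)).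
Qed.

Lemma CRInt_plus (f g : R -> C) (a b : R) (l m : C) :
  CRInt f a b l -> CRInt g a b m -> CRInt (fun t => f t + g t) a b (l + m).
Proof. exact (is_RInt_plus (V := C_R_NormedModule) f g a b l m). Qed.

Lemma CRInt_ext (f g : R -> C) (a b : R) (l : C) :
  (a <= b)%R -> (forall t, (a < t < b)%R -> f t = g t) -> CRInt f a b l -> CRInt g a b l.
Proof.
  intros Hab H. apply (is_RInt_ext (V := C_R_NormedModule)).
  rewrite Rmin_left, Rmax_right by exact Hab. exact H.
Qed.

Lemma CRInt_derive (F f : R -> C) (a b : R) :
  (a <= b)%R -> (forall t, (a <= t <= b)%R -> Cder F t (f t)) ->
  (forall t, (a <= t <= b)%R -> Cdiff f t) -> CRInt f a b (F b - F a).
Proof.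
  intros Hab HF Hf. apply CRInt_pair.
  - apply (is_RInt_derive (V := R_CompleteNormedModule) (fun t => Re (F t)) (fun t => Re (f t)));
      rewrite Rmin_left, Rmax_right by exact Hab; intros t Ht.
    + apply HF, Ht.
    + destruct (Hf t Ht) as [l [H1 H2]]. exact (ex_derive_continuous (V := R_NormedModule) _ t (ex_intro _ _ H1)).
  - apply (is_RInt_derive (V := R_CompleteNormedModule) (fun t => Im (F t)) (fun t => Im (f t)));
      rewrite Rmin_left, Rmax_right by exact Hab; intros t Ht.
    + apply HF, Ht.
    + destruct (Hf t Ht) as [l [H1 H2]]. exact (ex_derive_continuous (V := R_NormedModule) _ t (ex_intro _ _ H2)).
Qed.

Lemma Cmod_lt_ball (x y : C) (eps : posreal) :
  (Cmod (y - x) < eps)%R -> ball (M := C_UniformSpace) x eps y.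
Proof.
  intros H. split.
  - apply Rle_lt_trans with (2 := H). exact (Rle_trans _ _ _ (Rmax_l _ _) (Rmax_Cmod (y - x))).
  - apply Rle_lt_trans with (2 := H). exact (Rle_trans _ _ _ (Rmax_r _ _) (Rmax_Cmod (y - x))).
Qed.

(** The modulus is at most [sqrt 2] times the larger coordinate; 2 is a rounder constant. *)
Lemma ball_Cmod_lt (x y : C) (eps : posreal) :
  ball (M := C_UniformSpace) x eps y -> (Cmod (y - x) < 2 * eps)%R.
Proof.
  intros [H1 H2]. change (Rabs (Re (y - x)%C) < eps)%R in H1. change (Rabs (Im (y - x)%C) < eps)%R in H2.
  apply Rle_lt_trans with (1 := Cmod_2Rmax _).
  assert (A : (sqrt 2 <= 2)%R).
  { rewrite <- (sqrt_square 2) at 2 by lra. apply sqrt_le_1_alt. lra. }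
  assert (B : (Rmax (Rabs (Re (y - x)%C)) (Rabs (Im (y - x)%C)) < eps)%R)
    by (apply Rmax_lub_lt; assumption).
  change (sqrt 2 * Rmax (Rabs (Re (y - x)%C)) (Rabs (Im (y - x)%C)) < 2 * eps)%R.
  pose proof (Rle_trans _ _ _ (Rabs_pos _) (Rmax_l (Rabs (Re (y - x)%C)) (Rabs (Im (y - x)%C)))).
  assert (0 < sqrt 2)%R by (apply sqrt_lt_R0; lra). nra.
Qed.

(** The filters leave the endpoints unordered; the clause [a <= b] is included because the estimates
    on compact intervals need it. *)
Lemma CInt_iff (f : R -> C) (l : C) :
  CInt f l <->
  forall eps : R, (0 < eps)%R -> exists (d B : R), (0 < d)%R /\
    forall a b, (0 < a < d)%R -> (B < b)%R -> (a <= b)%R /\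
      exists I, CRInt f a b I /\ (Cmod (I - l) < eps)%R.
Proof.
  split.
  - intros H eps He.
    assert (He2 : (0 < eps / 2)%R) by lra.
    destruct (H _ (locally_ball (T := C_UniformSpace) l (mkposreal _ He2))) as [P Q [d Hd] [B HB] K].
    (* These bounds place 1 between the endpoints, whence [a <= b]. *)
    exists (Rmin d 1), (Rmax B 1). split; [apply Rmin_pos; [apply d|lra]|].
    intros a b Ha Hb.
    pose proof (Rmin_l d 1). pose proof (Rmin_r d 1). pose proof (Rmax_l B 1). pose proof (Rmax_r B 1).
    split; [lra|].
    destruct (K a b) as [I [HI1 HI2]].
    + apply Hd; [|lra]. change (Rabs (a - 0) < d)%R. rewrite Rminus_0_r, Rabs_pos_eq; lra.
    + apply HB. lra.
    + exists I. split; [exact HI1|]. apply ball_Cmod_lt in HI2. simpl in HI2. lra.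
  - intros H P [e He].
    destruct (H e (cond_pos e)) as [d [B [Hd K]]].
    exists (fun a => (0 < a < d)%R) (fun b => (B < b)%R).
    + exists (mkposreal d Hd). intros y Hy Hy2. change (Rabs (y - 0) < d)%R in Hy.
      rewrite Rminus_0_r, Rabs_pos_eq in Hy; lra.
    + exists B. intros x Hx. exact Hx.
    + intros a b Ha Hb. destruct (K a b Ha Hb) as [_ [I [HI1 HI2]]].
      exists I. split; [exact HI1|]. apply He. apply Cmod_lt_ball. exact HI2.
Qed.

Lemma CInt_ext (f g : R -> C) (l : C) :
  (forall t, (0 < t)%R -> f t = g t) -> CInt f l -> CInt g l.
Proof.
  intros E H. apply CInt_iff. intros eps He.
  destruct (proj1 (CInt_iff f l) H eps He) as [d [B [Hd K]]].
  exists d, B. split; [exact Hd|]. intros a b Ha Hb.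
  destruct (K a b Ha Hb) as [Hab [I [HI1 HI2]]]. split; [exact Hab|].
  exists I. split; [|exact HI2]. apply CRInt_ext with f; [exact Hab| |exact HI1].
  intros t Ht. apply E. lra.
Qed.

Lemma CInt_eq (f : R -> C) (l l' : C) : CInt f l -> l = l' -> CInt f l'.
Proof. intros H <-. exact H. Qed.

Lemma CInt_plus (f g : R -> C) (l m : C) :
  CInt f l -> CInt g m -> CInt (fun t => f t + g t) (l + m).
Proof.
  intros Hf Hg.
  exact (is_RInt_gen_plus (V := C_R_CompleteNormedModule) (Fa := at_right 0)
           (Fb := Rbar_locally p_infty) f g l m Hf Hg).
Qed.

Lemma CInt_scal (c : C) (f : R -> C) (l : C) : CInt f l -> CInt (fun t => c * f t) (c * l).
Proof.
  intros H. apply CInt_iff. intros eps He.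
  assert (Hc := Cmod_ge_0 c).
  assert (He2 : (0 < eps / (Cmod c + 1))%R) by (apply Rdiv_lt_0_compat; lra).
  destruct (proj1 (CInt_iff f l) H _ He2) as [d [B [Hd K]]].
  exists d, B. split; [exact Hd|]. intros a b Ha Hb.
  destruct (K a b Ha Hb) as [Hab [I [HI1 HI2]]]. split; [exact Hab|].
  exists (c * I). split; [apply CRInt_scal, HI1|].
  replace (c * I - c * l) with (c * (I - l)) by ring. rewrite Cmod_mult.
  apply Rle_lt_trans with ((Cmod c) * (eps / (Cmod c + 1)))%R.
  - apply Rmult_le_compat_l; lra.
  - apply Rlt_le_trans with ((Cmod c + 1) * (eps / (Cmod c + 1)))%R.
    + apply Rmult_lt_compat_r; lra.
    + right. field. lra.
Qed.

Lemma CInt_minus (f g : R -> C) (l m : C) :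
  CInt f l -> CInt g m -> CInt (fun t => f t - g t) (l - m).
Proof.
  intros Hf Hg. apply CInt_ext with (fun t => f t + (- (1)) * g t).
  - intros t _. ring.
  - apply CInt_eq with (l + (- (1)) * m); [|ring]. apply CInt_plus; [exact Hf|apply CInt_scal, Hg].
Qed.

Lemma CInt_RInt_gen (f : R -> C) (l : C) :
  CInt f l ->
  RInt_gen (V := C_R_CompleteNormedModule) f (at_right 0) (Rbar_locally p_infty) = l.
Proof. intros H. exact (is_RInt_gen_unique (V := C_R_CompleteNormedModule) f l H). Qed.

Lemma CInt_unique (f : R -> C) (l m : C) : CInt f l -> CInt f m -> l = m.
Proof. intros Hl Hm. rewrite <- (CInt_RInt_gen f l Hl). apply CInt_RInt_gen, Hm. Qed.

Lemma CInt_derive (F f : R -> C) (A B : C) :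
  (forall t, (0 < t)%R -> Cder F t (f t)) ->
  (forall t, (0 < t)%R -> Cdiff f t) ->
  Ctends (at_right 0) F A -> Ctends (Rbar_locally p_infty) F B ->
  CInt f (B - A).
Proof.
  intros HF Hf HA HB. apply CInt_iff. intros eps He.
  assert (He2 : (0 < eps / 2)%R) by lra.
  destruct (HA _ He2) as [d Hd]. destruct (HB _ He2) as [M HM].
  exists d, (Rmax M d). split; [apply d|]. intros a b Ha Hb.
  pose proof (Rmax_l M d). pose proof (Rmax_r M d). split; [lra|].
  exists (F b - F a). split.
  - apply CRInt_derive; [lra| |]; intros t Ht; [apply HF|apply Hf]; lra.
  - replace (F b - F a - (B - A)) with ((F b - B) + - (F a - A)) by ring.
    apply Rle_lt_trans with (1 := Cmod_triangle _ _). rewrite Cmod_opp.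
    assert (K1 := HM b). assert (K2 := Hd a).
    assert (K3 : (Cmod (F a - A) < eps / 2)%R).
    { apply K2; [|lra]. change (Rabs (a - 0) < d)%R. rewrite Rminus_0_r, Rabs_pos_eq; lra. }
    assert (K4 : (Cmod (F b - B) < eps / 2)%R) by (apply K1; lra). lra.
Qed.

(** * Exponential majorants *)

(** [exp (s t) > 1 + s t], which exceeds [1 / eps] once [t > 1 / (s eps)]. *)
Lemma exp_decay (s eps : R) :
  (0 < s)%R -> (0 < eps)%R -> exists B : R, (0 < B)%R /\ forall t, (B < t)%R -> (exp (- s * t) < eps)%R.
Proof.
  intros Hs He. exists (/ (s * eps))%R.
  assert (Hse : (0 < s * eps)%R) by (apply Rmult_lt_0_compat; assumption).
  split; [apply Rinv_0_lt_compat, Hse|]. intros t Ht.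
  assert (Ht0 : (0 < t)%R) by (pose proof (Rinv_0_lt_compat _ Hse); lra).
  replace (- s * t)%R with (- (s * t))%R by ring. rewrite exp_Ropp.
  rewrite <- (Rinv_inv eps). apply Rinv_lt_contravar.
  - apply Rmult_lt_0_compat; [apply Rinv_0_lt_compat, He|apply exp_pos].
  - assert (H1 : (1 + s * t < exp (s * t))%R).
    { apply exp_ineq1. apply Rgt_not_eq, Rmult_lt_0_compat; assumption. }
    assert (H2 : (/ eps = s * (/ (s * eps)))%R) by (field; lra).
    assert (H3 : (s * / (s * eps) < s * t)%R) by (apply Rmult_lt_compat_l; assumption). lra.
Qed.

Lemma exp_pow_INR (x : R) (n : nat) : (exp x ^ n = exp (INR n * x))%R.
Proof.
  induction n as [|n IH].
  - simpl. rewrite Rmult_0_l, exp_0. reflexivity.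
  - rewrite S_INR, Rmult_plus_distr_r, exp_plus, <- IH, Rmult_1_l. simpl. ring.
Qed.

Lemma exp_nonneg_ge_1 (x : R) : (0 <= x)%R -> (1 <= exp x)%R.
Proof. intros H. pose proof (exp_ineq1_le x). lra. Qed.

(** The inequality [x <= exp x] at [x = a t / m], raised to the power [m]. *)
Lemma pow_le_exp (m : nat) (a t : R) :
  (0 < a)%R -> (0 <= t)%R -> (t ^ m <= (INR m / a) ^ m * exp (a * t))%R.
Proof.
  intros Ha Ht. destruct m as [|m].
  - simpl. rewrite Rmult_1_l. apply exp_nonneg_ge_1. nra.
  - assert (HM : (0 < INR (S m))%R) by (apply lt_0_INR; lia).
    set (x := (a * t / INR (S m))%R).
    assert (Hx : (0 <= x)%R).
    { apply Rmult_le_pos; [nra|left; apply Rinv_0_lt_compat, HM]. }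
    replace (exp (a * t)) with (exp x ^ S m)%R.
    2:{ rewrite exp_pow_INR. f_equal. unfold x. field. lra. }
    rewrite <- Rpow_mult_distr. apply pow_incr. split; [exact Ht|].
    replace t with (INR (S m) / a * x)%R at 1 by (unfold x; field; lra).
    apply Rmult_le_compat_l.
    + left. apply Rdiv_lt_0_compat; lra.
    + pose proof (exp_ineq1_le x). lra.
Qed.

Lemma norm_Cmod (z : C) : norm (V := C_R_NormedModule) z = Cmod z.
Proof.
  change (sqrt (Rabs (fst z) ^ 2 + Rabs (snd z) ^ 2) = Cmod z).
  rewrite !pow2_abs. reflexivity.
Qed.

(** The bound is the integral of the majorant; keeping it as a difference of endpoint values
    controls both the piece near 0 and the tail. *)
Lemma CRInt_exists_bound (f : R -> C) (K s x y : R) :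
  (0 < s)%R -> (0 < x <= y)%R ->
  (forall t, (0 < t)%R -> Cdiff f t) ->
  (forall t, (0 < t)%R -> (Cmod (f t) <= K * exp (- s * t))%R) ->
  exists I, CRInt f x y I /\ (Cmod I <= K / s * exp (- s * x) - K / s * exp (- s * y))%R.
Proof.
  intros Hs Hxy Hf HK.
  destruct (ex_RInt_continuous (V := C_R_CompleteNormedModule) f x y) as [I HI].
  { rewrite Rmin_left, Rmax_right by lra. intros z Hz. apply Cdiff_cont, Hf. lra. }
  exists I. split; [exact HI|].
  rewrite <- norm_Cmod.
  apply (norm_RInt_le (V := C_R_NormedModule) f (fun t => (K * exp (- s * t))%R) x y I); [lra| |exact HI|].
  - intros t Ht. rewrite norm_Cmod. apply HK. lra.
  - replace (K / s * exp (- s * x) - K / s * exp (- s * y))%R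
      with (minus ((- K / s * exp (- s * y))%R : R_CompleteNormedModule) (- K / s * exp (- s * x))%R)
      by (unfold minus, plus, opp; simpl; field; lra).
    apply (is_RInt_derive (V := R_CompleteNormedModule) (fun t => (- K / s * exp (- s * t))%R)).
    + intros t _. auto_derive; [easy|field; lra].
    + intros t _. apply (ex_derive_continuous (V := R_NormedModule)). auto_derive. easy.
Qed.

(** Cauchy's criterion: all integrals over [(a, b)] are compared with the one over [(d, M)]. The
    piece near 0 costs at most [K * d], the tail at most [K / s * exp (- s * M)]. *)
Lemma CInt_dominated (f : R -> C) (K s : R) :
  (0 < s)%R -> (forall t, (0 < t)%R -> Cdiff f t) ->
  (forall t, (0 < t)%R -> (Cmod (f t) <= K * exp (- s * t))%R) ->
  exists l, CInt f l /\ (Cmod l <= K / s)%R.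
Proof.
  intros Hs Hf HK.
  assert (HK0 : (0 <= K)%R).
  { pose proof (HK 1%R Rlt_0_1) as H. pose proof (Cmod_ge_0 (f 1%R)). pose proof (exp_pos (- s * 1)).
    destruct (Rle_dec 0 K) as [A|A]; [exact A|exfalso; nra]. }
  assert (HKs : (0 <= K / s)%R) by (apply Rmult_le_pos; [exact HK0|left; apply Rinv_0_lt_compat, Hs]).
  set (F := filter_prod (at_right 0) (Rbar_locally p_infty)).
  set (g := fun ab : R * R => RInt (V := C_R_CompleteNormedModule) f (fst ab) (snd ab)).
  assert (HF : ProperFilter F) by (unfold F; apply _).
  assert (HI : forall x y, (0 < x <= y)%R -> CRInt f x y (g (x, y)) /\
            (Cmod (g (x, y)) <= K / s * exp (- s * x) - K / s * exp (- s * y))%R).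
  { intros x y Hxy. destruct (CRInt_exists_bound f K s x y Hs Hxy Hf HK) as [I [H1 H2]].
    assert (E : g (x, y) = I) by exact (is_RInt_unique (V := C_R_CompleteNormedModule) f x y I H1).
    rewrite E. split; assumption. }
  assert (HC : exists l : C_R_CompleteNormedModule, filterlim g F (locally l)).
  { apply (filterlim_locally_cauchy (U := C_R_CompleteNormedModule) (F := F) g).
    intros eps.
    (* The piece near 0 and the tail are each allowed [eps / 4]; the added 1 keeps the denominators
       positive when [K = 0]. *)
    assert (He : (0 < eps / (4 * (K / s + 1)))%R).
    { apply Rdiv_lt_0_compat; [apply cond_pos|]. lra. }
    destruct (exp_decay s _ Hs He) as [B [HB0 HB]].
    assert (Hd : (0 < eps / (4 * (K + 1)))%R).
    { apply Rdiv_lt_0_compat; [apply cond_pos|]. lra. }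
    set (d := (eps / (4 * (K + 1)))%R) in *. set (M := (Rmax B d + 1)%R).
    pose proof (Rmax_l B d) as HM1. pose proof (Rmax_r B d) as HM2.
    exists (fun ab => (0 < fst ab < d)%R /\ (M < snd ab)%R). split.
    - exists (fun a => (0 < a < d)%R) (fun b => (M < b)%R).
      + exists (mkposreal d Hd). intros y Hy Hy2. change (Rabs (y - 0) < d)%R in Hy.
        rewrite Rminus_0_r, Rabs_pos_eq in Hy; lra.
      + exists M. intros x Hx. exact Hx.
      + intros a b Ha Hb. split; assumption.
    - assert (P : forall a b, (0 < a < d)%R -> (M < b)%R ->
                (Cmod (g (a, b) - g (d, M)) < eps / 2)%R).
      { intros a b Ha Hb. unfold M in *.
        destruct (HI a d) as [I1 B1]; [lra|]. destruct (HI d (Rmax B d + 1)%R) as [I2 _]; [lra|].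
        destruct (HI (Rmax B d + 1)%R b) as [I3 B3]; [lra|].
        pose proof (is_RInt_Chasles (V := C_R_NormedModule) f _ _ _ _ _ I1 I2) as I4.
        pose proof (is_RInt_Chasles (V := C_R_NormedModule) f _ _ _ _ _ I4 I3) as I5.
        assert (E : g (a, b) = g (a, d) + g (d, (Rmax B d + 1)%R) + g ((Rmax B d + 1)%R, b))
          by exact (is_RInt_unique (V := C_R_CompleteNormedModule) f a b _ I5).
        rewrite E.
        replace (g (a, d) + g (d, (Rmax B d + 1)%R) + g ((Rmax B d + 1)%R, b) - g (d, (Rmax B d + 1)%R))
          with (g (a, d) + g ((Rmax B d + 1)%R, b)) by ring.
        apply Rle_lt_trans with (1 := Cmod_triangle _ _).
        assert (L1 : (K / s * exp (- s * a) - K / s * exp (- s * d) <= K * d)%R).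
        { assert (exp (- s * a) <= 1)%R.
          { rewrite <- exp_0. left. apply exp_increasing. nra. }
          pose proof (exp_ineq1_le (- s * d)).
          replace (K * d)%R with (K / s * (s * d))%R by (field; lra). nra. }
        assert (L2 : (K * d < eps / 4)%R).
        { unfold d. replace (eps / 4)%R with ((K + 1) * (eps / (4 * (K + 1))))%R by (field; lra).
          apply Rmult_lt_compat_r; [exact Hd|lra]. }
        assert (L3 : (K / s * exp (- s * (Rmax B d + 1)) <= eps / 4)%R).
        { apply Rle_trans with ((K / s + 1) * (eps / (4 * (K / s + 1))))%R.
          - apply Rmult_le_compat; [exact HKs|left; apply exp_pos|lra|].
            left. apply HB. lra.
          - right. field. split; lra. }
        pose proof (Rmult_le_pos _ _ HKs (Rlt_le _ _ (exp_pos (- s * b)))). lra. }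
      intros [a b] [a' b'] [Ha Hb] [Ha' Hb']. simpl in Ha, Hb, Ha', Hb'.
      apply Cmod_lt_ball.
      replace (g (a', b') - g (a, b)) with ((g (a', b') - g (d, M)) + - (g (a, b) - g (d, M))) by ring.
      apply Rle_lt_trans with (1 := Cmod_triangle _ _). rewrite Cmod_opp.
      pose proof (P a b Ha Hb). pose proof (P a' b' Ha' Hb'). lra. }
  destruct HC as [l Hl]. exists l.
  assert (H : CInt f l).
  { intros P HP. specialize (Hl P HP). change (F (fun ab => P (g ab))) in Hl.
    assert (Hpos : F (fun ab => (0 < fst ab <= snd ab)%R)).
    { exists (fun a => (0 < a < 1)%R) (fun b => (1 < b)%R).
      - exists (mkposreal 1 Rlt_0_1). intros y Hy Hy2. change (Rabs (y - 0) < 1)%R in Hy.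
        rewrite Rminus_0_r, Rabs_pos_eq in Hy; lra.
      - exists 1%R. intros x Hx. exact Hx.
      - simpl. intros a b Ha Hb. lra. }
    unfold filtermapi. generalize (filter_and _ _ Hl Hpos). apply filter_imp.
    intros [a b] [A1 A2]. exists (g (a, b)). split; [|exact A1].
    apply (HI a b). exact A2. }
  split; [exact H|].
  (* Every integral over a compact interval has modulus at most [K / s], so none of them comes
     within [Cmod l - K / s] of a larger limit [l]. *)
  apply Rnot_lt_le. intros Hlt.
  assert (He : (0 < Cmod l - K / s)%R) by lra.
  destruct (proj1 (CInt_iff f l) H _ He) as [d [B [Hd Q]]].
  destruct (Q (d / 2)%R (Rmax B d + 1)%R) as [_ [I [HI1 HI2]]].
  { lra. } { pose proof (Rmax_l B d). lra. }
  pose proof (Rmax_r B d).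
  destruct (HI (d / 2)%R (Rmax B d + 1)%R) as [HI3 HI4]; [lra|].
  assert (E : g ((d / 2)%R, (Rmax B d + 1)%R) = I)
    by exact (is_RInt_unique (V := C_R_CompleteNormedModule) f _ _ I HI1).
  rewrite E in HI4.
  assert (exp (- s * (d / 2)) <= 1)%R.
  { rewrite <- exp_0. left. apply exp_increasing. nra. }
  pose proof (Rmult_le_pos _ _ HKs (Rlt_le _ _ (exp_pos (- s * (Rmax B d + 1))))).
  pose proof (Cmod_triangle (- (I - l)) I) as T.
  assert (E2 : - (I - l) + I = l) by (clear; revert I l; intros x y; change (- (x - y) + x = y :> C); ring).
  rewrite E2 in T.
  rewrite Cmod_opp in T. nra.
Qed.

Lemma Ctends_p_infty (f : R -> C) (K s : R) :
  (0 < s)%R -> (forall t, (0 < t)%R -> (Cmod (f t) <= K * exp (- s * t))%R) ->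
  Ctends (Rbar_locally p_infty) f 0.
Proof.
  intros Hs HK eps He.
  assert (Hp : (0 < eps / (Rabs K + 1))%R).
  { apply Rdiv_lt_0_compat; [exact He|]. pose proof (Rabs_pos K). lra. }
  destruct (exp_decay s _ Hs Hp) as [B [HB0 HB]].
  exists B. intros t Ht. replace (f t - 0) with (f t) by ring.
  apply Rle_lt_trans with (1 := HK t ltac:(lra)).
  pose proof (HB t Ht). pose proof (exp_pos (- s * t)). pose proof (Rle_abs K). pose proof (Rabs_pos K).
  replace eps with ((Rabs K + 1) * (eps / (Rabs K + 1)))%R by (field; lra). nra.
Qed.

Lemma Ctends_0_linear (f : R -> C) (l : C) (K r : R) :
  (0 < r)%R -> (forall t, (0 < t < r)%R -> (Cmod (f t - l) <= K * t)%R) ->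
  Ctends (at_right 0) f l.
Proof.
  intros Hr HK eps He.
  assert (Hp : (0 < Rmin r (eps / (Rabs K + 1)))%R).
  { apply Rmin_pos; [exact Hr|]. apply Rdiv_lt_0_compat; [exact He|]. pose proof (Rabs_pos K). lra. }
  exists (mkposreal _ Hp). intros t Ht1 Ht. change (Rabs (t - 0) < Rmin r (eps / (Rabs K + 1)))%R in Ht1.
  rewrite Rminus_0_r, Rabs_pos_eq in Ht1 by lra.
  pose proof (Rmin_l r (eps / (Rabs K + 1))). pose proof (Rmin_r r (eps / (Rabs K + 1))).
  apply Rle_lt_trans with (1 := HK t ltac:(lra)).
  pose proof (Rle_abs K). pose proof (Rabs_pos K).
  replace eps with ((Rabs K + 1) * (eps / (Rabs K + 1)))%R by (field; lra).
  apply Rle_lt_trans with ((Rabs K) * t)%R; [nra|].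
  apply Rle_lt_trans with (Rabs K * (eps / (Rabs K + 1)))%R; [nra|]. nra.
Qed.

(** Half of the decay is spent on absorbing the power, by [pow_le_exp] with [a = s / 2]. *)
Lemma pow_exp_le (m : nat) (s t : R) :
  (0 < s)%R -> (0 <= t)%R ->
  (t ^ m * exp (- s * t) <= (INR m / (s / 2)) ^ m * exp (- (s / 2) * t))%R.
Proof.
  intros Hs Ht.
  replace (- s * t)%R with (- (s / 2) * t + - (s / 2) * t)%R by field. rewrite exp_plus, <- Rmult_assoc.
  apply Rmult_le_compat_r; [left; apply exp_pos|].
  apply Rmult_le_reg_r with (exp (s / 2 * t)); [apply exp_pos|].
  rewrite Rmult_assoc, <- exp_plus. replace (- (s / 2) * t + s / 2 * t)%R with 0%R by ring.
  rewrite exp_0, Rmult_1_r. apply pow_le_exp; lra.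
Qed.

(** Euler's Gamma integral, by parts: [- t^(m+1) e^(-st) / s] has derivative
    [t^(m+1) e^(-st) - (m+1)/s t^m e^(-st)] and vanishes at both ends. It supplies the terms of
    Watson's expansion. *)
Lemma CInt_pow_exp (m : nat) (s : R) :
  (0 < s)%R ->
  CInt (fun t => RtoC (t ^ m * exp (- s * t))) (RtoC (INR (fact m) / s ^ S m)).
Proof.
  intros Hs. induction m as [|m IH].
  - apply CInt_eq with (0 - RtoC (- / s)).
    2:{ rewrite <- RtoC_minus. f_equal. simpl. field. lra. }
    apply CInt_derive with (fun t => RtoC (- / s * exp (- s * t))).
    + intros t Ht. apply Cder_RtoC. auto_derive; [easy|]. simpl. field. lra.
    + intros t Ht. apply Cdiff_RtoC. auto_derive. easy.
    + apply Ctends_0_linear with (K := 1%R) (r := 1%R); [lra|]. intros t Ht.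
      rewrite <- RtoC_minus, Cmod_R.
      replace (- / s * exp (- s * t) - - / s)%R with (/ s * (1 - exp (- s * t)))%R by ring.
      pose proof (exp_ineq1_le (- s * t)).
      assert (exp (- s * t) <= 1)%R by (rewrite <- exp_0; left; apply exp_increasing; nra).
      assert (0 < / s)%R by (apply Rinv_0_lt_compat, Hs).
      rewrite Rabs_pos_eq by nra.
      replace (1 * t)%R with (/ s * (s * t))%R by (field; lra). nra.
    + apply Ctends_p_infty with (K := (/ s)%R) (s := s); [exact Hs|]. intros t Ht.
      rewrite Cmod_R, Rabs_mult, Rabs_Ropp.
      rewrite !Rabs_pos_eq; [lra|left; apply exp_pos|left; apply Rinv_0_lt_compat, Hs].
  - apply CInt_ext with (fun t => RtoC (t ^ S m * exp (- s * t) - INR (S m) / s * (t ^ m * exp (- s * t)))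
       + RtoC (INR (S m) / s) * RtoC (t ^ m * exp (- s * t))).
    { intros t Ht. rewrite <- RtoC_mult, <- RtoC_plus. f_equal. ring. }
    apply CInt_eq with ((0 - 0) + RtoC (INR (S m) / s) * RtoC (INR (fact m) / s ^ S m)).
    2:{ rewrite <- RtoC_mult, fact_simpl, mult_INR. 
        replace (0 - 0 + RtoC (INR (S m) / s * (INR (fact m) / s ^ S m)))
         with (RtoC (INR (S m) / s * (INR (fact m) / s ^ S m))) by ring. f_equal. 
        rewrite <- (tech_pow_Rmult s (S m)). field. split; [apply pow_nonzero; lra|lra]. }
    apply CInt_plus; [|apply CInt_scal, IH].
    apply CInt_derive with (fun t => RtoC (- / s * (t ^ S m * exp (- s * t)))).
    + intros t Ht. apply Cder_RtoC. auto_derive; [easy|]. 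
      change (match m with 0%nat => 1 | S _ => INR m + 1 end)%R with (INR (S m)).
      simpl pow. field. lra.
    + intros t Ht. apply Cdiff_RtoC. auto_derive. easy.
    + apply Ctends_0_linear with (K := (/ s)%R) (r := 1%R); [lra|]. intros t Ht.
      rewrite <- RtoC_minus, Cmod_R.
      rewrite Rminus_0_r, Rabs_mult, Rabs_Ropp.
      assert (0 < / s)%R by (apply Rinv_0_lt_compat, Hs).
      assert (exp (- s * t) <= 1)%R by (rewrite <- exp_0; left; apply exp_increasing; nra).
      pose proof (exp_pos (- s * t)).
      assert (0 <= t ^ m <= 1)%R.
      { split; [apply pow_le; lra|]. rewrite <- (pow1 m). apply pow_incr. lra. }
      rewrite !Rabs_pos_eq; [|simpl; apply Rmult_le_pos; nra|lra].
      apply Rmult_le_compat_l; [lra|]. simpl. rewrite Rmult_assoc.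
      pose proof (Rmult_le_compat_l t (t ^ m * exp (- s * t)) 1). nra.
    + apply Ctends_p_infty with (K := (/ s * (INR (S m) / (s / 2)) ^ S m)%R) (s := (s / 2)%R); [lra|].
      intros t Ht. assert (0 < / s)%R by (apply Rinv_0_lt_compat, Hs).
      rewrite Cmod_R, Rabs_mult, Rabs_Ropp.
      rewrite !Rabs_pos_eq; [|apply Rmult_le_pos; [apply pow_le; lra|left; apply exp_pos]|lra].
      rewrite Rmult_assoc. apply Rmult_le_compat_l; [lra|]. apply pow_exp_le; lra.
Qed.

(** * The principal logarithm and Frullani's integral *)

(** On the right half-plane the case split of [Carg] disappears, and the argument becomes a visibly
    smooth function of the coordinates. *)
Lemma Carg_atan (z : C) : (0 < Re z)%R -> Carg z = atan (Im z / Re z).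
Proof.
  intros Hz. destruct z as [x y]. unfold Carg. simpl in *.
  assert (Hm : (0 < Cmod (x, y))%R).
  { apply Cmod_gt_0. intros E. injection E. intros; lra. }
  assert (Hm2 : (Cmod (x, y) * Cmod (x, y) = x * x + y * y)%R).
  { unfold Cmod. simpl. rewrite sqrt_sqrt; nra. }
  set (m := Cmod (x, y)) in *.
  assert (A : acos (x / m) = atan (Rabs y / x)).
  { rewrite acos_atan by (apply Rdiv_lt_0_compat; assumption). f_equal.
    replace (1 - (x / m)²)%R with ((Rabs y / m)²)%R.
    - rewrite sqrt_Rsqr; [field; lra|].
      apply Rmult_le_pos; [apply Rabs_pos|left; apply Rinv_0_lt_compat, Hm].
    - rewrite !Rsqr_div', <- Rsqr_abs. unfold Rsqr.
      replace (y * y)%R with (m * m - x * x)%R by lra. field. lra. }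
  rewrite A. destruct (Rle_dec 0 y) as [H|H].
  - rewrite Rabs_pos_eq by exact H. reflexivity.
  - rewrite Rabs_left by lra. rewrite <- atan_opp. f_equal. field. lra.
Qed.

Lemma Cder_Clog (g : R -> C) (x : R) (l : C) :
  Cder g x l -> (0 < Re (g x))%R -> Cder (fun t => Clog (g t)) x (l / g x).
Proof.
  intros [H1 H2] Hp.
  assert (Hloc : locally x (fun t => (0 < Re (g t))%R)).
  { exact (ex_derive_continuous (V := R_NormedModule) _ x (ex_intro _ _ H1) _ (open_gt 0 _ Hp)). }
  set (a := fun t => Re (g t)) in *. set (b := fun t => Im (g t)) in *.
  assert (Da : Derive a x = Re l) by (apply is_derive_unique; exact H1).
  assert (Db : Derive b x = Im l) by (apply is_derive_unique; exact H2).
  assert (Ea : ex_derive a x) by (eexists; exact H1).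
  assert (Eb : ex_derive b x) by (eexists; exact H2).
  assert (Hs : (0 < a x * a x + b x * b x)%R) by (change (0 < a x)%R in Hp; nra).
  assert (Hq : (0 < sqrt (a x * a x + b x * b x))%R) by (apply sqrt_lt_R0, Hs).
  assert (Hsq := sqrt_sqrt _ (Rlt_le _ _ Hs)).
  change (0 < a x)%R in Hp.
  split.
  - apply is_derive_ext with (fun t => ln (sqrt (a t * a t + b t * b t))).
    { intros t. unfold Clog, Cmod, a, b, Re, Im; simpl. do 3 f_equal; ring. }
    auto_derive; [repeat split; assumption|].
    change (Derive (fun t => a t) x) with (Derive a x); change (Derive (fun t => b t) x) with (Derive b x); rewrite Da, Db. set (q := sqrt (a x * a x + b x * b x)) in *.
    unfold Cdiv, Cinv, Cmult. change (fst (g x)) with (a x). change (snd (g x)) with (b x). simpl.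
    change (fst l) with (Re l). change (snd l) with (Im l).
    apply Rmult_eq_reg_l with (q * q)%R; [|nra].
    transitivity ((a x * Re l + b x * Im l))%R; [field; lra|rewrite Hsq; field; nra].
  - apply is_derive_ext_loc with (fun t => atan (b t / a t)).
    { revert Hloc. apply filter_imp. intros t Ht. symmetry. apply (Carg_atan (g t)). exact Ht. }
    auto_derive; [repeat split; try assumption; lra|].
    change (Derive (fun t => a t) x) with (Derive a x); change (Derive (fun t => b t) x) with (Derive b x); rewrite Da, Db.
    unfold Cdiv, Cinv, Cmult. change (fst (g x)) with (a x). change (snd (g x)) with (b x). simpl.
    change (fst l) with (Re l). change (snd l) with (Im l). field.
    repeat split; nra.
Qed.

(* The phase [phi] covers at once the real part ([phi = 0]) and the imaginary
   part ([phi = PI / 2]) of [Cexp (- (1 + x (p + i b)) t) / t]. *)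
Lemma is_derive_RInt_exp_cos (p b phi e T x : R) :
  (0 < e <= T)%R ->
  is_derive (fun x => RInt (fun t => (exp (- (1 + x * p) * t) * cos (x * b * t + phi) / t)%R) e T) x
    (RInt (fun t => (- (exp (- (1 + x * p) * t)
        * (p * cos (x * b * t + phi) + b * sin (x * b * t + phi))))%R) e T).
Proof.
  intros He.
  set (f := fun x t => (exp (- (1 + x * p) * t) * cos (x * b * t + phi) / t)%R).
  assert (D : forall x t, (0 < t)%R -> is_derive (fun u => f u t) x
     (- (exp (- (1 + x * p) * t) * (p * cos (x * b * t + phi) + b * sin (x * b * t + phi))))%R).
  { intros y t Ht. unfold f. auto_derive; [lra|]. field. lra. }
  assert (E : RInt (fun t => Derive (fun u => f u t) x) e T =
     RInt (fun t => (- (exp (- (1 + x * p) * t)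
        * (p * cos (x * b * t + phi) + b * sin (x * b * t + phi))))%R) e T).
  { apply RInt_ext. rewrite Rmin_left, Rmax_right by lra. intros t Ht.
    apply is_derive_unique, D. lra. }
  rewrite <- E. apply is_derive_RInt_param.
  - apply filter_forall. intros y t. rewrite Rmin_left, Rmax_right by lra. intros Ht.
    eexists. apply D. lra.
  - intros t. rewrite Rmin_left, Rmax_right by lra. intros Ht.
    apply continuity_2d_pt_ext_loc with (fun x t => (- (exp (- (1 + x * p) * t)
        * (p * cos (x * b * t + phi) + b * sin (x * b * t + phi))))%R).
    + assert (Ht0 : (0 < t)%R) by lra. exists (mkposreal t Ht0). simpl. intros u v Hu Hv.
      symmetry. apply is_derive_unique, D. apply Rabs_def2 in Hv. lra.
    + assert (C1 : continuity_2d_pt (fun x t => (x * b * t + phi)%R) x t).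
      { apply continuity_2d_pt_plus; [|apply continuity_2d_pt_const].
        apply continuity_2d_pt_mult; [|apply continuity_2d_pt_id2].
        apply continuity_2d_pt_mult; [apply continuity_2d_pt_id1|apply continuity_2d_pt_const]. }
      apply continuity_2d_pt_opp, continuity_2d_pt_mult.
      * apply (continuity_1d_2d_pt_comp exp).
        { apply derivable_continuous_pt, derivable_pt_exp. }
        apply continuity_2d_pt_mult; [|apply continuity_2d_pt_id2].
        apply continuity_2d_pt_opp, continuity_2d_pt_plus; [apply continuity_2d_pt_const|].
        apply continuity_2d_pt_mult; [apply continuity_2d_pt_id1|apply continuity_2d_pt_const].
      * apply continuity_2d_pt_plus; (apply continuity_2d_pt_mult; [apply continuity_2d_pt_const|]).
        -- apply (continuity_1d_2d_pt_comp cos); [apply continuity_cos|exact C1].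
        -- apply (continuity_1d_2d_pt_comp sin); [apply continuity_sin|exact C1].
  - apply filter_forall. intros y. apply (ex_RInt_continuous (V := R_CompleteNormedModule)).
    rewrite Rmin_left, Rmax_right by lra. intros t Ht.
    apply (ex_derive_continuous (V := R_NormedModule)). unfold f. auto_derive. lra.
Qed.

Lemma CRInt_RInt (f : R -> C) (a b : R) :
  (a <= b)%R -> (forall t, (a <= t <= b)%R -> Cdiff f t) ->
  CRInt f a b (RInt (fun t => Re (f t)) a b, RInt (fun t => Im (f t)) a b).
Proof.
  intros Hab Hf. destruct (ex_RInt_continuous (V := C_R_CompleteNormedModule) f a b) as [I HI].
  { rewrite Rmin_left, Rmax_right by lra. intros z Hz. apply Cdiff_cont, Hf, Hz. }
  rewrite (is_RInt_unique _ _ _ _ (CRInt_re _ _ _ _ HI)).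
  rewrite (is_RInt_unique _ _ _ _ (CRInt_im _ _ _ _ HI)).
  destruct I. exact HI.
Qed.

(** With [u = 1 + x (v - 1)], differentiation in [x] under the integral sign produces the factor
    [- (v - 1) t], which cancels [1 / t]. What remains, the integral of [- (v - 1) e^(-ut)], is
    elementary. *)
Lemma Cder_exp_integral (v : C) (e T x : R) :
  (0 < e <= T)%R -> (0 < Re (1 + RtoC x * (v - 1)))%R ->
  Cder (fun x => (RInt (fun t => Re (Cexp (- (1 + RtoC x * (v - 1)) * RtoC t) * RtoC (/ t))) e T,
                  RInt (fun t => Im (Cexp (- (1 + RtoC x * (v - 1)) * RtoC t) * RtoC (/ t))) e T) : C)
   x ((v - 1) / (1 + RtoC x * (v - 1)) *
      (Cexp (- (1 + RtoC x * (v - 1)) * RtoC T) - Cexp (- (1 + RtoC x * (v - 1)) * RtoC e))).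
Proof.
  intros He Hx. set (u := 1 + RtoC x * (v - 1)) in *.
  assert (Hu : u <> 0) by (intros E; rewrite E in Hx; simpl in Hx; lra).
  assert (I : CRInt (fun t => - (v - 1) * Cexp (- u * RtoC t)) e T
     ((v - 1) / u * (Cexp (- u * RtoC T) - Cexp (- u * RtoC e)))).
  { replace ((v - 1) / u * (Cexp (- u * RtoC T) - Cexp (- u * RtoC e)))
      with ((v - 1) / u * Cexp (- u * RtoC T) - (v - 1) / u * Cexp (- u * RtoC e)) by ring.
    apply (CRInt_derive (fun t => (v - 1) / u * Cexp (- u * RtoC t))); [lra| |].
    - intros t _. apply Cder_eq with (1 := Cder_scal _ _ _ _ (Cder_Cexp u t)). field. exact Hu.
    - intros t _. apply Cdiff_mult; [apply Cdiff_const|]. eexists. apply Cder_Cexp. }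
  pose proof (is_RInt_unique _ _ _ _ (CRInt_re _ _ _ _ I)) as Ire.
  pose proof (is_RInt_unique _ _ _ _ (CRInt_im _ _ _ _ I)) as Iim.
  destruct v as [a b].
  split.
  - rewrite <- Ire. cbn [Re fst].
    apply is_derive_ext with (fun x => RInt (fun t => (exp (- (1 + x * (a - 1)) * t) * cos (x * b * t + 0) / t)%R) e T).
    { intros y. apply RInt_ext. intros t _. unfold Cexp, Re, Im; simpl.
      replace (- (1 + (y * (a + - (1)) - 0 * (b + - 0))) * t - - (0 + (y * (b + - 0) + 0 * (a + - (1)))) * 0)%R
        with (- (1 + y * (a - 1)) * t)%R by ring.
      replace (- (1 + (y * (a + - (1)) - 0 * (b + - 0))) * 0 + - (0 + (y * (b + - 0) + 0 * (a + - (1)))) * t)%R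
        with (- (y * b * t))%R by ring.
      rewrite Rplus_0_r, cos_neg. unfold Rdiv. ring. }
    apply is_derive_eqv with (1 := is_derive_RInt_exp_cos (a - 1) b 0 e T x He).
    apply RInt_ext. intros t _. unfold u, Cexp, Re, Im; simpl.
    rewrite Rplus_0_r.
    replace (- (1 + (x * (a + - (1)) - 0 * (b + - 0))) * t - - (0 + (x * (b + - 0) + 0 * (a + - (1)))) * 0)%R
      with (- (1 + x * (a - 1)) * t)%R by ring.
    replace (- (1 + (x * (a + - (1)) - 0 * (b + - 0))) * 0 + - (0 + (x * (b + - 0) + 0 * (a + - (1)))) * t)%R
      with (- (x * b * t))%R by ring.
    rewrite cos_neg, sin_neg. ring.
  - rewrite <- Iim. cbn [Im snd].
    apply is_derive_ext with (fun x => RInt (fun t => (exp (- (1 + x * (a - 1)) * t) * cos (x * b * t + PI / 2) / t)%R) e T).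
    { intros y. apply RInt_ext. intros t _. unfold Cexp, Re, Im; simpl.
      replace (- (1 + (y * (a + - (1)) - 0 * (b + - 0))) * t - - (0 + (y * (b + - 0) + 0 * (a + - (1)))) * 0)%R
        with (- (1 + y * (a - 1)) * t)%R by ring.
      replace (- (1 + (y * (a + - (1)) - 0 * (b + - 0))) * 0 + - (0 + (y * (b + - 0) + 0 * (a + - (1)))) * t)%R
        with (- (y * b * t))%R by ring.
      rewrite sin_neg, cos_plus, cos_PI2, sin_PI2. unfold Rdiv. ring. }
    apply is_derive_eqv with (1 := is_derive_RInt_exp_cos (a - 1) b (PI / 2) e T x He).
    apply RInt_ext. intros t _. unfold u, Cexp, Re, Im; simpl.
    replace (- (1 + (x * (a + - (1)) - 0 * (b + - 0))) * t - - (0 + (x * (b + - 0) + 0 * (a + - (1)))) * 0)%R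
      with (- (1 + x * (a - 1)) * t)%R by ring.
    replace (- (1 + (x * (a + - (1)) - 0 * (b + - 0))) * 0 + - (0 + (x * (b + - 0) + 0 * (a + - (1)))) * t)%R
      with (- (x * b * t))%R by ring.
    rewrite cos_neg, sin_neg, cos_plus, sin_plus, cos_PI2, sin_PI2. ring.
Qed.

Lemma exp_le_mono (x y : R) : (x <= y)%R -> (exp x <= exp y)%R.
Proof. intros [H|H]; [left; apply exp_increasing, H|right; rewrite H; reflexivity]. Qed.

Lemma Re_segment (v : C) (x : R) :
  Re (1 + RtoC x * (v - 1)) = (1 + x * (Re v - 1))%R.
Proof. destruct v. simpl. ring. Qed.

Lemma Cmod_1_minus_Cexp_le (v : C) (t : R) :
  (0 <= Re v)%R -> (0 <= t)%R -> (Cmod (Cexp (- v * RtoC t) - 1) <= Cmod v * t)%R.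
Proof.
  intros Hv Ht.
  replace (RtoC 1) with (Cexp (- v * RtoC 0)) by (rewrite <- Cexp_0; f_equal; ring).
  replace (Cmod v * t)%R with (Cmod v * (t - 0))%R by ring.
  apply (Cmod_mean_value (fun t => Cexp (- v * RtoC t)) (fun t => - v * Cexp (- v * RtoC t))); [exact Ht|].
  intros s Hs. split; [apply Cder_Cexp|].
  rewrite Cmod_mult, Cmod_opp. rewrite <- (Rmult_1_r (Cmod v)) at 2.
  apply Rmult_le_compat_l; [apply Cmod_ge_0|]. apply Cmod_Cexp_le_1; lra.
Qed.

Lemma Clog_1 : Clog 1 = 0.
Proof.
  unfold Clog. rewrite Carg_atan by (simpl; lra). rewrite Cmod_1, ln_1.
  replace (Im 1 / Re 1)%R with 0%R by (simpl; field). rewrite atan_0. reflexivity.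
Qed.

(** Let [u x = 1 + x (v - 1)] run from 1 to [v]; [d <= 1] keeps the whole segment in the half-plane
    [Re >= d]. The sum of the integral of [e^(-ut) / t] and of [log u] has derivative
    [(v - 1) / u * (e^(-uT) - (e^(-ue) - 1))] in [x]: the derivative of the logarithm cancels the
    limit of the boundary term at [e]. This is small uniformly in [x], and the mean value inequality
    bounds the increment. *)
Lemma frullani_truncated (v : C) (e T d : R) :
  (0 < d <= 1)%R -> (d <= Re v)%R -> (0 < e <= T)%R ->
  exists I, CRInt (fun t => RtoC (/ t) * (Cexp (- v * RtoC t) - RtoC (exp (- t)))) e T I /\
   (Cmod (I + Clog v) <= Cmod (v - 1) / d * (exp (- d * T) + (1 + Cmod (v - 1)) * e))%R.
Proof.
  intros Hd Hv He.
  set (f := fun x t => Cexp (- (1 + RtoC x * (v - 1)) * RtoC t) * RtoC (/ t)).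
  set (K := fun x => (RInt (fun t => Re (f x t)) e T, RInt (fun t => Im (f x t)) e T) : C).
  assert (HK : forall x, CRInt (f x) e T (K x)).
  { intros x. apply CRInt_RInt; [lra|]. intros t Ht. apply Cdiff_mult.
    - eexists. apply Cder_Cexp.
    - apply Cdiff_RtoC. auto_derive. lra. }
  exists (K 1%R - K 0%R). split.
  - apply CRInt_ext with (fun t => f 1%R t + (- (1)) * f 0%R t); [lra| |].
    + intros t Ht. unfold f.
      replace (- (1 + 1 * (v - 1)) * RtoC t) with (- v * RtoC t) by ring.
      replace (- (1 + 0 * (v - 1)) * RtoC t) with (RtoC (- t)) by (rewrite RtoC_opp; ring).
      rewrite Cexp_RtoC. ring.
    + replace (K 1%R - K 0%R) with (K 1%R + (- (1)) * K 0%R) by ring.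
      apply CRInt_plus; [apply HK|apply CRInt_scal, HK].
  - set (u := fun x => 1 + RtoC x * (v - 1)).
    assert (Hu : forall x, (0 <= x <= 1)%R -> (d <= Re (u x))%R).
    { intros x Hx. unfold u. rewrite Re_segment. nra. }
    assert (Hum : forall x, (0 <= x <= 1)%R -> (Cmod (u x) <= 1 + Cmod (v - 1))%R).
    { intros x Hx. unfold u. apply Rle_trans with (1 := Cmod_triangle _ _).
      rewrite Cmod_1, Cmod_mult, Cmod_RtoC by lra. pose proof (Cmod_ge_0 (v - 1)). nra. }
    set (dh := fun x => (v - 1) / u x *
      (Cexp (- u x * RtoC T) - Cexp (- u x * RtoC e)) + (v - 1) / u x).
    replace (K 1%R - K 0%R + Clog v) with ((K 1%R + Clog (u 1%R)) - (K 0%R + Clog (u 0%R))).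
    2:{ unfold u. replace (1 + 1 * (v - 1)) with v by ring.
        replace (1 + 0 * (v - 1)) with (RtoC 1) by ring. rewrite Clog_1. ring. }
    set (D := (Cmod (v - 1) / d * (exp (- d * T) + (1 + Cmod (v - 1)) * e))%R).
    replace D with (D * (1 - 0))%R by ring.
    apply (Cmod_mean_value (fun x => K x + Clog (u x)) dh); [lra|].
    intros x Hx. pose proof (Hu x Hx) as Hux. pose proof (Hum x Hx) as Humx. split.
    + unfold dh. apply Cder_plus.
      * exact (Cder_exp_integral v e T x He (Rlt_le_trans _ _ _ (proj1 Hd) Hux)).
      * apply Cder_Clog with (l := v - 1); [|lra].
        apply Cder_eq with (0 + (1 * (v - 1) + RtoC x * 0)); [|ring].
        apply Cder_plus; [apply Cder_const|]. apply Cder_mult; [apply Cder_id|apply Cder_const].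
    + assert (Hu0 : u x <> 0) by (intros E; rewrite E in Hux; simpl in Hux; lra).
      assert (Hud : (d <= Cmod (u x))%R).
      { apply Rle_trans with (1 := Hux). apply Rle_trans with (1 := Rle_abs _). apply re_le_Cmod. }
      unfold dh. replace ((v - 1) / u x * (Cexp (- u x * RtoC T) - Cexp (- u x * RtoC e)) + (v - 1) / u x)
        with ((v - 1) / u x * (Cexp (- u x * RtoC T) - (Cexp (- u x * RtoC e) - 1))) by (field; exact Hu0).
      rewrite Cmod_mult, Cmod_div by exact Hu0.
      apply Rmult_le_compat; [|apply Cmod_ge_0| |].
      * apply Rmult_le_pos; [apply Cmod_ge_0|left; apply Rinv_0_lt_compat; lra].
      * apply Rmult_le_compat_l; [apply Cmod_ge_0|]. apply Rinv_le_contravar; lra.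
      * unfold Cminus at 1. apply Rle_trans with (1 := Cmod_triangle _ _). rewrite Cmod_opp.
        apply Rplus_le_compat.
        -- rewrite Cmod_Cexp. apply exp_le_mono.
           replace (Re (- u x * RtoC T)) with (- Re (u x) * T)%R by (destruct (u x); simpl; ring). nra.
        -- apply Rle_trans with (Cmod (u x) * e)%R.
           ++ apply Cmod_1_minus_Cexp_le; lra.
           ++ apply Rmult_le_compat_r; lra.
Qed.

Lemma frullani (v : C) :
  (0 < Re v)%R -> CInt (fun t => RtoC (/ t) * (Cexp (- v * RtoC t) - RtoC (exp (- t)))) (- Clog v).
Proof.
  intros Hv. apply CInt_iff. intros eps He.
  set (d := Rmin 1 (Re v)).
  assert (Hd : (0 < d)%R) by (apply Rmin_pos; lra).
  pose proof (Rmin_l 1 (Re v)) as Hd1. pose proof (Rmin_r 1 (Re v)) as Hd2. fold d in Hd1, Hd2.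
  set (A := Cmod (v - 1)). assert (HA : (0 <= A)%R) by apply Cmod_ge_0.
  set (D := (A / d)%R). assert (HD : (0 <= D)%R).
  { apply Rmult_le_pos; [exact HA|left; apply Rinv_0_lt_compat, Hd]. }
  assert (H1 : (0 < eps / (4 * (D + 1)))%R) by (apply Rdiv_lt_0_compat; lra).
  destruct (exp_decay d _ Hd H1) as [B [HB0 HB]].
  assert (H2 : (0 < eps / (4 * (D + 1)) / (1 + A))%R) by (apply Rdiv_lt_0_compat; lra).
  exists (eps / (4 * (D + 1)) / (1 + A))%R, (Rmax B (eps / (4 * (D + 1)) / (1 + A)))%R.
  split; [exact H2|]. intros a b Ha Hb.
  pose proof (Rmax_l B (eps / (4 * (D + 1)) / (1 + A))). pose proof (Rmax_r B (eps / (4 * (D + 1)) / (1 + A))).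
  split; [lra|].
  destruct (frullani_truncated v a b d) as [I [HI1 HI2]]; [lra|lra|lra|].
  exists I. split; [exact HI1|].
  replace (I - - Clog v) with (I + Clog v) by ring.
  apply Rle_lt_trans with (1 := HI2). fold A. fold D.
  assert (H3 : (exp (- d * b) < eps / (4 * (D + 1)))%R) by (apply HB; lra).
  assert (H4 : ((1 + A) * a < eps / (4 * (D + 1)))%R).
  { replace (eps / (4 * (D + 1)))%R with ((1 + A) * (eps / (4 * (D + 1)) / (1 + A)))%R by (field; lra).
    apply Rmult_lt_compat_l; lra. }
  apply Rle_lt_trans with ((D + 1) * (exp (- d * b) + (1 + A) * a))%R.
  - apply Rmult_le_compat_r; [|lra]. pose proof (exp_pos (- d * b)). nra.
  - apply Rlt_le_trans with ((D + 1) * (eps / (4 * (D + 1)) + eps / (4 * (D + 1))))%R.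
    + apply Rmult_lt_compat_l; lra.
    + replace ((D + 1) * (eps / (4 * (D + 1)) + eps / (4 * (D + 1))))%R with (eps / 2)%R by (field; lra). lra.
Qed.

(** * Finite parts *)

Definition exp_term (v : C) (j : nat) (t : R) : C := (- v * RtoC t) ^ j * RtoC (/ INR (fact j)).

(** [e^(-vt)] minus its Taylor polynomial of degree [j - 1]. The derivative of each remainder is
    [- v] times the previous one, which drives both the size estimate and the integration by
    parts. *)
Fixpoint exp_rem (v : C) (j : nat) (t : R) : C :=
  match j with
  | O => Cexp (- v * RtoC t)
  | S i => exp_rem v i t - exp_term v i t
  end.

Lemma Cder_exp_term (v : C) (j : nat) (t : R) :
  Cder (exp_term v (S j)) t (- v * exp_term v j t).
Proof.
  assert (P : forall j, Cder (fun t => (- v * RtoC t) ^ (S j)) t (RtoC (INR (S j)) * (- v) * (- v * RtoC t) ^ j)).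
  { intros i. induction i as [|i IH].
    - apply Cder_ext_loc with (fun t => - v * RtoC t).
      + apply filter_forall. intros s. simpl. ring.
      + apply Cder_eq with (- v * 1); [apply Cder_scal, Cder_id|simpl; ring].
    - apply Cder_eq with ((- v * 1) * (- v * RtoC t) ^ (S i)
        + (- v * RtoC t) * (RtoC (INR (S i)) * - v * (- v * RtoC t) ^ i)).
      + apply (Cder_mult (fun t => - v * RtoC t)); [apply Cder_scal, Cder_id|exact IH].
      + rewrite (S_INR (S i)), RtoC_plus. simpl (_ ^ (S i)). ring. }
  unfold exp_term.
  apply Cder_eq with (1 := Cder_mult _ _ _ _ _ (P j) (Cder_const (RtoC (/ INR (fact (S j)))) t)).
  rewrite fact_simpl, mult_INR.
  assert (H1 : INR (S j) <> 0%R) by (apply not_0_INR; lia).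
  assert (H2 := INR_fact_neq_0 j).
  rewrite Rinv_mult, RtoC_mult.
  replace (RtoC (INR (S j)) * - v * (- v * RtoC t) ^ j * (RtoC (/ INR (S j)) * RtoC (/ INR (fact j))))
    with (RtoC (INR (S j)) * RtoC (/ INR (S j)) * (- v * ((- v * RtoC t) ^ j * RtoC (/ INR (fact j))))) by ring.
  rewrite <- RtoC_mult, Rinv_r by exact H1. ring.
Qed.

Lemma Cder_exp_rem (v : C) (j : nat) (t : R) : Cder (exp_rem v (S j)) t (- v * exp_rem v j t).
Proof.
  induction j as [|j IH].
  - simpl. apply Cder_eq with (- v * Cexp (- v * RtoC t) - 0); [|ring].
    apply Cder_minus; [apply Cder_Cexp|].
    apply Cder_ext_loc with (fun _ => 1); [|apply Cder_const].
    apply filter_forall. intros s. unfold exp_term. simpl. rewrite Rinv_1. ring.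
  - apply Cder_eq with (- v * exp_rem v j t - - v * exp_term v j t); [|simpl; ring].
    apply (Cder_minus (exp_rem v (S j)) (exp_term v (S j))); [exact IH|apply Cder_exp_term].
Qed.

Lemma exp_rem_at_0 (v : C) (j : nat) : exp_rem v (S j) 0 = 0.
Proof.
  induction j as [|j IH].
  - simpl. unfold exp_term. simpl. rewrite Rinv_1.
    replace (- v * 0) with (RtoC 0) by ring. rewrite Cexp_0. ring.
  - change (exp_rem v (S j) 0 - exp_term v (S j) 0 = 0). rewrite IH.
    unfold exp_term. simpl. ring.
Qed.

Lemma Cmod_exp_term_le (v : C) (j : nat) (t : R) :
  (0 <= t)%R -> (Cmod (exp_term v j t) <= (Cmod v * t) ^ j)%R.
Proof.
  intros Ht. unfold exp_term.
  rewrite Cmod_mult, Cmod_pow, Cmod_mult, Cmod_opp, (Cmod_RtoC t) by exact Ht.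
  rewrite Cmod_RtoC by (left; apply Rinv_0_lt_compat, INR_fact_lt_0).
  rewrite <- (Rmult_1_r ((Cmod v * t) ^ j)) at 2. apply Rmult_le_compat_l.
  - apply pow_le, Rmult_le_pos; [apply Cmod_ge_0|exact Ht].
  - rewrite <- Rinv_1. apply Rinv_le_contravar; [lra|]. apply (le_INR 1).
    pose proof (lt_O_fact j). lia.
Qed.

(** Mean value inequality from 0, where the remainder vanishes, by induction on [j]. The factor
    [1 / j!] is given up, since only the order in [t] matters. *)
Lemma Cmod_exp_rem_le (v : C) (j : nat) (t : R) :
  (0 <= Re v)%R -> (0 <= t)%R -> (Cmod (exp_rem v j t) <= (Cmod v * t) ^ j)%R.
Proof.
  intros Hv. revert t. induction j as [|j IH]; intros t Ht.
  - simpl. apply Cmod_Cexp_le_1; assumption.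
  - replace (exp_rem v (S j) t) with (exp_rem v (S j) t - exp_rem v (S j) 0)
      by (rewrite exp_rem_at_0; ring).
    replace ((Cmod v * t) ^ S j)%R with (Cmod v * (Cmod v * t) ^ j * (t - 0))%R by (simpl; ring).
    apply (Cmod_mean_value _ (fun t => - v * exp_rem v j t)); [exact Ht|].
    intros s Hs. split; [apply Cder_exp_rem|].
    rewrite Cmod_mult, Cmod_opp. apply Rmult_le_compat_l; [apply Cmod_ge_0|].
    apply Rle_trans with (1 := IH s ltac:(lra)).
    apply pow_incr. pose proof (Cmod_ge_0 v). split; [apply Rmult_le_pos; lra|].
    apply Rmult_le_compat_l; lra.
Qed.

Lemma Cdiff_exp_rem (v : C) (j : nat) (t : R) : Cdiff (exp_rem v j) t.
Proof. destruct j as [|j]; eexists; [apply Cder_Cexp|apply Cder_exp_rem]. Qed.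

(* The integrand [t^(-j-1) e^(-vt)] with its polar part at 0 removed; the
   factor [e^(-t)] in the last subtracted term makes it integrable at infinity. *)
Definition reg_exp (v : C) (j : nat) (t : R) : C :=
  RtoC (/ t ^ S j) * (exp_rem v j t - exp_term v j t * RtoC (exp (- t))).

(* Finite part of the integral of [t^(-j-1) e^(-vt)], normalized so that
   Euler's constant does not appear. *)
Definition fp_exp (v : C) (j : nat) : C :=
  (- v) ^ j * RtoC (/ INR (fact j)) * (RtoC (harmonic j) - Clog v).

Lemma harmonic_S (j : nat) : harmonic (S j) = (harmonic j + / INR (S j))%R.
Proof. unfold harmonic. rewrite (sum_n_Sm (G := R_AbelianMonoid)) by lia. reflexivity. Qed.

Lemma harmonic_O : harmonic 0 = 0%R.
Proof. unfold harmonic. rewrite (sum_n_m_zero (G := R_AbelianMonoid)) by lia. reflexivity. Qed.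

(** Write [R_j] for [exp_rem v j]. The function [F = - t^(-j-1) R_(j+1) / (j+1)] has derivative
    [t^(-j-2) R_(j+1) + v/(j+1) t^(-j-1) R_j], and adding [- v/(j+1) * reg_exp v j] gives
    [reg_exp v (S j)]. The value of [F] at 0 contributes [(-v)^(j+1) / ((j+1) (j+1)!)], exactly what
    raises [H_j] to [H_(j+1)]. *)
Lemma CInt_reg_exp (v : C) (j : nat) : (0 < Re v)%R -> CInt (reg_exp v j) (fp_exp v j).
Proof.
  intros Hv. induction j as [|j IH].
  - apply CInt_ext with (fun t => RtoC (/ t) * (Cexp (- v * RtoC t) - RtoC (exp (- t)))).
    + intros t Ht. unfold reg_exp, exp_term. simpl. rewrite Rinv_1, Rmult_1_r. ring.
    + apply CInt_eq with (1 := frullani v Hv). unfold fp_exp.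
      rewrite harmonic_O. simpl. rewrite Rinv_1. ring.
  - set (F := fun t => RtoC (- / INR (S j)) * (RtoC (/ t ^ S j) * exp_rem v (S j) t)).
    set (f := fun t => RtoC (/ t ^ S (S j)) * exp_rem v (S j) t
                + v * RtoC (/ INR (S j)) * (RtoC (/ t ^ S j) * exp_rem v j t)).
    assert (HN : INR (S j) <> 0%R) by (apply not_0_INR; lia).
    assert (HN0 : (0 < INR (S j))%R) by (apply lt_0_INR; lia).
    assert (Hfact := INR_fact_neq_0 j).
    apply CInt_ext with (fun t => f t + (- v * RtoC (/ INR (S j))) * reg_exp v j t).
    { intros t Ht. unfold f, reg_exp.
      assert (E : exp_term v (S j) t = - v * RtoC t * RtoC (/ INR (S j)) * exp_term v j t).
      { unfold exp_term. rewrite fact_simpl, mult_INR, Rinv_mult, RtoC_mult. simpl (_ ^ S j). ring. }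
      rewrite E.
      assert (E2 : RtoC (/ t ^ S j) = RtoC (/ t ^ S (S j)) * RtoC t).
      { rewrite <- RtoC_mult. f_equal. simpl. field. split; [apply pow_nonzero|]; lra. }
      rewrite E2. ring. }
    apply CInt_eq with ((0 - RtoC (- / INR (S j)) * ((- v) ^ S j * RtoC (/ INR (fact (S j)))))
      + (- v * RtoC (/ INR (S j))) * fp_exp v j).
    2:{ unfold fp_exp. rewrite harmonic_S, fact_simpl, mult_INR, Rinv_mult, RtoC_mult, RtoC_plus, RtoC_opp.
        simpl (_ ^ S j). ring. }
    apply CInt_plus; [|apply CInt_scal, IH].
    apply CInt_derive with F.
    + intros t Ht. unfold F.
      apply Cder_eq with (RtoC (- / INR (S j)) * (RtoC (- INR (S j) / t ^ S (S j)) * exp_rem v (S j) t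
          + RtoC (/ t ^ S j) * (- v * exp_rem v j t))).
      * apply Cder_scal, (Cder_mult (fun t => RtoC (/ t ^ S j)) (exp_rem v (S j))); [|apply Cder_exp_rem].
        apply Cder_RtoC. auto_derive; [apply (pow_nonzero t (S j)); lra|].
        change (match j with 0%nat => 1 | S _ => INR j + 1 end)%R with (INR (S j)).
        simpl pow. field. split; [apply pow_nonzero|]; lra.
      * unfold f.
        replace (RtoC (/ t ^ S (S j))) with (RtoC (- / INR (S j)) * RtoC (- INR (S j) / t ^ S (S j))).
        -- rewrite RtoC_opp. ring.
        -- rewrite <- RtoC_mult. f_equal. field. split; [apply pow_nonzero; lra|exact HN].
    + intros t Ht. assert (Hp : forall i, Cdiff (fun t => RtoC (/ t ^ i)) t).
      { intros i. apply Cdiff_RtoC. auto_derive. apply (pow_nonzero t i). lra. }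
      apply Cdiff_plus.
      * apply Cdiff_mult; [apply Hp|apply Cdiff_exp_rem].
      * apply Cdiff_mult; [apply Cdiff_const|]. apply Cdiff_mult; [apply Hp|apply Cdiff_exp_rem].
    + apply Ctends_scal.
      apply Ctends_0_linear with (K := (Cmod v ^ S (S j))%R) (r := 1%R); [lra|]. intros t Ht.
      assert (Htp : (0 < t ^ S j)%R) by (apply pow_lt; lra).
      (* At 0 the quotient tends to the leading Taylor coefficient; the error is [t^(-j-1)] times
         the next remainder, hence O(t). *)
      assert (E : RtoC (/ t ^ S j) * exp_rem v (S j) t - (- v) ^ S j * RtoC (/ INR (fact (S j)))
                  = RtoC (/ t ^ S j) * exp_rem v (S (S j)) t).
      { change (exp_rem v (S (S j)) t) with (exp_rem v (S j) t - exp_term v (S j) t).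
        unfold exp_term. rewrite Cpow_mult_l, <- RtoC_pow.
        replace (RtoC (/ t ^ S j) * (exp_rem v (S j) t - (- v) ^ S j * RtoC (t ^ S j) * RtoC (/ INR (fact (S j)))))
          with (RtoC (/ t ^ S j) * exp_rem v (S j) t
                - (RtoC (/ t ^ S j) * RtoC (t ^ S j)) * ((- v) ^ S j * RtoC (/ INR (fact (S j))))) by ring.
        rewrite <- RtoC_mult, Rinv_l by lra. ring. }
      rewrite E, Cmod_mult, Cmod_RtoC by (left; apply Rinv_0_lt_compat, Htp).
      apply Rmult_le_reg_l with (1 := Htp). rewrite <- Rmult_assoc, Rinv_r, Rmult_1_l by lra.
      replace (t ^ S j * (Cmod v ^ S (S j) * t))%R with ((Cmod v * t) ^ S (S j))%R
        by (rewrite Rpow_mult_distr; simpl; ring).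
      apply Cmod_exp_rem_le; lra.
    + apply Ctends_eq with (RtoC (- / INR (S j)) * 0); [|ring]. apply Ctends_scal.
      (* At infinity [exp_rem v (S j)] is O(t^j), as a difference of a remainder and a term of index
         [j]; this is one power short of the denominator. *)
      set (K := (Cmod v ^ j + Cmod v ^ j)%R).
      intros eps He. exists (Rmax 1 ((K + 1) / eps)). intros t Ht.
      pose proof (Rmax_l 1 ((K + 1) / eps)). pose proof (Rmax_r 1 ((K + 1) / eps)).
      assert (Htp : (0 < t ^ S j)%R) by (apply pow_lt; lra).
      replace (RtoC (/ t ^ S j) * exp_rem v (S j) t - 0) with (RtoC (/ t ^ S j) * exp_rem v (S j) t) by ring.
      rewrite Cmod_mult, Cmod_RtoC by (left; apply Rinv_0_lt_compat, Htp).
      apply Rmult_lt_reg_l with (1 := Htp). rewrite <- Rmult_assoc, Rinv_r, Rmult_1_l by lra.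
      apply Rle_lt_trans with (K * t ^ j)%R.
      * change (exp_rem v (S j) t) with (exp_rem v j t - exp_term v j t).
        unfold Cminus. apply Rle_trans with (1 := Cmod_triangle _ _). rewrite Cmod_opp.
        pose proof (Cmod_exp_rem_le v j t ltac:(lra) ltac:(lra)) as A1.
        pose proof (Cmod_exp_term_le v j t ltac:(lra)) as A2.
        rewrite Rpow_mult_distr in A1, A2. unfold K. lra.
      * assert (Htj : (0 < t ^ j)%R) by (apply pow_lt; lra).
        replace (t ^ S j * eps)%R with (t * eps * t ^ j)%R by (simpl; ring).
        apply Rmult_lt_compat_r; [exact Htj|].
        apply Rlt_le_trans with (K + 1)%R; [lra|].
        replace (K + 1)%R with ((K + 1) / eps * eps)%R by (field; lra).
        apply Rmult_le_compat_r; lra.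
Qed.

(** The span of [e^(-t) / t] and [t^(-2), ..., t^(-N-1)], encoded so that the strongest singularity
    can be split off first. *)
Fixpoint is_polar (N : nat) (P : R -> C) : Prop :=
  match N with
  | O => exists c : C, forall t, (0 < t)%R -> P t = c * RtoC (exp (- t) / t)
  | S M => exists (Q : R -> C) (c : C), is_polar M Q /\
             forall t, (0 < t)%R -> P t = Q t + c * RtoC (/ t ^ S (S M))
  end.

Lemma is_polar_ext (N : nat) (P Q : R -> C) :
  (forall t, (0 < t)%R -> P t = Q t) -> is_polar N P -> is_polar N Q.
Proof.
  destruct N as [|N]; intros E.
  - intros [c H]. exists c. intros t Ht. rewrite <- E; auto.
  - intros [P' [c [H1 H2]]]. exists P', c. split; [exact H1|]. intros t Ht. rewrite <- E; auto.
Qed.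

Lemma is_polar_plus (N : nat) (P Q : R -> C) :
  is_polar N P -> is_polar N Q -> is_polar N (fun t => P t + Q t).
Proof.
  revert P Q. induction N as [|N IH]; intros P Q.
  - intros [c H] [d K]. exists (c + d). intros t Ht. rewrite H, K by exact Ht. ring.
  - intros [P' [c [H1 H2]]] [Q' [d [K1 K2]]]. exists (fun t => P' t + Q' t), (c + d).
    split; [apply IH; assumption|]. intros t Ht. rewrite H2, K2 by exact Ht. ring.
Qed.

Lemma is_polar_scal (N : nat) (c : C) (P : R -> C) :
  is_polar N P -> is_polar N (fun t => c * P t).
Proof.
  revert P. induction N as [|N IH]; intros P.
  - intros [d H]. exists (c * d). intros t Ht. rewrite H by exact Ht. ring.
  - intros [P' [d [H1 H2]]]. exists (fun t => c * P' t), (c * d).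
    split; [apply IH, H1|]. intros t Ht. rewrite H2 by exact Ht. ring.
Qed.

Lemma is_polar_S (N : nat) (P : R -> C) : is_polar N P -> is_polar (S N) P.
Proof. intros H. exists P, (RtoC 0). split; [exact H|]. intros t _. ring. Qed.

Lemma is_polar_0 (N : nat) : is_polar N (fun _ => RtoC 0).
Proof.
  induction N as [|N IH]; [|apply is_polar_S, IH]. exists (RtoC 0). intros t _. ring.
Qed.

Lemma is_polar_exp (N : nat) : is_polar N (fun t => RtoC (exp (- t) / t)).
Proof.
  induction N as [|N IH]; [|apply is_polar_S, IH]. exists (RtoC 1). intros t _. ring.
Qed.

Lemma is_polar_pow (N m : nat) : (1 <= m <= N)%nat -> is_polar N (fun t => RtoC (/ t ^ S m)).
Proof.
  induction N as [|N IH]; [lia|]. intros Hm.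
  destruct (Nat.eq_dec m (S N)) as [->|E].
  - exists (fun _ => RtoC 0), (RtoC 1). split; [apply is_polar_0|]. intros t _. ring.
  - apply is_polar_S, IH. lia.
Qed.

Lemma Ctends_pow_0 (k : nat) : Ctends (at_right 0) (fun t => RtoC (t ^ S k)) 0.
Proof.
  apply Ctends_0_linear with (K := 1%R) (r := 1%R); [lra|]. intros t Ht.
  replace (RtoC (t ^ S k) - 0) with (RtoC (t ^ S k)) by ring.
  assert (0 <= t ^ k <= 1)%R.
  { split; [apply pow_le; lra|]. rewrite <- (pow1 k). apply pow_incr. lra. }
  rewrite Cmod_RtoC by (apply pow_le; lra). simpl. nra.
Qed.

Lemma at_right_pos : at_right 0 (fun t => (0 < t)%R).
Proof. exists (mkposreal 1 Rlt_0_1). intros t _ Ht. exact Ht. Qed.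

Lemma Ctends_exp_0 : Ctends (at_right 0) (fun t => RtoC (exp (- t))) 1.
Proof.
  apply Ctends_0_linear with (K := 1%R) (r := 1%R); [lra|]. intros t Ht.
  rewrite <- RtoC_minus, Cmod_R.
  assert (exp (- t) <= 1)%R by (rewrite <- exp_0; apply exp_le_mono; lra).
  pose proof (exp_ineq1_le (- t)). rewrite Rabs_left1 by lra. lra.
Qed.

Lemma is_polar_tends (N : nat) (P : R -> C) :
  is_polar N P -> Ctends (at_right 0) (fun t => RtoC (t ^ S (S N)) * P t) 0.
Proof.
  revert P. induction N as [|N IH]; intros P.
  - intros [c H].
    apply Ctends_ext with (fun t => c * (RtoC (t ^ 1) * RtoC (exp (- t)))).
    + generalize at_right_pos. apply filter_imp. intros t Ht.
      rewrite H by exact Ht.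
      replace (RtoC (t ^ 2) * (c * RtoC (exp (- t) / t))) with (c * (RtoC (t ^ 2) * RtoC (exp (- t) / t))) by ring.
      rewrite <- !RtoC_mult. do 2 f_equal. field. lra.
    + apply Ctends_eq with (c * 0); [|ring]. apply Ctends_scal.
      apply Ctends_mult_0 with (D := 1%R); [|apply Ctends_pow_0].
      generalize at_right_pos. apply filter_imp. intros t Ht.
      rewrite Cmod_RtoC by (left; apply exp_pos). rewrite <- exp_0. apply exp_le_mono. lra.
  - intros [Q [c [H1 H2]]].
    apply Ctends_ext with (fun t => (RtoC (t ^ S (S N)) * Q t) * RtoC t + c * RtoC (t ^ 1)).
    + generalize at_right_pos. apply filter_imp. intros t Ht. rewrite H2 by exact Ht.
      replace (RtoC (t ^ S (S (S N)))) with (RtoC (t ^ S (S N)) * RtoC t)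
        by (rewrite <- RtoC_mult; f_equal; simpl; ring).
      replace (RtoC (t ^ 1)) with (RtoC (t ^ S (S N)) * RtoC (/ t ^ S (S N)) * RtoC t).
      * ring.
      * rewrite <- !RtoC_mult. f_equal. simpl. field. split; [apply pow_nonzero|]; lra.
    + apply Ctends_eq with (0 + c * 0); [|ring]. apply Ctends_plus.
      * apply Ctends_mult_0 with (D := 1%R); [|apply IH, H1].
        exists (mkposreal 1 Rlt_0_1). intros t Ht1 Ht. change (Rabs (t - 0) < 1)%R in Ht1.
        rewrite Rminus_0_r in Ht1. rewrite Cmod_R. lra.
      * apply Ctends_scal, Ctends_pow_0.
Qed.

(** The coefficient of the strongest singularity is a limit of [P] times a power of [t], and that
    limit is 0 because [P] is o(1/t). Removing the term leaves a polar function of lower order that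
    is still o(1/t). *)
Lemma is_polar_null (N : nat) (P : R -> C) :
  is_polar N P -> Ctends (at_right 0) (fun t => RtoC t * P t) 0 ->
  forall t, (0 < t)%R -> P t = 0.
Proof.
  revert P. induction N as [|N IH]; intros P.
  - intros [c H] HP.
    assert (E : c = 0).
    { apply (Ctends_unique (F := at_right 0) (fun t => RtoC t * P t)); [|exact HP].
      apply Ctends_ext with (fun t => c * RtoC (exp (- t))).
      - generalize at_right_pos. apply filter_imp. intros t Ht. rewrite H by exact Ht.
        replace (RtoC t * (c * RtoC (exp (- t) / t))) with (c * (RtoC t * RtoC (exp (- t) / t))) by ring.
        rewrite <- RtoC_mult. do 2 f_equal. field. lra.
      - apply Ctends_eq with (c * 1); [|ring]. apply Ctends_scal, Ctends_exp_0. }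
    intros t Ht. rewrite H, E by exact Ht. ring.
  - intros [Q [c [H1 H2]]] HP.
    assert (E : c = 0).
    { apply (Ctends_unique (F := at_right 0) (fun t => RtoC (t ^ S (S N)) * P t)).
      - apply Ctends_ext with (fun t => RtoC (t ^ S (S N)) * Q t + c).
        + generalize at_right_pos. apply filter_imp. intros t Ht. rewrite H2 by exact Ht.
          assert (E : RtoC (t ^ S (S N)) * RtoC (/ t ^ S (S N)) = 1).
          { rewrite <- RtoC_mult, Rinv_r; [reflexivity|apply pow_nonzero; lra]. }
          replace (RtoC (t ^ S (S N)) * (Q t + c * RtoC (/ t ^ S (S N))))
            with (RtoC (t ^ S (S N)) * Q t + c * (RtoC (t ^ S (S N)) * RtoC (/ t ^ S (S N)))) by ring.
          rewrite E. ring.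
        + apply Ctends_eq with (0 + c); [|ring].
          apply Ctends_plus; [apply is_polar_tends, H1|apply Ctends_const].
      - apply Ctends_ext with (fun t => (RtoC t * P t) * RtoC (t ^ S N)).
        + apply filter_forall. intros t. rewrite <- (tech_pow_Rmult t (S N)), RtoC_mult. ring.
        + apply Ctends_mult_0 with (D := 1%R); [|exact HP].
          exists (mkposreal 1 Rlt_0_1). intros t Ht1 Ht. change (Rabs (t - 0) < 1)%R in Ht1.
          rewrite Rminus_0_r, Rabs_pos_eq in Ht1 by lra.
          rewrite Cmod_RtoC by (apply pow_le; lra). rewrite <- (pow1 (S N)). apply pow_incr. lra. }
    assert (EQ : forall t, (0 < t)%R -> P t = Q t).
    { intros t Ht. rewrite H2, E by exact Ht. ring. }
    intros t Ht. rewrite EQ by exact Ht. apply (IH Q H1); [|exact Ht].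
    apply Ctends_ext with (fun t => RtoC t * P t); [|exact HP].
    generalize at_right_pos. apply filter_imp. intros s Hs. rewrite EQ by exact Hs. reflexivity.
Qed.

(* [L] is the finite part of the integral of [F]: the polar part [P] is
   integrated to 0. *)
Definition has_fp (N : nat) (F : R -> C) (L : C) : Prop :=
  exists G P : R -> C, CInt G L /\ Ctends (at_right 0) (fun t => RtoC t * G t) 0 /\
    is_polar N P /\ forall t, (0 < t)%R -> F t = G t + P t.

Lemma has_fp_plus (N : nat) (F1 F2 : R -> C) (L1 L2 : C) :
  has_fp N F1 L1 -> has_fp N F2 L2 -> has_fp N (fun t => F1 t + F2 t) (L1 + L2).
Proof.
  intros [G1 [P1 [A1 [B1 [C1 D1]]]]] [G2 [P2 [A2 [B2 [C2 D2]]]]].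
  exists (fun t => G1 t + G2 t), (fun t => P1 t + P2 t). repeat split.
  - apply CInt_plus; assumption.
  - apply Ctends_ext with (fun t => RtoC t * G1 t + RtoC t * G2 t).
    + apply filter_forall. intros t. ring.
    + apply Ctends_eq with (0 + 0); [|ring]. apply Ctends_plus; assumption.
  - apply is_polar_plus; assumption.
  - intros t Ht. rewrite D1, D2 by exact Ht. ring.
Qed.

Lemma has_fp_scal (N : nat) (c : C) (F : R -> C) (L : C) :
  has_fp N F L -> has_fp N (fun t => c * F t) (c * L).
Proof.
  intros [G [P [A [B [D E]]]]].
  exists (fun t => c * G t), (fun t => c * P t). repeat split.
  - apply CInt_scal; assumption.
  - apply Ctends_ext with (fun t => c * (RtoC t * G t)).
    + apply filter_forall. intros t. ring.
    + apply Ctends_eq with (c * 0); [|ring]. apply Ctends_scal; assumption.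
  - apply is_polar_scal; assumption.
  - intros t Ht. rewrite E by exact Ht. ring.
Qed.

Lemma has_fp_ext (N : nat) (F G : R -> C) (L : C) :
  (forall t, (0 < t)%R -> F t = G t) -> has_fp N F L -> has_fp N G L.
Proof.
  intros E [H [P [A [B [D K]]]]]. exists H, P. repeat split; try assumption.
  intros t Ht. rewrite <- E by exact Ht. apply K, Ht.
Qed.

Lemma has_fp_sum (N : nat) (F : nat -> R -> C) (L : nat -> C) (n : nat) :
  (forall k, (k <= n)%nat -> has_fp N (F k) (L k)) ->
  has_fp N (fun t => Csum (fun k => F k t) 0 n) (Csum L 0 n).
Proof.
  intros H. induction n as [|n IH].
  - rewrite Csum_O. apply has_fp_ext with (F O); [|apply H; lia].
    intros t _. rewrite Csum_O. reflexivity.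
  - rewrite Csum_S by lia.
    apply has_fp_ext with (fun t => Csum (fun k => F k t) 0 n + F (S n) t).
    + intros t _. rewrite Csum_S by lia. reflexivity.
    + apply has_fp_plus; [apply IH; intros; apply H; lia|apply H; lia].
Qed.

(** The way back from finite parts to genuine integrals: if [F] is o(1/t), then so is its polar
    part, which is therefore zero. *)
Lemma has_fp_CInt (N : nat) (F : R -> C) (L : C) :
  has_fp N F L -> Ctends (at_right 0) (fun t => RtoC t * F t) 0 -> CInt F L.
Proof.
  intros [G [P [A [B [D E]]]]] HF.
  apply CInt_ext with G; [|exact A].
  assert (HP : Ctends (at_right 0) (fun t => RtoC t * P t) 0).
  { apply Ctends_ext with (fun t => RtoC t * F t - RtoC t * G t).
    - generalize at_right_pos. apply filter_imp. intros s Hs. rewrite E by exact Hs. ring.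
    - apply Ctends_eq with (0 - 0); [apply Ctends_minus; assumption|ring]. }
  intros t Ht. rewrite E, (is_polar_null N P D HP t Ht) by exact Ht. ring.
Qed.

(** Beyond [reg_exp] there remain the Taylor terms of degree below [j], which give the poles
    [t^(-2), ..., t^(-j-1)], and the term of degree [j], which is carried by [e^(-t) / t]. *)
Lemma has_fp_exp (N j : nat) (v : C) :
  (0 < Re v)%R -> (j <= N)%nat ->
  has_fp N (fun t => RtoC (/ t ^ S j) * Cexp (- v * RtoC t)) (fp_exp v j).
Proof.
  intros Hv Hj.
  exists (reg_exp v j), (fun t => RtoC (/ t ^ S j) * (Cexp (- v * RtoC t) - exp_rem v j t)
     + (- v) ^ j * RtoC (/ INR (fact j)) * RtoC (exp (- t) / t)).
  split; [apply CInt_reg_exp, Hv|]. split; [|split].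
  - apply Ctends_0_linear with (K := (Cmod v ^ S j + Cmod v ^ j)%R) (r := 1%R); [lra|].
    intros t Ht. assert (Htp : (0 < t ^ S j)%R) by (apply pow_lt; lra).
    (* The bracket collects [exp_rem v (S j)] and [exp_term v j * (1 - e^(-t))], both O(t^(j+1));
       hence [reg_exp] is bounded near 0. *)
    replace (RtoC t * reg_exp v j t - 0) with
      (RtoC t * RtoC (/ t ^ S j) * (exp_rem v (S j) t + exp_term v j t * RtoC (1 - exp (- t)))).
    2:{ unfold reg_exp. rewrite RtoC_minus. simpl exp_rem. ring. }
    rewrite !Cmod_mult, Cmod_RtoC, Cmod_RtoC by (try lra; left; apply Rinv_0_lt_compat, Htp).
    rewrite Rmult_assoc, (Rmult_comm t). apply Rmult_le_compat_r; [lra|].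
    apply Rmult_le_reg_l with (1 := Htp). rewrite <- Rmult_assoc, Rinv_r, Rmult_1_l by lra.
    apply Rle_trans with (1 := Cmod_triangle _ _). rewrite Cmod_mult.
    assert (H1 : (0 <= 1 - exp (- t) <= t)%R).
    { assert (exp (- t) <= 1)%R by (rewrite <- exp_0; apply exp_le_mono; lra).
      pose proof (exp_ineq1_le (- t)). lra. }
    rewrite Cmod_RtoC by lra.
    pose proof (Cmod_exp_rem_le v (S j) t ltac:(lra) ltac:(lra)) as A1.
    pose proof (Cmod_exp_term_le v j t ltac:(lra)) as A2.
    rewrite Rpow_mult_distr in A1, A2.
    pose proof (Cmod_ge_0 (exp_term v j t)).
    assert (A3 : (Cmod (exp_term v j t) * (1 - exp (- t)) <= Cmod v ^ j * t ^ j * t)%R).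
    { apply Rmult_le_compat; lra. }
    replace (t ^ S j * (Cmod v ^ S j + Cmod v ^ j))%R
      with (Cmod v ^ S j * t ^ S j + Cmod v ^ j * t ^ j * t)%R by (simpl; ring). lra.
  - apply is_polar_plus; [|apply is_polar_scal, is_polar_exp].
    assert (K : forall i, (i <= j)%nat ->
      is_polar N (fun t => RtoC (/ t ^ S j) * (Cexp (- v * RtoC t) - exp_rem v i t))).
    2:{ apply K. lia. }
    induction i as [|i IH]; intros Hi.
    + apply is_polar_ext with (fun _ => RtoC 0); [|apply is_polar_0]. intros t _. simpl. ring.
    + apply is_polar_ext with (fun t => RtoC (/ t ^ S j) * (Cexp (- v * RtoC t) - exp_rem v i t)
         + (- v) ^ i * RtoC (/ INR (fact i)) * RtoC (/ t ^ S (j - i))).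
      * intros t Ht. simpl exp_rem. unfold exp_term. rewrite Cpow_mult_l, <- RtoC_pow.
        replace (RtoC (/ t ^ S (j - i))) with (RtoC (/ t ^ S j) * RtoC (t ^ i)); [ring|].
        rewrite <- RtoC_mult. f_equal. replace (S j) with (S (j - i) + i)%nat by lia.
        rewrite pow_add. field. split; apply pow_nonzero; lra.
      * apply is_polar_plus; [apply IH; lia|]. apply is_polar_scal, is_polar_pow. lia.
  - intros t Ht. unfold reg_exp, exp_term.
    rewrite Cpow_mult_l, <- RtoC_pow.
    replace (RtoC (exp (- t) / t)) with (RtoC (/ t ^ S j) * RtoC (t ^ j) * RtoC (exp (- t))); [ring|].
    rewrite <- !RtoC_mult. f_equal. simpl. field. split; [|apply pow_nonzero]; lra.
Qed.

(** * The Laurent coefficients *)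

Lemma CV_radius_ge (a : nat -> R) (r M : R) :
  (forall n, (Rabs (a n * r ^ n) <= M)%R) -> Rbar_le r (CV_radius a).
Proof. intros H. apply (proj1 (CV_radius_bounded a)). exists M. exact H. Qed.

(* [(1 - exp (- t)) / t] is the power series with coefficients [uexp]; the
   coefficients of its inverse are [inv_uexp]. *)
Definition uexp (j : nat) : R := ((-1) ^ j / INR (fact (S j)))%R.

(** Each coefficient depends on all the earlier ones, so a structural recursion carries the whole
    table; it is meaningful at arguments up to [n]. *)
Fixpoint inv_uexp_table (n : nat) : nat -> R :=
  match n with
  | O => fun _ => 1%R
  | S m => fun j =>
      if (j <=? m)%nat then inv_uexp_table m j
      else (- sum_f_R0 (fun i => uexp (S i) * inv_uexp_table m (m - i)) m)%R
  end.

Definition inv_uexp (n : nat) : R := inv_uexp_table n n.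

Lemma inv_uexp_table_eq (n j : nat) : (j <= n)%nat -> inv_uexp_table n j = inv_uexp j.
Proof.
  induction n as [|n IH]; intros Hj.
  - replace j with O by lia. reflexivity.
  - destruct (Nat.eq_dec j (S n)) as [->|E]; [reflexivity|].
    simpl. replace (j <=? n)%nat with true by (symmetry; apply Nat.leb_le; lia). apply IH. lia.
Qed.

Lemma inv_uexp_S (m : nat) :
  inv_uexp (S m) = (- sum_f_R0 (fun i => uexp (S i) * inv_uexp (m - i)) m)%R.
Proof.
  unfold inv_uexp at 1. simpl.
  replace (match m with O => false | S m' => (m <=? m')%nat end) with false.
  2:{ destruct m; [reflexivity|]. symmetry. apply Nat.leb_gt. lia. }
  f_equal. apply sum_eq. intros i Hi. rewrite inv_uexp_table_eq by lia. reflexivity.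
Qed.

Lemma PS_mult_inv_uexp (n : nat) :
  PS_mult uexp inv_uexp n = match n with O => 1%R | S _ => 0%R end.
Proof.
  unfold PS_mult. destruct n as [|m].
  - unfold uexp, inv_uexp. simpl. field.
  - rewrite decomp_sum by lia. simpl pred. rewrite Nat.sub_0_r, inv_uexp_S.
    replace (uexp 0) with 1%R by (unfold uexp; simpl; field).
    replace (sum_f_R0 (fun i => uexp (S i) * inv_uexp (S m - S i)) m)%R
      with (sum_f_R0 (fun i => uexp (S i) * inv_uexp (m - i)) m)%R.
    + ring.
    + apply sum_eq. intros i Hi. reflexivity.
Qed.

(** A telescoping form of [1/2! + 1/3! + ... <= 1], which is what keeps the bound 1 on [inv_uexp]
    stable under its recursion. *)
Lemma sum_inv_fact_le (m : nat) :
  (sum_f_R0 (fun i => / INR (fact (S (S i)))) m <= 1 - / INR (fact (S (S m))))%R.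
Proof.
  induction m as [|m IH].
  - simpl. lra.
  - rewrite tech5.
    assert (H : (2 * / INR (fact (S (S (S m)))) <= / INR (fact (S (S m))))%R).
    { rewrite (fact_simpl (S (S m))), mult_INR, Rinv_mult.
      assert (H1 := INR_fact_lt_0 (S (S m))). apply Rinv_0_lt_compat in H1.
      assert (H2 : (2 * / INR (S (S (S m))) <= 1)%R).
      { apply Rmult_le_reg_r with (INR (S (S (S m)))); [apply lt_0_INR; lia|].
        rewrite Rmult_assoc, Rinv_l by (apply not_0_INR; lia).
        rewrite !S_INR. pose proof (pos_INR m). lra. }
      rewrite <- Rmult_assoc. nra. }
    lra.
Qed.

Lemma Rabs_uexp (j : nat) : Rabs (uexp j) = (/ INR (fact (S j)))%R.
Proof.
  unfold uexp, Rdiv. rewrite Rabs_mult, pow_1_abs, Rmult_1_l.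
  apply Rabs_pos_eq. left. apply Rinv_0_lt_compat, INR_fact_lt_0.
Qed.

Lemma Rabs_inv_uexp_le (n : nat) : (Rabs (inv_uexp n) <= 1)%R.
Proof.
  induction n as [n IH] using (well_founded_induction Nat.lt_wf_0).
  destruct n as [|m].
  - unfold inv_uexp. simpl. rewrite Rabs_R1. lra.
  - rewrite inv_uexp_S, Rabs_Ropp.
    apply Rle_trans with (1 := sum_f_R0_triangle _ _).
    apply Rle_trans with (sum_f_R0 (fun i => / INR (fact (S (S i)))) m)%R.
    + apply sum_Rle. intros i Hi. rewrite Rabs_mult, Rabs_uexp.
      rewrite <- (Rmult_1_r (/ _)) at 2. apply Rmult_le_compat_l.
      * left. apply Rinv_0_lt_compat, INR_fact_lt_0.
      * apply IH. lia.
    + pose proof (sum_inv_fact_le m). pose proof (Rinv_0_lt_compat _ (INR_fact_lt_0 (S (S m)))). lra.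
Qed.

Lemma is_pseries_uexp (t : R) : t <> 0%R -> is_pseries uexp t ((1 - exp (- t)) / t)%R.
Proof.
  intros Ht. pose proof (is_exp_Reals (- t)) as H.
  (* The series of [e^(-t)] without its constant term, divided by [- t]. *)
  apply (is_pseries_decr_1 _ _ (- / t)%R) in H.
  2:{ unfold mult, one; simpl. field. exact Ht. }
  apply (is_series_ext _ (fun k => scal (pow_n t k) (uexp k))) in H.
  2:{ intros n. unfold PS_decr_1, uexp, scal; simpl. unfold mult; simpl.
      rewrite !pow_n_pow. replace (- t)%R with ((-1) * t)%R by ring. rewrite Rpow_mult_distr.
      unfold Rdiv. change (@pow_n _ t n) with (@pow_n R_Ring t n). rewrite (pow_n_pow t n). ring. }
  unfold is_pseries. replace ((1 - exp (- t)) / t)%R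
    with (scal (- / t)%R (plus (exp (- t)) (opp (/ INR (fact 0))%R))); [exact H|].
  unfold scal, plus, opp; simpl. unfold mult; simpl. field. exact Ht.
Qed.

Lemma one_minus_exp_neq_0 (t : R) : t <> 0%R -> (1 - exp (- t))%R <> 0%R.
Proof.
  intros Ht E. apply Ht. assert (E2 : exp (- t) = exp 0) by (rewrite exp_0; lra).
  apply exp_inv in E2. lra.
Qed.

(** Both series converge for [|t| < 1], and by construction their Cauchy product is the constant
    1. *)
Lemma is_pseries_inv_uexp (t : R) :
  (0 < Rabs t < 1)%R -> is_pseries inv_uexp t (t / (1 - exp (- t)))%R.
Proof.
  intros Ht.
  assert (Ht0 : t <> 0%R) by (intros E; rewrite E, Rabs_R0 in Ht; lra).
  assert (R1 : Rbar_lt (Rabs t) (CV_radius uexp)).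
  { apply Rbar_lt_le_trans with 1%R; [exact (proj2 Ht)|]. apply CV_radius_ge with 1%R.
    intros n. rewrite pow1, Rmult_1_r, Rabs_uexp. rewrite <- Rinv_1. apply Rinv_le_contravar; [lra|].
    apply (le_INR 1). pose proof (lt_O_fact (S n)). lia. }
  assert (R2 : Rbar_lt (Rabs t) (CV_radius inv_uexp)).
  { apply Rbar_lt_le_trans with 1%R; [exact (proj2 Ht)|]. apply CV_radius_ge with 1%R.
    intros n. rewrite pow1, Rmult_1_r. apply Rabs_inv_uexp_le. }
  pose proof (PSeries_correct _ _ (CV_radius_inside _ _ R2)) as H2.
  pose proof (is_pseries_mult _ _ _ _ _ (is_pseries_uexp t Ht0) H2 R1 R2) as H3.
  pose proof (is_pseries_unique _ _ _ H3) as H4.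
  rewrite PSeries_decr_1 in H4 by (eexists; exact H3).
  rewrite (PSeries_ext (PS_decr_1 _) (fun _ => 0%R)), PSeries_const_0, PS_mult_inv_uexp in H4
    by (intros n; apply PS_mult_inv_uexp).
  replace (t / (1 - exp (- t)))%R with (PSeries inv_uexp t); [exact H2|].
  assert (Hn := one_minus_exp_neq_0 t Ht0).
  apply Rmult_eq_reg_l with ((1 - exp (- t)) / t)%R.
  - rewrite <- H4. field. split; assumption.
  - apply Rmult_integral_contrapositive. split; [exact Hn|apply Rinv_neq_0_compat, Ht0].
Qed.

(** [is_laurent_expansion] speaks of a sequence in [Q], so the real numbers [inv_uexp] must be
    rational before they can witness it. *)
Definition is_rat (x : R) : Prop := exists q : Q, Q2R q = x.

Lemma is_rat_plus (x y : R) : is_rat x -> is_rat y -> is_rat (x + y).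
Proof. intros [p <-] [q <-]. exists (p + q)%Q. apply Q2R_plus. Qed.

Lemma is_rat_mult (x y : R) : is_rat x -> is_rat y -> is_rat (x * y).
Proof. intros [p <-] [q <-]. exists (p * q)%Q. apply Q2R_mult. Qed.

Lemma is_rat_opp (x : R) : is_rat x -> is_rat (- x).
Proof. intros [p <-]. exists (- p)%Q. apply Q2R_opp. Qed.

Lemma is_rat_uexp (j : nat) : is_rat (uexp j).
Proof.
  apply is_rat_mult.
  - induction j as [|j IH]; simpl.
    + exists 1%Q. unfold Q2R. simpl. field.
    + apply is_rat_mult; [|exact IH]. exists (- (1))%Q. unfold Q2R. simpl. field.
  - assert (E : INR (fact (S j)) = IZR (Z.pos (Pos.of_nat (fact (S j))))).
    { rewrite <- Znat.positive_nat_Z, Nat2Pos.id by apply fact_neq_0. apply INR_IZR_INZ. }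
    exists (1 # Pos.of_nat (fact (S j)))%Q. rewrite E. unfold Q2R. cbn [Qnum Qden]. ring.
Qed.

Lemma is_rat_inv_uexp (n : nat) : is_rat (inv_uexp n).
Proof.
  induction n as [n IH] using (well_founded_induction Nat.lt_wf_0).
  destruct n as [|m].
  - exists 1%Q. unfold Q2R, inv_uexp. simpl. field.
  - rewrite inv_uexp_S. apply is_rat_opp.
    assert (K : forall k, (k <= m)%nat -> is_rat (sum_f_R0 (fun i => uexp (S i) * inv_uexp (m - i))%R k)).
    { induction k as [|k IHk]; intros Hk; simpl.
      - apply is_rat_mult; [apply is_rat_uexp|apply IH; lia].
      - apply is_rat_plus; [apply IHk; lia|].
        apply is_rat_mult; [apply is_rat_uexp|apply IH; lia]. }
    apply K. lia.
Qed.

Lemma powerRZ_pred (t : R) (j : nat) :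
  t <> 0%R -> powerRZ t (Z.of_nat j - 1) = (/ t * t ^ j)%R.
Proof.
  intros Ht. unfold Z.sub. rewrite powerRZ_add by exact Ht. rewrite <- pow_powerRZ. simpl.
  rewrite Rmult_1_r. ring.
Qed.

(** The witness makes [epsilon_spec] applicable in [todd_pseries], so that later facts about
    [laurent_coef] come from the defining expansion itself. *)
Lemma laurent_expansion_exists : exists b, is_laurent_expansion b.
Proof.
  destruct (ClassicalEpsilon.constructive_indefinite_description
              (fun x : nat -> Q => forall n, Q2R (x n) = inv_uexp n)) as [x Hx].
  { exists (fun n => epsilon (inhabits 0%Q) (fun q => Q2R q = inv_uexp n)).
    intros n. apply epsilon_spec. apply is_rat_inv_uexp. }
  exists (fun k => x (Z.to_nat (k + 1))). exists 1%R. split; [lra|]. intros t Ht.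
  assert (Ht0 : t <> 0%R) by (intros E; rewrite E, Rabs_R0 in Ht; lra).
  pose proof (is_pseries_inv_uexp t Ht) as H.
  apply (is_series_scal (/ t)%R) in H.
  replace (/ (1 - exp (- t)))%R with (scal (/ t)%R (t / (1 - exp (- t)))%R).
  2:{ unfold scal; simpl. unfold mult; simpl. field. split; [apply one_minus_exp_neq_0|]; exact Ht0. }
  revert H. apply is_series_ext. intros n. cbv zeta.
  replace (Z.to_nat (Z.of_nat n - 1 + 1)) with n by lia.
  rewrite powerRZ_pred, Hx by exact Ht0. unfold scal; simpl. unfold mult; simpl.
  rewrite pow_n_pow. ring.
Qed.

(* The coefficients [b_(j-1)] of [t / (1 - exp (- t))]. *)
Definition todd_coef (j : nat) : R := laurent_coef (Z.of_nat j - 1).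

Lemma todd_pseries :
  exists r : R, (0 < r)%R /\ forall t, (0 < t < r)%R -> is_pseries todd_coef t (t / (1 - exp (- t)))%R.
Proof.
  destruct (epsilon_spec (inhabits (fun _ => 0%Q)) is_laurent_expansion laurent_expansion_exists)
    as [r [Hr H]].
  exists r. split; [exact Hr|]. intros t Ht.
  assert (Ht0 : t <> 0%R) by lra.
  assert (Ht2 : (0 < Rabs t < r)%R) by (rewrite Rabs_pos_eq; lra).
  specialize (H t Ht2). apply (is_series_scal t) in H.
  refine (is_series_ext _ _ _ _ H). intros n. cbv zeta.
  rewrite powerRZ_pred by exact Ht0. unfold scal; simpl. unfold mult; simpl.
  change (@pow_n _ t n) with (@pow_n R_Ring t n). rewrite (pow_n_pow t n).
  unfold todd_coef, laurent_coef, laurent_coef_rat. field. exact Ht0.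
Qed.

(** * Asymptotic expansions at 0 *)

Definition asym0 (f : R -> C) (a : nat -> C) : Prop :=
  forall N : nat, exists K r : R, (0 < r)%R /\ (0 <= K)%R /\ forall t, (0 < t < r)%R ->
    (Cmod (f t - Csum (fun j => (a j * RtoC (t ^ j))%C) 0 N) <= K * t ^ S N)%R.

Lemma sum_f_R0_Csum (a : nat -> R) (N : nat) :
  RtoC (sum_f_R0 a N) = Csum (fun j => RtoC (a j)) 0 N.
Proof.
  induction N as [|N IH].
  - rewrite Csum_O. reflexivity.
  - rewrite Csum_S, tech5, RtoC_plus, IH by lia. reflexivity.
Qed.

(** The remainder after order [N] is [t^(N+1)] times the shifted power series. The terms of the
    series are bounded at [q = r / 2], so the shifted series has positive radius, is continuous at 0
    and hence bounded near it. *)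
Lemma asym0_todd :
  asym0 (fun t => RtoC (t / (1 - exp (- t)))) (fun j => RtoC (todd_coef j)).
Proof.
  intros N. destruct todd_pseries as [r [Hr H]].
  assert (Hq : (0 < r / 2 < r)%R) by lra. set (q := (r / 2)%R) in *.
  assert (HM : exists M, forall n, (Rabs (todd_coef n * q ^ n) <= M)%R).
  { pose proof (ex_series_lim_0 _ (ex_intro _ _ (H q Hq))) as L.
    destruct (filterlim_bounded (V := R_NormedModule)
      (fun k => scal (pow_n q k) (todd_coef k)) (ex_intro _ 0%R L)) as [M HM].
    exists M. intros n. specialize (HM n). change (Rabs (pow_n q n * todd_coef n) <= M)%R in HM.
    change (@pow_n _ q n) with (@pow_n R_Ring q n) in HM.
    rewrite (pow_n_pow q n), Rmult_comm in HM. exact HM. }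
  destruct HM as [M HM].
  assert (HR : Rbar_lt (Rabs 0) (CV_radius (PS_decr_n todd_coef (S N)))).
  { apply Rbar_lt_le_trans with q; [rewrite Rabs_R0; apply Hq|].
    apply CV_radius_ge with (M / q ^ S N)%R. intros n. unfold PS_decr_n.
    assert (Hqp : (0 < q ^ S N)%R) by (apply pow_lt; lra).
    apply Rmult_le_reg_r with (1 := Hqp). unfold Rdiv. rewrite (Rmult_assoc M), Rinv_l, Rmult_1_r by lra.
    rewrite <- (Rabs_pos_eq (q ^ S N)) at 1 by lra. rewrite <- Rabs_mult, Rmult_assoc, <- pow_add, (Nat.add_comm n).
    apply HM. }
  pose proof (PSeries_continuity _ _ HR) as HC.
  set (p := PSeries (PS_decr_n todd_coef (S N))) in *.
  destruct (HC 1%R Rlt_0_1) as [d [Hd HD]].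
  exists (Rabs (p 0%R) + 1)%R, (Rmin d r).
  split; [apply Rmin_pos; assumption|]. split; [pose proof (Rabs_pos (p 0%R)); lra|].
  intros t Ht. pose proof (Rmin_l d r). pose proof (Rmin_r d r).
  assert (Ht2 : (0 < t < r)%R) by lra.
  rewrite <- (is_pseries_unique _ _ _ (H t Ht2)).
  rewrite (PSeries_decr_n _ N) by (eexists; exact (H t Ht2)). fold p.
  rewrite RtoC_plus, sum_f_R0_Csum.
  rewrite (Csum_ext _ (fun j => RtoC (todd_coef j) * RtoC (t ^ j))) by (intros; apply RtoC_mult).
  match goal with |- (Cmod ?z <= _)%R => replace z with (RtoC (t ^ S N * p t)) by ring end.
  rewrite Cmod_R, Rabs_mult, Rabs_pos_eq, Rmult_comm by (apply pow_le; lra).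
  apply Rmult_le_compat_r; [apply pow_le; lra|].
  assert (HP : (Rabs (p t - p 0) < 1)%R).
  { apply HD. split; [split; [exact I|lra]|]. simpl. unfold R_dist. rewrite Rminus_0_r, Rabs_pos_eq; lra. }
  pose proof (Rabs_triang (p t - p 0) (p 0)) as T. replace (p t - p 0 + p 0)%R with (p t) in T by ring. lra.
Qed.

Lemma asym0_exp (v : C) :
  (0 <= Re v)%R ->
  asym0 (fun t => Cexp (- v * RtoC t)) (fun j => (- v) ^ j * RtoC (/ INR (fact j))).
Proof.
  intros Hv N. exists (Cmod v ^ S N)%R, 1%R. split; [lra|]. split; [apply pow_le, Cmod_ge_0|].
  intros t Ht. rewrite <- Rpow_mult_distr.
  assert (E : forall M, Cexp (- v * RtoC t) - Csum (fun j => (- v) ^ j * RtoC (/ INR (fact j)) * RtoC (t ^ j)) 0 M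
     = exp_rem v (S M) t).
  { induction M as [|M IH].
    - rewrite Csum_O. simpl. unfold exp_term. simpl. ring.
    - rewrite Csum_S by lia. change (exp_rem v (S (S M)) t) with (exp_rem v (S M) t - exp_term v (S M) t).
      rewrite <- IH. unfold exp_term. rewrite Cpow_mult_l, <- RtoC_pow. ring. }
  rewrite E. apply Cmod_exp_rem_le; lra.
Qed.

(** The Cauchy product, peeled at the front of [a] to match the passage from [f] to [(f - a 0) / t]
    in [asym0_mult]. *)
Fixpoint conv (a b : nat -> C) (n : nat) : C :=
  match n with
  | O => a O * b O
  | S m => a O * b (S m) + conv (fun j => a (S j)) b m
  end.

Lemma asym0_shift (f : R -> C) (a : nat -> C) :
  asym0 f a -> asym0 (fun t => (f t - a O) * RtoC (/ t)) (fun j => a (S j)).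
Proof.
  intros H N. destruct (H (S N)) as [K [r [Hr [HK B]]]]. exists K, r.
  split; [exact Hr|]. split; [exact HK|]. intros t Ht.
  specialize (B t Ht). rewrite Csum_shift in B.
  assert (E : Csum (fun k => a (S k) * RtoC (t ^ S k)) 0 N = RtoC t * Csum (fun k => a (S k) * RtoC (t ^ k)) 0 N).
  { rewrite <- Csum_scal. apply Csum_ext. intros k _. rewrite <- tech_pow_Rmult, RtoC_mult. ring. }
  rewrite E in B. simpl (t ^ 0)%R in B.
  replace ((f t - a O) * RtoC (/ t) - Csum (fun j => a (S j) * RtoC (t ^ j)) 0 N)
    with (RtoC (/ t) * (f t - (a O * 1 + RtoC t * Csum (fun j => a (S j) * RtoC (t ^ j)) 0 N))).
  2:{ replace (Csum (fun j => a (S j) * RtoC (t ^ j)) 0 N)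
        with (RtoC (/ t) * RtoC t * Csum (fun j => a (S j) * RtoC (t ^ j)) 0 N) at 2.
      - ring.
      - rewrite <- RtoC_mult, Rinv_l by lra. ring. }
  rewrite Cmod_mult, Cmod_RtoC by (left; apply Rinv_0_lt_compat; lra).
  apply Rmult_le_reg_l with t; [lra|]. rewrite <- Rmult_assoc, Rinv_r, Rmult_1_l by lra.
  apply Rle_trans with (1 := B). right. simpl. ring.
Qed.

Lemma asym0_bounded (f : R -> C) (a : nat -> C) :
  asym0 f a -> exists K r : R, (0 < r)%R /\ (0 <= K)%R /\ forall t, (0 < t < r)%R -> (Cmod (f t) <= K)%R.
Proof.
  intros H. destruct (H O) as [K [r [Hr [HK B]]]].
  exists (K * r + Cmod (a O))%R, r. split; [exact Hr|]. split.
  { apply Rplus_le_le_0_compat; [apply Rmult_le_pos; lra|apply Cmod_ge_0]. }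
  intros t Ht. specialize (B t Ht). rewrite Csum_O in B. simpl in B.
  replace (f t) with ((f t - a O * 1) + a O) by ring.
  apply Rle_trans with (1 := Cmod_triangle _ _). rewrite Rmult_1_r in B.
  assert (K * t <= K * r)%R by (apply Rmult_le_compat_l; lra). lra.
Qed.

(** From [f g = a_0 g + t ((f - a_0) / t) g]: in the second summand one order less is wanted of a
    product of the same kind, so induction on [N] for all [f] replaces any double sum. *)
Lemma asym0_mult (f g : R -> C) (a b : nat -> C) :
  asym0 f a -> asym0 g b -> asym0 (fun t => f t * g t) (conv a b).
Proof.
  intros Hf Hg N. revert f a Hf. induction N as [|N IH]; intros f a Hf.
  - destruct (Hf O) as [K1 [r1 [Hr1 [HK1 B1]]]]. destruct (Hg O) as [K2 [r2 [Hr2 [HK2 B2]]]].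
    destruct (asym0_bounded g b Hg) as [K3 [r3 [Hr3 [HK3 B3]]]].
    exists (K1 * K3 + Cmod (a O) * K2)%R, (Rmin r1 (Rmin r2 r3)). split.
    { repeat apply Rmin_pos; assumption. } split.
    { apply Rplus_le_le_0_compat; apply Rmult_le_pos; try assumption. apply Cmod_ge_0. }
    intros t Ht. pose proof (Rmin_l r1 (Rmin r2 r3)). pose proof (Rmin_r r1 (Rmin r2 r3)).
    pose proof (Rmin_l r2 r3). pose proof (Rmin_r r2 r3).
    specialize (B1 t ltac:(lra)). specialize (B2 t ltac:(lra)). specialize (B3 t ltac:(lra)).
    rewrite Csum_O in *. simpl pow in *. simpl conv.
    replace (f t * g t - a O * b O * 1) with ((f t - a O * 1) * g t + a O * (g t - b O * 1)) by ring.
    apply Rle_trans with (1 := Cmod_triangle _ _). rewrite !Cmod_mult.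
    pose proof (Rmult_le_compat _ _ _ _ (Cmod_ge_0 _) (Cmod_ge_0 _) B1 B3).
    pose proof (Rmult_le_compat_l _ _ _ (Cmod_ge_0 (a O)) B2). lra.
  - destruct (IH _ _ (asym0_shift f a Hf)) as [K1 [r1 [Hr1 [HK1 B1]]]].
    destruct (Hg (S N)) as [K2 [r2 [Hr2 [HK2 B2]]]].
    exists (Cmod (a O) * K2 + K1)%R, (Rmin r1 r2). split; [apply Rmin_pos; assumption|]. split.
    { apply Rplus_le_le_0_compat; [apply Rmult_le_pos; [apply Cmod_ge_0|]|]; assumption. }
    intros t Ht. pose proof (Rmin_l r1 r2). pose proof (Rmin_r r1 r2).
    specialize (B1 t ltac:(lra)). specialize (B2 t ltac:(lra)).
    assert (E : Csum (fun j => conv a b j * RtoC (t ^ j)) 0 (S N)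
       = a O * Csum (fun j => b j * RtoC (t ^ j)) 0 (S N)
         + RtoC t * Csum (fun j => conv (fun j => a (S j)) b j * RtoC (t ^ j)) 0 N).
    { rewrite !Csum_shift, <- !Csum_scal. simpl conv. simpl (t ^ 0)%R.
      rewrite (Csum_ext _ (fun k => a O * (b (S k) * RtoC (t ^ S k))
                 + RtoC t * (conv (fun j => a (S j)) b k * RtoC (t ^ k)))).
      - rewrite Csum_plus, Csum_scal. ring.
      - intros k _. rewrite <- tech_pow_Rmult, RtoC_mult. ring. }
    rewrite E.
    replace (f t * g t - _) with
      (a O * (g t - Csum (fun j => b j * RtoC (t ^ j)) 0 (S N))
       + RtoC t * ((f t - a O) * RtoC (/ t) * g t
            - Csum (fun j => conv (fun j => a (S j)) b j * RtoC (t ^ j)) 0 N)).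
    2:{ replace (RtoC t * ((f t - a O) * RtoC (/ t) * g t
            - Csum (fun j => conv (fun j => a (S j)) b j * RtoC (t ^ j)) 0 N))
         with ((RtoC t * RtoC (/ t)) * ((f t - a O) * g t)
            - RtoC t * Csum (fun j => conv (fun j => a (S j)) b j * RtoC (t ^ j)) 0 N) by ring.
        rewrite <- RtoC_mult, Rinv_r by lra. ring. }
    apply Rle_trans with (1 := Cmod_triangle _ _). rewrite !Cmod_mult, (Cmod_RtoC t) by lra.
    pose proof (Rmult_le_compat_l _ _ _ (Cmod_ge_0 (a O)) B2) as P1.
    pose proof (Rmult_le_compat_l t _ _ ltac:(lra) B1) as P2.
    replace ((Cmod (a O) * K2 + K1) * t ^ S (S N))%R
      with (Cmod (a O) * (K2 * t ^ S (S N)) + t * (K1 * t ^ S N))%R by (simpl; ring). lra.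
Qed.

(** For [t >= r] a lower power of [t] is at most a constant times a higher one. So the linearly
    bounded [f] and its Taylor polynomial are both O(t^(N+1)) there, and the local estimate extends
    to the half-line. *)
Lemma asym0_global (f : R -> C) (a : nat -> C) :
  asym0 f a ->
  (forall r, (0 < r)%R -> exists K, forall t, (r <= t)%R -> (Cmod (f t) <= K * t)%R) ->
  forall N, exists K : R, (0 <= K)%R /\ forall t, (0 < t)%R ->
    (Cmod (f t - Csum (fun j => (a j * RtoC (t ^ j))%C) 0 N) <= K * t ^ S N)%R.
Proof.
  intros H Hinf N. destruct (H N) as [K [r [Hr [HK B]]]].
  destruct (Hinf r Hr) as [K2 B2].
  assert (P : forall j M, (j <= M)%nat -> exists D, (0 <= D)%R /\ forall t, (r <= t)%R -> (t ^ j <= D * t ^ M)%R).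
  { intros j M Hj. exists (/ r ^ (M - j))%R. split; [left; apply Rinv_0_lt_compat, pow_lt, Hr|].
    intros t Ht. replace M with ((M - j) + j)%nat at 2 by lia. rewrite pow_add, <- Rmult_assoc.
    rewrite <- (Rmult_1_l (t ^ j)) at 1. apply Rmult_le_compat_r; [apply pow_le; lra|].
    apply Rmult_le_reg_l with (r ^ (M - j))%R; [apply pow_lt, Hr|].
    rewrite <- Rmult_assoc, Rinv_r, Rmult_1_r, Rmult_1_l by (apply pow_nonzero; lra).
    apply pow_incr. lra. }
  assert (S1 : forall M, (M <= N)%nat -> exists D, (0 <= D)%R /\ forall t, (r <= t)%R ->
      (Cmod (Csum (fun j => (a j * RtoC (t ^ j))%C) 0 M) <= D * t ^ S N)%R).
  { intros M HM. induction M as [|M IH].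
    - destruct (P O (S N)) as [D [HD HP]]; [lia|]. exists (Cmod (a O) * D)%R.
      split; [apply Rmult_le_pos; [apply Cmod_ge_0|exact HD]|]. intros t Ht.
      rewrite Csum_O, Cmod_mult, Cmod_RtoC by (apply pow_le; lra). rewrite Rmult_assoc.
      apply Rmult_le_compat_l; [apply Cmod_ge_0|]. apply HP, Ht.
    - destruct IH as [D1 [HD1 HP1]]; [lia|].
      destruct (P (S M) (S N)) as [D [HD HP]]; [lia|]. exists (D1 + Cmod (a (S M)) * D)%R.
      split; [apply Rplus_le_le_0_compat; [|apply Rmult_le_pos; [apply Cmod_ge_0|]]; assumption|].
      intros t Ht. rewrite Csum_S by lia. apply Rle_trans with (1 := Cmod_triangle _ _).
      rewrite Rmult_plus_distr_r. apply Rplus_le_compat; [apply HP1, Ht|].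
      rewrite Cmod_mult, Cmod_RtoC by (apply pow_le; lra). rewrite Rmult_assoc.
      apply Rmult_le_compat_l; [apply Cmod_ge_0|]. apply HP, Ht. }
  destruct (S1 N ltac:(lia)) as [D [HD HS]].
  destruct (P 1%nat (S N)) as [E [HE HP]]; [lia|].
  exists (K + (Rabs K2 * E + D))%R. split.
  { repeat apply Rplus_le_le_0_compat; try assumption. apply Rmult_le_pos; [apply Rabs_pos|exact HE]. }
  intros t Ht. assert (Htp : (0 < t ^ S N)%R) by (apply pow_lt, Ht).
  destruct (Rlt_le_dec t r) as [L|L].
  - apply Rle_trans with (1 := B t (conj Ht L)). apply Rmult_le_compat_r; [lra|].
    pose proof (Rmult_le_pos _ _ (Rabs_pos K2) HE). lra.
  - unfold Cminus. apply Rle_trans with (1 := Cmod_triangle _ _). rewrite Cmod_opp.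
    pose proof (B2 t L) as X1. pose proof (HS t L) as X2. pose proof (HP t L) as X3.
    rewrite pow_1 in X3.
    assert (X4 : (K2 * t <= Rabs K2 * (E * t ^ S N))%R).
    { apply Rle_trans with (Rabs K2 * t)%R.
      - apply Rmult_le_compat_r; [lra|apply Rle_abs].
      - apply Rmult_le_compat_l; [apply Rabs_pos|exact X3]. }
    pose proof (Rmult_le_pos _ _ HK (Rlt_le _ _ Htp)). lra.
Qed.

(** * Watson's lemma *)

Definition linear_growth (f : R -> C) : Prop :=
  forall r, (0 < r)%R -> exists K, forall t, (r <= t)%R -> (Cmod (f t) <= K * t)%R.

Definition taylor_rem (f : R -> C) (a : nat -> C) (N : nat) (t : R) : C :=
  f t - Csum (fun j => a j * RtoC (t ^ j)) 0 N.

(** The quotient is O(t^M). The value [M = 0] gives the integrals of the exact formula; larger [M]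
    give the successive remainders in Watson's lemma. *)
Definition watson_integrand (f : R -> C) (a : nat -> C) (p M : nat) (v : C) (t : R) : C :=
  RtoC (/ t ^ S p) * taylor_rem f a (p + M) t * Cexp (- v * RtoC t).

Definition watson_integral (f : R -> C) (a : nat -> C) (p M : nat) (v : C) : C :=
  RInt_gen (V := C_R_CompleteNormedModule) (watson_integrand f a p M v)
    (at_right 0) (Rbar_locally p_infty).

Lemma Cmod_watson_integrand_le (f : R -> C) (a : nat -> C) (p M : nat) :
  asym0 f a -> linear_growth f ->
  exists K : R, (0 <= K)%R /\ forall v t, (0 < t)%R ->
    (Cmod (watson_integrand f a p M v t) <= K * (t ^ M * exp (- Re v * t)))%R.
Proof.
  intros Hf Hg. destruct (asym0_global f a Hf Hg (p + M)) as [K [HK B]].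
  exists K. split; [exact HK|]. intros v t Ht.
  assert (Htp : (0 < t ^ S p)%R) by (apply pow_lt, Ht).
  unfold watson_integrand. rewrite !Cmod_mult, Cmod_Cexp, Cmod_RtoC by (left; apply Rinv_0_lt_compat, Htp).
  replace (Re (- v * RtoC t)) with (- Re v * t)%R by (destruct v; simpl; ring).
  rewrite <- Rmult_assoc. apply Rmult_le_compat_r; [left; apply exp_pos|].
  apply Rmult_le_reg_l with (1 := Htp). rewrite <- Rmult_assoc, Rinv_r, Rmult_1_l by lra.
  apply Rle_trans with (1 := B t Ht). right.
  replace (S (p + M)) with (S p + M)%nat by lia. rewrite pow_add. ring.
Qed.

Lemma Cdiff_watson_integrand (f : R -> C) (a : nat -> C) (p M : nat) (v : C) (t : R) :
  (0 < t)%R -> Cdiff f t -> Cdiff (watson_integrand f a p M v) t.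
Proof.
  intros Ht Hf. unfold watson_integrand, taylor_rem. apply Cdiff_mult; [apply Cdiff_mult|].
  - apply Cdiff_RtoC. auto_derive. apply (pow_nonzero t (S p)). lra.
  - apply Cdiff_minus; [exact Hf|].
    apply (Cdiff_sum (fun j t => a j * RtoC (t ^ j))). intros k.
    apply Cdiff_mult; [apply Cdiff_const|]. apply Cdiff_RtoC. auto_derive. easy.
  - eexists. apply Cder_Cexp.
Qed.

(** The constant [K] is independent of [v], so the bound is O(s^(-M-1)) in [s = Re v]: stronger than
    the o(s^(-M)) demanded of an expansion. *)
Lemma watson_integral_correct (f : R -> C) (a : nat -> C) (p M : nat) :
  asym0 f a -> linear_growth f -> (forall t, (0 < t)%R -> Cdiff f t) ->
  exists K : R, (0 <= K)%R /\ forall v, (0 < Re v)%R ->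
    CInt (watson_integrand f a p M v) (watson_integral f a p M v) /\
    (Cmod (watson_integral f a p M v) <= K * (INR M / (Re v / 2)) ^ M / (Re v / 2))%R.
Proof.
  intros Hf Hg Hd. destruct (Cmod_watson_integrand_le f a p M Hf Hg) as [K [HK B]].
  exists K. split; [exact HK|]. intros v Hv.
  destruct (CInt_dominated (watson_integrand f a p M v) (K * (INR M / (Re v / 2)) ^ M) (Re v / 2))
    as [l [H1 H2]].
  - lra.
  - intros t Ht. apply Cdiff_watson_integrand; auto.
  - intros t Ht. apply Rle_trans with (1 := B v t Ht). rewrite Rmult_assoc.
    apply Rmult_le_compat_l; [exact HK|]. apply pow_exp_le; lra.
  - assert (E : watson_integral f a p M v = l) by exact (CInt_RInt_gen _ _ H1).
    rewrite E. split; assumption.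
Qed.

(** The indices from -1 down to [- M], growing at the far end so that each further order of Watson's
    expansion adds one term. *)
Fixpoint neg_sum (g : Z -> C) (M : nat) : C :=
  match M with
  | O => 0
  | S m => g (- Z.of_nat (S m))%Z + neg_sum g m
  end.

Lemma Csum_Z_split (g : Z -> C) (M N : nat) :
  Csum (fun j => g (Z.of_nat j - Z.of_nat M)%Z) 0 (M + N)
  = neg_sum g M + Csum (fun j => g (Z.of_nat j)) 0 N.
Proof.
  induction M as [|M IH].
  - simpl neg_sum. rewrite Cplus_0_l. apply Csum_ext. intros k _. f_equal. simpl Z.of_nat. lia.
  - change (S M + N)%nat with (S (M + N)). rewrite Csum_shift. simpl neg_sum. rewrite <- Cplus_assoc, <- IH. f_equal.
    apply Csum_ext. intros k _. f_equal. lia.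
Qed.

(** Raising [M] by one moves the Taylor term of degree [p + M + 1] out of the remainder; divided by
    [t^(p+1)] it is a multiple of [t^M e^(-st)], a Gamma integral. *)
Lemma watson_expansion (f : R -> C) (a : nat -> C) (p M : nat) (s : R) (g : Z -> C) :
  asym0 f a -> linear_growth f -> (forall t, (0 < t)%R -> Cdiff f t) -> (0 < s)%R ->
  (forall m, g (- Z.of_nat (S m))%Z = a (p + S m)%nat * RtoC (INR (fact m) / s ^ S m)) ->
  watson_integral f a p 0 (RtoC s) = neg_sum g M + watson_integral f a p M (RtoC s).
Proof.
  intros Hf Hg Hd Hs Hc. induction M as [|M IH].
  - simpl. ring.
  - rewrite IH. simpl neg_sum.
    enough (E : watson_integral f a p M (RtoC s) =
       g (- Z.of_nat (S M))%Z + watson_integral f a p (S M) (RtoC s)) by (rewrite E; simpl; ring).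
    destruct (watson_integral_correct f a p M Hf Hg Hd) as [K1 [_ H1]].
    destruct (watson_integral_correct f a p (S M) Hf Hg Hd) as [K2 [_ H2]].
    destruct (H1 (RtoC s) Hs) as [H3 _]. destruct (H2 (RtoC s) Hs) as [H4 _].
    apply (CInt_unique _ _ _ H3).
    apply CInt_ext with (fun t => a (p + S M)%nat * RtoC (t ^ M * exp (- s * t))
         + watson_integrand f a p (S M) (RtoC s) t).
    + intros t Ht. unfold watson_integrand, taylor_rem.
      replace (- RtoC s * RtoC t) with (RtoC (- s * t)) by (rewrite RtoC_mult, RtoC_opp; ring).
      rewrite Cexp_RtoC. replace (p + S M)%nat with (S (p + M)) by lia. rewrite Csum_S by lia.
      rewrite RtoC_mult.
      replace (RtoC (t ^ M)) with (RtoC (/ t ^ S p) * RtoC (t ^ S (p + M))); [ring|].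
      rewrite <- RtoC_mult. f_equal. replace (S (p + M)) with (S p + M)%nat by lia.
      rewrite pow_add. field. apply pow_nonzero. lra.
    + rewrite Hc. apply CInt_plus; [|exact H4]. apply CInt_scal, CInt_pow_exp, Hs.
Qed.

(** * The exact formula for the partial sums *)

Lemma linear_growth_todd : linear_growth (fun t => RtoC (t / (1 - exp (- t)))).
Proof.
  intros r Hr. exists (/ (1 - exp (- r)))%R. intros t Ht.
  assert (H1 : (exp (- r) < 1)%R) by (rewrite <- exp_0; apply exp_increasing; lra).
  assert (H2 : (exp (- t) <= exp (- r))%R) by (apply exp_le_mono; lra).
  rewrite Cmod_RtoC by (apply Rmult_le_pos; [lra|left; apply Rinv_0_lt_compat; lra]).
  unfold Rdiv. rewrite Rmult_comm. apply Rmult_le_compat_r; [lra|].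
  apply Rinv_le_contravar; lra.
Qed.

Lemma linear_growth_mult_exp (f : R -> C) (v : C) :
  (0 <= Re v)%R -> linear_growth f -> linear_growth (fun t => f t * Cexp (- v * RtoC t)).
Proof.
  intros Hv H r Hr. destruct (H r Hr) as [K HK]. exists K. intros t Ht.
  rewrite Cmod_mult. apply Rle_trans with (2 := HK t Ht).
  rewrite <- (Rmult_1_r (Cmod (f t))) at 2. apply Rmult_le_compat_l; [apply Cmod_ge_0|].
  apply Cmod_Cexp_le_1; lra.
Qed.

Definition todd (t : R) : C := RtoC (t / (1 - exp (- t))).

Definition ctodd_coef (j : nat) : C := RtoC (todd_coef j).

Definition todd_exp (w : C) (t : R) : C := todd t * Cexp (- w * RtoC t).

Definition todd_exp_coef (w : C) : nat -> C :=
  conv ctodd_coef (fun j => (- w) ^ j * RtoC (/ INR (fact j))).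

Lemma Cdiff_todd (t : R) : (0 < t)%R -> Cdiff todd t.
Proof.
  intros Ht. apply Cdiff_RtoC. auto_derive. apply (one_minus_exp_neq_0 t). lra.
Qed.

Lemma geometric_exp (w : C) (m : nat) (t : R) :
  (1 - RtoC (exp (- t))) * Csum (fun k => Cexp (- (RtoC (INR k) + w) * RtoC t)) 0 m
  = Cexp (- w * RtoC t) * (1 - Cexp (- RtoC (INR (S m)) * RtoC t)).
Proof.
  induction m as [|m IH].
  - rewrite Csum_O. simpl INR.
    replace (- RtoC 1 * RtoC t) with (RtoC (- t)) by (rewrite RtoC_opp; ring). rewrite Cexp_RtoC.
    replace (- (0 + w) * RtoC t) with (- w * RtoC t) by ring. ring.
  - rewrite Csum_S by lia. rewrite Cmult_plus_distr_l, IH.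
    replace (- (RtoC (INR (S m)) + w) * RtoC t)
      with (- w * RtoC t + - RtoC (INR (S m)) * RtoC t) by ring.
    replace (- RtoC (INR (S (S m))) * RtoC t) with (- RtoC (INR (S m)) * RtoC t + RtoC (- t)).
    2:{ rewrite (S_INR (S m)), RtoC_plus, RtoC_opp. ring. }
    rewrite !Cexp_plus, Cexp_RtoC. ring.
Qed.

Lemma Ctends_watson_integrand (f : R -> C) (a : nat -> C) (p : nat) (v : C) :
  asym0 f a -> linear_growth f -> (0 <= Re v)%R ->
  Ctends (at_right 0) (fun t => RtoC t * watson_integrand f a p 0 v t) 0.
Proof.
  intros Hf Hg Hv. destruct (Cmod_watson_integrand_le f a p 0 Hf Hg) as [K [HK B]].
  apply Ctends_0_linear with (K := K) (r := 1%R); [lra|]. intros t Ht.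
  replace (RtoC t * watson_integrand f a p 0 v t - 0) with (RtoC t * watson_integrand f a p 0 v t) by ring.
  rewrite Cmod_mult, Cmod_RtoC, Rmult_comm by lra. apply Rmult_le_compat_r; [lra|].
  apply Rle_trans with (1 := B v t ltac:(lra)). rewrite <- (Rmult_1_r K) at 2.
  apply Rmult_le_compat_l; [exact HK|]. simpl. rewrite Rmult_1_l. rewrite <- exp_0. apply exp_le_mono. nra.
Qed.

(** The integral of [F] is computed twice: as a difference of two convergent integrals ([I3]), and
    by finite parts from its expression through pure exponentials ([FP]). *)
Lemma fp_sum_formula (n m : nat) (w : C) :
  (0 < Re w)%R ->
  Csum (fun k => fp_exp (RtoC (INR k) + w) n) 0 m =
  watson_integral todd ctodd_coef (S n) 0 w
  + Csum (fun j => ctodd_coef j * fp_exp w (S n - j)) 0 (S n)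
  - Csum (fun j => todd_exp_coef w j * fp_exp (RtoC (INR (S m))) (S n - j)) 0 (S n)
  - watson_integral (todd_exp w) (todd_exp_coef w) (S n) 0 (RtoC (INR (S m))).
Proof.
  intros Hw. set (p := S n). set (s := RtoC (INR (S m))).
  assert (Hs : (0 < Re s)%R) by (apply (lt_0_INR (S m)); lia).
  assert (A1 : asym0 todd ctodd_coef) by exact asym0_todd.
  assert (A2 : asym0 (todd_exp w) (todd_exp_coef w)).
  { apply asym0_mult; [exact asym0_todd|apply asym0_exp; lra]. }
  assert (G1 : linear_growth todd) by exact linear_growth_todd.
  assert (G2 : linear_growth (todd_exp w)).
  { apply linear_growth_mult_exp; [lra|exact linear_growth_todd]. }
  assert (D1 : forall t, (0 < t)%R -> Cdiff todd t) by exact Cdiff_todd.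
  assert (D2 : forall t, (0 < t)%R -> Cdiff (todd_exp w) t).
  { intros t Ht. apply Cdiff_mult; [apply Cdiff_todd, Ht|]. eexists. apply Cder_Cexp. }
  destruct (watson_integral_correct todd ctodd_coef p 0 A1 G1 D1) as [K1 [_ H1]].
  destruct (watson_integral_correct (todd_exp w) (todd_exp_coef w) p 0 A2 G2 D2) as [K2 [_ H2]].
  destruct (H1 w Hw) as [I1 _]. destruct (H2 s Hs) as [I2 _].
  pose proof (CInt_minus _ _ _ _ I1 I2) as I3.
  pose proof (Ctends_minus (F := at_right 0) _ _ _ _
    (Ctends_watson_integrand todd ctodd_coef p w A1 G1 (Rlt_le _ _ Hw))
    (Ctends_watson_integrand _ _ p s A2 G2 (Rlt_le _ _ Hs))) as T3.
  set (F := fun t => watson_integrand todd ctodd_coef p 0 w t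
       - watson_integrand (todd_exp w) (todd_exp_coef w) p 0 s t) in *.
  assert (FP : has_fp p F
    (Csum (fun k => fp_exp (RtoC (INR k) + w) n) 0 m
     + (- (1)) * Csum (fun j => ctodd_coef j * fp_exp w (p - j)) 0 p
     + Csum (fun j => todd_exp_coef w j * fp_exp s (p - j)) 0 p)).
  { apply has_fp_ext with (fun t =>
      Csum (fun k => RtoC (/ t ^ S n) * Cexp (- (RtoC (INR k) + w) * RtoC t)) 0 m
      + (- (1)) * Csum (fun j => ctodd_coef j * (RtoC (/ t ^ S (p - j)) * Cexp (- w * RtoC t))) 0 p
      + Csum (fun j => todd_exp_coef w j * (RtoC (/ t ^ S (p - j)) * Cexp (- s * RtoC t))) 0 p).
    - intros t Ht. unfold F, watson_integrand, taylor_rem. rewrite Nat.add_0_r.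
      assert (E : forall (a : nat -> C) (e : C),
        Csum (fun j => a j * (RtoC (/ t ^ S (p - j)) * e)) 0 p
        = RtoC (/ t ^ S p) * e * Csum (fun j => a j * RtoC (t ^ j)) 0 p).
      { intros a e. rewrite <- Csum_scal. apply Csum_ext. intros k Hk.
        replace (RtoC (/ t ^ S (p - k))) with (RtoC (/ t ^ S p) * RtoC (t ^ k)); [ring|].
        rewrite <- RtoC_mult. f_equal. replace (S p) with (S (p - k) + k)%nat by lia.
        rewrite pow_add. field. split; apply pow_nonzero; lra. }
      rewrite !E, Csum_scal. unfold todd_exp.
      assert (HG := geometric_exp w m t). fold s in HG.
      assert (Hn := one_minus_exp_neq_0 t ltac:(lra)).
      (* Since [todd t * (1 - e^(-t)) = t], the geometric sum lowers the exponent by one: poles of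
         order [p + 1] become the order [n + 1] of [fp_exp _ n]. *)
      assert (E2 : RtoC (/ t ^ S n) * Csum (fun k => Cexp (- (RtoC (INR k) + w) * RtoC t)) 0 m
         = RtoC (/ t ^ S p) * todd t * (Cexp (- w * RtoC t) * (1 - Cexp (- s * RtoC t)))).
      { rewrite <- HG. unfold todd.
        replace (RtoC (/ t ^ S n)) with (RtoC (/ t ^ S p) * RtoC (t / (1 - exp (- t))) * (1 - RtoC (exp (- t)))); [ring|].
        rewrite <- RtoC_minus, <- !RtoC_mult. f_equal. unfold p. simpl. field.
        repeat split; try lra; try apply pow_nonzero; lra. }
      rewrite E2. ring.
    - apply has_fp_plus; [apply has_fp_plus|].
      + apply (has_fp_sum p (fun k t => RtoC (/ t ^ S n) * Cexp (- (RtoC (INR k) + w) * RtoC t))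
                 (fun k => fp_exp (RtoC (INR k) + w) n)).
        intros k _. apply has_fp_exp; [|unfold p; lia].
        destruct w as [x y]. simpl in *. pose proof (pos_INR k). lra.
      + apply has_fp_scal.
        apply (has_fp_sum p (fun j t => ctodd_coef j * (RtoC (/ t ^ S (p - j)) * Cexp (- w * RtoC t)))
                 (fun j => ctodd_coef j * fp_exp w (p - j))).
        intros j _. apply has_fp_scal, has_fp_exp; [exact Hw|lia].
      + apply (has_fp_sum p (fun j t => todd_exp_coef w j * (RtoC (/ t ^ S (p - j)) * Cexp (- s * RtoC t)))
                 (fun j => todd_exp_coef w j * fp_exp s (p - j))).
        intros j _. apply has_fp_scal, has_fp_exp; [exact Hs|lia]. }
  (* [T3] says that [F] is o(1/t) at 0, so its finite part is its integral. *)
  apply has_fp_CInt in FP.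
  2:{ apply Ctends_eq with (0 - 0); [|ring]. revert T3. apply Ctends_ext.
      apply filter_forall. intros t. unfold F. ring. }
  pose proof (CInt_unique _ _ _ FP I3) as E.
  set (S1 := Csum (fun k => fp_exp (RtoC (INR k) + w) n) 0 m) in *.
  set (S2 := Csum (fun j => ctodd_coef j * fp_exp w (p - j)) 0 p) in *.
  set (S3 := Csum (fun j => todd_exp_coef w j * fp_exp s (p - j)) 0 p) in *.
  set (J1 := watson_integral todd ctodd_coef p 0 w) in *.
  set (J2 := watson_integral (todd_exp w) (todd_exp_coef w) p 0 s) in *.
  replace S1 with (S1 + (- (1)) * S2 + S3 + S2 - S3) by ring. rewrite E. ring.
Qed.

(** * Power sums *)

(** Polynomials without constant term. The identity is required for every large [e], so that the
    number of terms can be raised freely when expansions are aligned. *)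
Definition is_pol0 (f : C -> C) : Prop :=
  exists (P : nat -> C) (d : nat), forall e, (d <= e)%nat -> forall x,
    f x = Csum (fun j => P j * x ^ S j) 0 e.

Lemma is_pol0_plus (f g : C -> C) : is_pol0 f -> is_pol0 g -> is_pol0 (fun x => f x + g x).
Proof.
  intros [P [d H]] [Q [d' H']]. exists (fun j => P j + Q j), (max d d'). intros e He x.
  rewrite (H e), (H' e) by lia. rewrite <- Csum_plus. apply Csum_ext. intros k _. ring.
Qed.

Lemma is_pol0_scal (c : C) (f : C -> C) : is_pol0 f -> is_pol0 (fun x => c * f x).
Proof.
  intros [P [d H]]. exists (fun j => c * P j), d. intros e He x.
  rewrite (H e), <- Csum_scal by lia. apply Csum_ext. intros k _. ring.
Qed.

Lemma is_pol0_mult_X (f : C -> C) : is_pol0 f -> is_pol0 (fun x => x * f x).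
Proof.
  intros [P [d H]]. exists (fun j => match j with O => RtoC 0 | S i => P i end), (S d). intros e He x.
  destruct e as [|e]; [lia|]. rewrite Csum_shift, (H e), <- Csum_scal by lia.
  rewrite Cmult_0_l, Cplus_0_l. apply Csum_ext. intros k _. simpl. ring.
Qed.

Lemma is_pol0_X : is_pol0 (fun x => x).
Proof.
  exists (fun j => match j with O => RtoC 1 | S _ => RtoC 0 end), O. intros e _ x.
  destruct e as [|e]; [rewrite Csum_O; simpl; ring|].
  rewrite Csum_shift, Csum_0 by (intros; ring). simpl. ring.
Qed.

Lemma is_pol0_ext (f g : C -> C) : (forall x, f x = g x) -> is_pol0 f -> is_pol0 g.
Proof. intros E [P [d H]]. exists P, d. intros e He x. rewrite <- E. apply H, He. Qed.

(** Falling factorials have closed-form sums, and [falling x (S i)] vanishes at 0; this is the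
    source of the missing constant term in power sums. *)
Fixpoint falling (x : C) (i : nat) : C :=
  match i with
  | O => 1
  | S j => falling x j * (x - RtoC (INR j))
  end.

Lemma falling_shift (x : C) (i : nat) : falling (x + 1) (S i) = (x + 1) * falling x i.
Proof.
  induction i as [|i IH].
  - simpl. ring.
  - change (falling (x + 1) (S (S i))) with (falling (x + 1) (S i) * (x + 1 - RtoC (INR (S i)))).
    rewrite IH, S_INR, RtoC_plus. simpl. ring.
Qed.

Lemma is_pol0_falling (i : nat) : is_pol0 (fun x => falling x (S i)).
Proof.
  induction i as [|i IH].
  - apply is_pol0_ext with (fun x => x); [|apply is_pol0_X]. intros x. simpl. ring.
  - apply is_pol0_ext with (fun x => x * falling x (S i) + (- RtoC (INR (S i))) * falling x (S i)).
    + intros x. simpl. ring.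
    + apply is_pol0_plus; [apply is_pol0_mult_X, IH|apply is_pol0_scal, IH].
Qed.

(** Telescoping: [falling (x + 1) (S i) - falling x (S i) = (i + 1) * falling x i]. *)
Lemma sum_falling (i m : nat) :
  Csum (fun k => falling (RtoC (INR k)) i) 0 m
  = RtoC (/ INR (S i)) * falling (RtoC (INR (S m))) (S i).
Proof.
  assert (HN : INR (S i) <> 0%R) by (apply not_0_INR; lia).
  assert (K : forall x, RtoC (/ INR (S i)) * falling (x + 1) (S i)
              = RtoC (/ INR (S i)) * falling x (S i) + falling x i).
  { intros x. rewrite falling_shift. simpl falling.
    replace (falling x i) with (RtoC (/ INR (S i)) * RtoC (INR (S i)) * falling x i) at 3.
    - rewrite (S_INR i) at 4. rewrite RtoC_plus. ring.
    - rewrite <- RtoC_mult, Rinv_l by exact HN. ring. }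
  induction m as [|m IH].
  - rewrite Csum_O. replace (RtoC (INR 1)) with (RtoC (INR 0) + 1) by (simpl; ring).
    rewrite K. enough (E : falling (RtoC (INR 0)) (S i) = 0) by (rewrite E; ring).
    clear K HN. induction i as [|i IHi]; [simpl; ring|].
    change (falling (RtoC (INR 0)) (S i) * (RtoC (INR 0) - RtoC (INR (S i))) = 0). rewrite IHi. ring.
  - rewrite Csum_S, IH by lia. rewrite (S_INR (S m)), RtoC_plus, K. ring.
Qed.

(* [(k + w) * falling k i = falling k (S i) + (i + w) * falling k i]. *)
Lemma power_sum_falling (w : C) (n i : nat) :
  exists f, is_pol0 f /\ forall m,
    Csum (fun k => (RtoC (INR k) + w) ^ n * falling (RtoC (INR k)) i) 0 m = f (RtoC (INR (S m))).
Proof.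
  revert i. induction n as [|n IH]; intros i.
  - exists (fun x => RtoC (/ INR (S i)) * falling x (S i)). split.
    + apply is_pol0_scal, is_pol0_falling.
    + intros m. rewrite <- sum_falling. apply Csum_ext. intros k _. simpl. ring.
  - destruct (IH (S i)) as [f [Hf Ef]]. destruct (IH i) as [g [Hg Eg]].
    exists (fun x => f x + (RtoC (INR i) + w) * g x). split.
    + apply is_pol0_plus; [exact Hf|apply is_pol0_scal, Hg].
    + intros m. rewrite <- Ef, <- Eg, <- Csum_scal, <- Csum_plus.
      apply Csum_ext. intros k _. simpl. ring.
Qed.

Lemma power_sum (w : C) (n : nat) :
  exists f, is_pol0 f /\ forall m, Csum (fun k => (RtoC (INR k) + w) ^ n) 0 m = f (RtoC (INR (S m))).
Proof.
  destruct (power_sum_falling w n 0) as [f [Hf Ef]]. exists f. split; [exact Hf|].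
  intros m. rewrite <- Ef. apply Csum_ext. intros k _. simpl. ring.
Qed.

(** * Uniqueness of the constant term *)

Lemma Ctends_filterlim (f : nat -> C) :
  filterlim f eventually (locally (RtoC 0)) <-> Ctends eventually f 0.
Proof.
  split.
  - intros H eps He. assert (He2 : (0 < eps / 2)%R) by lra.
    specialize (H _ (locally_ball (T := C_UniformSpace) (RtoC 0) (mkposreal _ He2))).
    change (eventually (fun s => ball (M := C_UniformSpace) (RtoC 0) (eps / 2)%R (f s))) in H.
    revert H. apply filter_imp. intros s Hs.
    pose proof (ball_Cmod_lt _ _ (mkposreal _ He2) Hs) as B. simpl in B.
    replace eps with (2 * (eps / 2))%R by field. exact B.
  - intros H P [e He]. specialize (H e (cond_pos e)).
    change (eventually (fun s => P (f s))). revert H. apply filter_imp. intros s Hs.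
    apply He. apply Cmod_lt_ball, Hs.
Qed.

Lemma eventually_ge_1 : eventually (fun s => (1 <= INR s)%R).
Proof. exists 1%nat. intros n Hn. apply (le_INR 1), Hn. Qed.

Lemma filterlim_INR : filterlim INR eventually (Rbar_locally p_infty).
Proof. exact is_lim_seq_INR. Qed.

Lemma Ctends_ln_div : Ctends eventually (fun s => RtoC (ln (INR s) / INR s)) 0.
Proof.
  apply Ctends_RtoC. apply (filterlim_comp _ _ _ INR (fun y => (ln y / y)%R) eventually (Rbar_locally p_infty)).
  - exact filterlim_INR.
  - exact is_lim_div_ln_p.
Qed.

Lemma Ctends_inv_INR : Ctends eventually (fun s => RtoC (/ INR s)) 0.
Proof.
  apply Ctends_RtoC. apply (filterlim_comp _ _ _ INR Rinv eventually (Rbar_locally p_infty)).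
  - exact filterlim_INR.
  - exact (is_lim_inv (fun y => y) p_infty p_infty (is_lim_id p_infty) ltac:(easy)).
Qed.

Lemma Ctends_inv_ln : Ctends eventually (fun s => RtoC (/ ln (INR s))) 0.
Proof.
  apply Ctends_RtoC. apply (filterlim_comp _ _ _ INR (fun y => (/ ln y)%R) eventually (Rbar_locally p_infty)).
  - exact filterlim_INR.
  - exact (is_lim_inv ln p_infty p_infty is_lim_ln_p ltac:(easy)).
Qed.

(** Division by [log s] isolates [u]; once [u = 0], the expression is the constant [v]. *)
Lemma log_affine_null (u v : C) :
  Ctends eventually (fun s => u * RtoC (ln (INR s)) + v) 0 -> u = 0 /\ v = 0.
Proof.
  intros H.
  assert (Hu : u = 0).
  { apply (Ctends_unique (F := eventually) (fun s => u + v * RtoC (/ ln (INR s)))).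
    - apply Ctends_eq with (u + v * 0); [|ring].
      apply Ctends_plus; [apply Ctends_const|apply Ctends_scal, Ctends_inv_ln].
    - apply Ctends_ext with (fun s => (u * RtoC (ln (INR s)) + v) * RtoC (/ ln (INR s))).
      (* From [s = 2] on the logarithm is positive and can be inverted. *)
      + exists 2%nat. intros s Hs.
        assert (Hl : (0 < ln (INR s))%R).
        { rewrite <- ln_1. apply ln_increasing; [lra|]. apply (lt_INR 1). lia. }
        replace ((u * RtoC (ln (INR s)) + v) * RtoC (/ ln (INR s)))
          with (u * (RtoC (ln (INR s)) * RtoC (/ ln (INR s))) + v * RtoC (/ ln (INR s))) by ring.
        rewrite <- RtoC_mult, Rinv_r by lra. ring.
      + destruct (Ctends_inv_ln 1%R Rlt_0_1) as [N HN].
        apply Ctends_mult_0 with (D := 1%R); [|exact H].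
        exists N. intros s Hs. specialize (HN s Hs).
        replace (RtoC (/ ln (INR s)) - 0) with (RtoC (/ ln (INR s))) in HN by ring. lra. }
  split; [exact Hu|].
  apply (Ctends_unique (F := eventually) (fun s => u * RtoC (ln (INR s)) + v)); [|exact H].
  apply Ctends_ext with (fun _ => v); [|apply Ctends_const].
  apply filter_forall. intros s. rewrite Hu. ring.
Qed.

Lemma pow_div_le_1 (s : R) (m N : nat) : (1 <= s)%R -> (m <= N)%nat -> (0 <= s ^ m / s ^ N <= 1)%R.
Proof.
  intros Hs Hm. assert (H1 : (0 < s ^ m)%R) by (apply pow_lt; lra).
  assert (H2 : (0 < s ^ N)%R) by (apply pow_lt; lra). split.
  - left. apply Rdiv_lt_0_compat; assumption.
  - apply Rmult_le_reg_r with (1 := H2). unfold Rdiv.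
    rewrite Rmult_assoc, Rinv_l, Rmult_1_r, Rmult_1_l by lra. apply Rle_pow; assumption.
Qed.

Lemma log_power_null (N : nat) (a c : nat -> C) :
  Ctends eventually (fun s =>
    Csum (fun m => a m * RtoC (INR s ^ m * ln (INR s))) 0 N
    + Csum (fun m => c m * RtoC (INR s ^ m)) 0 N) 0 ->
  c O = 0.
Proof.
  induction N as [|N IH]; intros H.
  - apply (log_affine_null (a O) (c O)). revert H. apply Ctends_ext.
    apply filter_forall. intros s. rewrite !Csum_O. simpl. rewrite Rmult_1_l. ring.
  - assert (K : a (S N) = 0 /\ c (S N) = 0).
    { apply log_affine_null.
      set (low := fun s => Csum (fun m => a m * (RtoC (ln (INR s) / INR s) * RtoC (INR s ^ m / INR s ^ N))) 0 N
         + Csum (fun m => c m * (RtoC (/ INR s) * RtoC (INR s ^ m / INR s ^ N))) 0 N).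
      set (full := fun s => (Csum (fun m => a m * RtoC (INR s ^ m * ln (INR s))) 0 (S N)
         + Csum (fun m => c m * RtoC (INR s ^ m)) 0 (S N)) * RtoC (/ INR s ^ S N)).
      assert (L : Ctends eventually low 0).
      { apply Ctends_eq with (Csum (fun m => a m * 0) 0 N + Csum (fun m => c m * 0) 0 N).
        2:{ rewrite !Csum_0 by (intros; ring). ring. }
        assert (B : forall m, (m <= N)%nat -> eventually (fun s => (Cmod (RtoC (INR s ^ m / INR s ^ N)) <= 1)%R)).
        { intros m Hm. generalize eventually_ge_1. apply filter_imp. intros s Hs.
          pose proof (pow_div_le_1 (INR s) m N Hs Hm). rewrite Cmod_RtoC; lra. }
        apply Ctends_plus.
        - apply (Ctends_sum (fun m s => a m * (RtoC (ln (INR s) / INR s) * RtoC (INR s ^ m / INR s ^ N)))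
                   (fun m => a m * 0)).
          intros m Hm. apply Ctends_scal. apply Ctends_mult_0 with (D := 1%R); [apply B, Hm|apply Ctends_ln_div].
        - apply (Ctends_sum (fun m s => c m * (RtoC (/ INR s) * RtoC (INR s ^ m / INR s ^ N)))
                   (fun m => c m * 0)).
          intros m Hm. apply Ctends_scal. apply Ctends_mult_0 with (D := 1%R); [apply B, Hm|apply Ctends_inv_INR]. }
      assert (M : Ctends eventually full 0).
      { apply Ctends_mult_0 with (D := 1%R); [|exact H].
        generalize eventually_ge_1. apply filter_imp. intros s Hs.
        assert (H2 : (1 <= INR s ^ S N)%R) by (apply pow_R1_Rle, Hs).
        rewrite Cmod_RtoC by (left; apply Rinv_0_lt_compat; lra).
        rewrite <- Rinv_1. apply Rinv_le_contravar; lra. }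
      apply Ctends_ext with (fun s => full s - low s).
      2:{ apply Ctends_eq with (0 - 0); [apply Ctends_minus; assumption|ring]. }
      generalize eventually_ge_1. apply filter_imp. intros s Hs.
      assert (Hp : forall i, (INR s ^ i <> 0)%R) by (intros i; apply pow_nonzero; lra).
      assert (E1 : Csum (fun m => a m * (RtoC (ln (INR s) / INR s) * RtoC (INR s ^ m / INR s ^ N))) 0 N
         = RtoC (/ INR s ^ S N) * Csum (fun m => a m * RtoC (INR s ^ m * ln (INR s))) 0 N).
      { rewrite <- Csum_scal. apply Csum_ext. intros m _.
        replace (RtoC (/ INR s ^ S N) * (a m * RtoC (INR s ^ m * ln (INR s))))
          with (a m * (RtoC (/ INR s ^ S N) * RtoC (INR s ^ m * ln (INR s)))) by ring.
        rewrite <- !RtoC_mult. do 2 f_equal. simpl. field. split; [apply Hp|lra]. }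
      assert (E2 : Csum (fun m => c m * (RtoC (/ INR s) * RtoC (INR s ^ m / INR s ^ N))) 0 N
         = RtoC (/ INR s ^ S N) * Csum (fun m => c m * RtoC (INR s ^ m)) 0 N).
      { rewrite <- Csum_scal. apply Csum_ext. intros m _.
        replace (RtoC (/ INR s ^ S N) * (c m * RtoC (INR s ^ m)))
          with (c m * (RtoC (/ INR s ^ S N) * RtoC (INR s ^ m))) by ring.
        rewrite <- !RtoC_mult. do 2 f_equal. simpl. field. split; [apply Hp|lra]. }
      unfold full, low. rewrite E1, E2, !Csum_S by lia. rewrite RtoC_mult.
      assert (E3 : RtoC (INR s ^ S N) * RtoC (/ INR s ^ S N) = 1).
      { rewrite <- RtoC_mult, Rinv_r by apply Hp. reflexivity. }
      set (q := RtoC (/ INR s ^ S N)) in *. set (r := RtoC (INR s ^ S N)) in *.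
      set (A := Csum (fun m => a m * RtoC (INR s ^ m * ln (INR s))) 0 N).
      set (B := Csum (fun m => c m * RtoC (INR s ^ m)) 0 N).
      transitivity ((a (S N) * RtoC (ln (INR s)) + c (S N)) * (r * q)); [ring|rewrite E3; ring]. }
    destruct K as [Ka Kc]. apply IH. revert H. apply Ctends_ext.
    apply filter_forall. intros s. rewrite !Csum_S, Ka, Kc by lia. ring.
Qed.

Lemma Csum_pad (f : nat -> C) (N N' : nat) :
  (N <= N')%nat -> Csum f 0 N = Csum (fun k => if (k <=? N)%nat then f k else RtoC 0) 0 N'.
Proof.
  induction 1 as [|N' H IH].
  - apply Csum_ext. intros k Hk. rewrite (proj2 (Nat.leb_le k N) Hk). reflexivity.
  - rewrite Csum_S, <- IH by lia. rewrite (proj2 (Nat.leb_gt (S N') N)) by lia. ring.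
Qed.

(** The truncation at [M = 0] already determines the constant term. Padding with zeros brings two
    expansions of different lengths to a common one, ready for subtraction. *)
Lemma expansion_at_0 (f : nat -> C) (N : nat) (a : nat -> C) (c : Z -> C) (N' : nat) :
  (N <= N')%nat -> is_log_power_expansion f N a c ->
  exists a' c' : nat -> C, c' O = c 0%Z /\
    Ctends eventually (fun s => f s
      - Csum (fun m => a' m * RtoC (INR s ^ m * ln (INR s))) 0 N'
      - Csum (fun m => c' m * RtoC (INR s ^ m)) 0 N') 0.
Proof.
  intros HN H. specialize (H O). apply Ctends_filterlim in H.
  exists (fun m => if (m <=? N)%nat then a m else RtoC 0),
    (fun m => if (m <=? N)%nat then c (Z.of_nat m) else RtoC 0).
  split; [reflexivity|]. revert H. apply Ctends_ext. apply filter_forall. intros s.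
  rewrite (Csum_pad _ N N' HN).
  assert (E : Csum (fun j => let m := (Z.of_nat j - Z.of_nat 0)%Z in c m * RtoC (powerRZ (INR s) m)) 0 (0 + N)
     = Csum (fun m => (if (m <=? N)%nat then c (Z.of_nat m) else RtoC 0) * RtoC (INR s ^ m)) 0 N').
  { simpl plus. rewrite (Csum_pad _ N N' HN). apply Csum_ext. intros k Hk. cbv zeta.
    replace (Z.of_nat k - Z.of_nat 0)%Z with (Z.of_nat k) by (simpl; lia).
    rewrite <- pow_powerRZ. destruct (k <=? N)%nat; ring. }
  rewrite E. simpl (INR s ^ 0)%R.
  assert (E2 : Csum (fun k => if (k <=? N)%nat then a k * RtoC (INR s ^ k * ln (INR s)) else RtoC 0) 0 N'
     = Csum (fun m => (if (m <=? N)%nat then a m else RtoC 0) * RtoC (INR s ^ m * ln (INR s))) 0 N').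
  { apply Csum_ext. intros k _. destruct (k <=? N)%nat; ring. }
  rewrite E2. ring.
Qed.

Lemma constant_term_unique (f : nat -> C) (x y : C) :
  is_constant_term f x -> is_constant_term f y -> x = y.
Proof.
  intros [N1 [a1 [c1 [H1 <-]]]] [N2 [a2 [c2 [H2 <-]]]].
  destruct (expansion_at_0 f N1 a1 c1 (max N1 N2) ltac:(lia) H1) as [a1' [c1' [E1 T1]]].
  destruct (expansion_at_0 f N2 a2 c2 (max N1 N2) ltac:(lia) H2) as [a2' [c2' [E2 T2]]].
  rewrite <- E1, <- E2.
  enough (E : c1' O - c2' O = 0).
  { replace (c1' O) with (c1' O - c2' O + c2' O) by ring. rewrite E. ring. }
  apply (log_power_null (max N1 N2) (fun m => a1' m - a2' m) (fun m => c1' m - c2' m)).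
  pose proof (Ctends_minus (F := eventually) _ _ _ _ T2 T1) as T.
  apply Ctends_eq with (0 - 0); [|ring]. revert T. apply Ctends_ext.
  apply filter_forall. intros s.
  rewrite (Csum_ext (fun m => (a1' m - a2' m) * RtoC (INR s ^ m * ln (INR s)))
     (fun m => a1' m * RtoC (INR s ^ m * ln (INR s)) + (- (1)) * (a2' m * RtoC (INR s ^ m * ln (INR s)))))
    by (intros; ring).
  rewrite (Csum_ext (fun m => (c1' m - c2' m) * RtoC (INR s ^ m))
     (fun m => c1' m * RtoC (INR s ^ m) + (- (1)) * (c2' m * RtoC (INR s ^ m))))
    by (intros; ring).
  rewrite !Csum_plus, !Csum_scal. ring.
Qed.

Lemma constant_term_eq (f : nat -> C) (x : C) : is_constant_term f x -> constant_term f = x.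
Proof.
  intros H. apply (constant_term_unique f); [|exact H].
  apply (iota_correct (V := C_R_CompleteNormedModule) (is_constant_term f)).
  exists x. split; [exact H|]. intros y Hy. exact (constant_term_unique f x y H Hy).
Qed.

(** * The expansion of the partial sums *)

Lemma RtoC_sum_n_m (f : nat -> R) (N : nat) :
  RtoC (sum_n_m (G := R_AbelianMonoid) f 0 N) = Csum (fun j => RtoC (f j)) 0 N.
Proof.
  induction N as [|N IH].
  - rewrite sum_n_n, Csum_O. reflexivity.
  - rewrite sum_n_Sm, Csum_S, <- IH by lia. apply RtoC_plus.
Qed.

(** Index bookkeeping: one of the [n + 2] factors [1 / t] turns [todd] back into [1 / (1 - e^(-t))]
    and [b_(j-1) t^j] into [b_k t^k]; the others give [t^(-n-1)]. *)
Lemma SR_integrand_eq (n : nat) (w : C) (t : R) :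
  (0 < t)%R -> watson_integrand todd ctodd_coef (S n) 0 w t = SR_integrand n w t.
Proof.
  intros Ht. assert (Ht0 : t <> 0%R) by lra.
  unfold watson_integrand, SR_integrand, laurent_trunc, taylor_rem, Cdiv.
  rewrite Nat.add_0_r, Nat.add_1_r, RtoC_mult, RtoC_minus, RtoC_sum_n_m.
  rewrite (Csum_ext (fun j => RtoC (let k := (Z.of_nat j - 1)%Z in (laurent_coef k * powerRZ t k)%R))
     (fun j => RtoC (/ t) * (ctodd_coef j * RtoC (t ^ j)))).
  2:{ intros j _. cbv zeta. rewrite powerRZ_pred by exact Ht0. unfold ctodd_coef, todd_coef.
      rewrite !RtoC_mult. ring. }
  rewrite Csum_scal. unfold todd. rewrite <- RtoC_inv by exact Ht0.
  replace (RtoC (t / (1 - exp (- t)))) with (RtoC t * RtoC (1 / (1 - exp (- t)))).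
  2:{ rewrite <- RtoC_mult. f_equal. field. apply one_minus_exp_neq_0, Ht0. }
  replace (RtoC (/ t ^ S (S n))) with (RtoC (1 / t ^ n) * RtoC (/ t) * RtoC (/ t)).
  2:{ rewrite <- !RtoC_mult. f_equal. simpl. field. split; [apply pow_nonzero|]; exact Ht0. }
  assert (E : RtoC (/ t) * RtoC t = 1) by (rewrite <- RtoC_mult, Rinv_l by exact Ht0; reflexivity).
  set (q := RtoC (/ t)) in *. set (S0 := Csum _ 0 _). set (X := RtoC (1 / (1 - exp (- t)))).
  replace (RtoC (1 / t ^ n) * q * q * (RtoC t * X - S0) * Cexp (- w * RtoC t))
    with (RtoC (1 / t ^ n) * q * ((q * RtoC t) * X - q * S0) * Cexp (- w * RtoC t)) by ring.
  rewrite E. ring.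
Qed.

Lemma RtoC_m1 : RtoC (-1) = - RtoC 1.
Proof. exact (RtoC_opp 1). Qed.

(** Substitution [l = n + 1 - j]. The harmonic sum may start at [l = 0] because [H_0 = 0]. *)
Lemma r_hat_eq (n : nat) (w : C) :
  r_hat n w = Csum (fun j => ctodd_coef j * fp_exp w (S n - j)) 0 (S n).
Proof.
  rewrite <- (Csum_rev _ (S n)). unfold r_hat. rewrite Nat.add_1_r.
  set (A := fun l => RtoC (laurent_coef (Z.of_nat n - Z.of_nat l)
                       * ((-1) ^ l / INR (fact l))) * w ^ l * RtoC (harmonic l)).
  set (B := fun l => RtoC (laurent_coef (Z.of_nat n - Z.of_nat l)
                         * ((-1) ^ (l + 1) / INR (fact l))) * w ^ l).
  change (Csum A 1 (S n) + Csum B 0 (S n) * Clog w = Csum (fun k => ctodd_coef (S n - k) * fp_exp w (S n - (S n - k))) 0 (S n)).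
  assert (E : Csum A 1 (S n) = Csum A 0 (S n)).
  { rewrite Csum_first. unfold A at 2. rewrite harmonic_O. ring. }
  rewrite E, (Cmult_comm _ (Clog w)), <- Csum_scal, <- Csum_plus. apply Csum_ext. intros l Hl.
  unfold A, B, ctodd_coef, todd_coef, fp_exp.
  replace (S n - (S n - l))%nat with l by lia.
  replace (Z.of_nat (S n - l) - 1)%Z with (Z.of_nat n - Z.of_nat l)%Z by lia.
  unfold Rdiv. rewrite !RtoC_mult, !RtoC_pow.
  replace (- w) with (RtoC (-1) * w) by (rewrite RtoC_m1; ring).
  rewrite Cpow_mult_l, Cpow_add_r, Cpow_1_r.
  set (q := RtoC (-1) ^ l). rewrite RtoC_m1. ring.
Qed.

Lemma fp_exp_nat (s : R) (j : nat) :
  (0 < s)%R ->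
  fp_exp (RtoC s) j = RtoC ((-1) ^ j / INR (fact j)) * RtoC (s ^ j) * (RtoC (harmonic j) - RtoC (ln s)).
Proof.
  intros Hs. unfold fp_exp.
  assert (E : Clog (RtoC s) = RtoC (ln s)).
  { unfold Clog. rewrite Carg_atan, Cmod_RtoC by (simpl; lra).
    replace (Im (RtoC s) / Re (RtoC s))%R with 0%R by (simpl; field; lra). rewrite atan_0. reflexivity. }
  rewrite E. replace (- RtoC s) with (RtoC (-1) * RtoC s) by (rewrite RtoC_m1; ring).
  unfold Rdiv. rewrite Cpow_mult_l, RtoC_mult, !RtoC_pow. ring.
Qed.

(** The definition of [fp_exp v n] solved for the logarithm; this is the origin of the factor
    [(-1)^(n+1) n!] in the theorem. *)
Lemma power_log_fp (n : nat) (v : C) :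
  v ^ n * Clog v = RtoC ((-1) ^ (n + 1) * INR (fact n)) * fp_exp v n + RtoC (harmonic n) * v ^ n.
Proof.
  unfold fp_exp. replace (- v) with (RtoC (-1) * v) by (rewrite RtoC_m1; ring).
  rewrite Cpow_mult_l, <- RtoC_pow.
  replace (RtoC ((-1) ^ (n + 1) * INR (fact n)) * (RtoC ((-1) ^ n) * v ^ n * RtoC (/ INR (fact n)) * (RtoC (harmonic n) - Clog v)))
    with (RtoC ((-1) ^ (n + 1) * INR (fact n)) * RtoC ((-1) ^ n) * RtoC (/ INR (fact n)) * (v ^ n * (RtoC (harmonic n) - Clog v))) by ring.
  rewrite <- !RtoC_mult.
  replace ((-1) ^ (n + 1) * INR (fact n) * (-1) ^ n * / INR (fact n))%R with (-1)%R.
  - rewrite RtoC_m1. ring.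
  - rewrite pow_add, pow_1.
    replace ((-1) ^ n * -1 * INR (fact n) * (-1) ^ n * / INR (fact n))%R
      with (((-1) * (-1)) ^ n * -1 * (INR (fact n) * / INR (fact n)))%R by (rewrite Rpow_mult_distr; ring).
    rewrite Rinv_r by apply INR_fact_neq_0. replace (-1 * -1)%R with 1%R by ring. rewrite pow1. ring.
Qed.

Lemma asym0_todd_exp (w : C) : (0 < Re w)%R -> asym0 (todd_exp w) (todd_exp_coef w).
Proof. intros Hw. apply asym0_mult; [exact asym0_todd|apply asym0_exp; lra]. Qed.

Lemma linear_growth_todd_exp (w : C) : (0 < Re w)%R -> linear_growth (todd_exp w).
Proof. intros Hw. apply linear_growth_mult_exp; [lra|exact linear_growth_todd]. Qed.

Lemma Cdiff_todd_exp (w : C) (t : R) : (0 < t)%R -> Cdiff (todd_exp w) t.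
Proof. intros Ht. apply Cdiff_mult; [apply Cdiff_todd, Ht|]. eexists. apply Cder_Cexp. Qed.

Lemma CInt_SR_integrand (n : nat) (w : C) :
  (0 < Re w)%R -> CInt (SR_integrand n w) (watson_integral todd ctodd_coef (S n) 0 w).
Proof.
  intros Hw.
  destruct (watson_integral_correct todd ctodd_coef (S n) 0 asym0_todd linear_growth_todd Cdiff_todd)
    as [K [_ H]].
  destruct (H w Hw) as [I _]. apply CInt_ext with (2 := I).
  intros t Ht. apply SR_integrand_eq, Ht.
Qed.

Lemma log_power_sum_formula (n m : nat) (w : C) :
  (0 < Re w)%R ->
  log_power_sum n w (S m) =
  RtoC ((-1) ^ (n + 1) * INR (fact n)) *
    (watson_integral todd ctodd_coef (S n) 0 w + r_hat n w
     - Csum (fun l => todd_exp_coef w (S n - l) * fp_exp (RtoC (INR (S m))) l) 0 (S n)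
     - watson_integral (todd_exp w) (todd_exp_coef w) (S n) 0 (RtoC (INR (S m))))
  + RtoC (harmonic n) * Csum (fun k => (RtoC (INR k) + w) ^ n) 0 m.
Proof.
  intros Hw. rewrite r_hat_eq.
  rewrite <- (Csum_rev (fun l => todd_exp_coef w (S n - l) * fp_exp (RtoC (INR (S m))) l)).
  rewrite (Csum_ext (fun k => todd_exp_coef w (S n - (S n - k)) * fp_exp (RtoC (INR (S m))) (S n - k))
             (fun j => todd_exp_coef w j * fp_exp (RtoC (INR (S m))) (S n - j))).
  2:{ intros k Hk. replace (S n - (S n - k))%nat with k by lia. reflexivity. }
  rewrite <- fp_sum_formula, <- !Csum_scal, <- Csum_plus by exact Hw.
  apply Csum_ext. intros k _. apply power_log_fp.
Qed.

Lemma is_constant_term_log_power_sum (n : nat) (w : C) :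
  (0 < Re w)%R ->
  is_constant_term (log_power_sum n w)
    (RtoC ((-1) ^ (n + 1) * INR (fact n))
     * (watson_integral todd ctodd_coef (S n) 0 w + r_hat n w)).
Proof.
  intros Hw. destruct (power_sum w n) as [P [[pc [d HP]] HPs]].
  set (k := RtoC ((-1) ^ (n + 1) * INR (fact n))).
  set (J := watson_integral todd ctodd_coef (S n) 0 w).
  (* The terms [s^l] and [s^l log s] reach degree [n + 1], the power sum degree [d + 1]; [S N]
     bounds both. *)
  set (N := (n + d)%nat).
  (* The coefficient of [s^l (H_l - log s)] in the sum of the [B_(n-l) L_l s], continued by 0. *)
  set (q := fun l => if (l <=? S n)%nat
      then todd_exp_coef w (S n - l) * RtoC ((-1) ^ l / INR (fact l)) else RtoC 0).
  (* The Watson coefficient of [s^(-m)] for [z = - m]: a Taylor coefficient of index [n + 1 + m]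
     times [(m - 1)!], from the Gamma integral of [t^(m-1)]. *)
  set (g := fun z : Z => todd_exp_coef w (S n + Z.to_nat (- z))
               * RtoC (INR (fact (pred (Z.to_nat (- z)))))).
  (* At [Z0] neither the power sum, a polynomial without constant term, nor the [q] terms, where
     [H_0 = 0], contribute. *)
  set (c := fun z : Z => match z with
      | Z0 => k * (J + r_hat n w)
      | Zpos _ => RtoC (harmonic n) * pc (pred (Z.to_nat z))
                  - k * (q (Z.to_nat z) * RtoC (harmonic (Z.to_nat z)))
      | Zneg _ => - k * g z
      end).
  exists (S N), (fun l => k * q l), c. split; [|reflexivity].
  intros M. apply Ctends_filterlim.
  set (W := fun s : R => watson_integral (todd_exp w) (todd_exp_coef w) (S n) M (RtoC s)).
  assert (HW := watson_integral_correct (todd_exp w) (todd_exp_coef w) (S n) M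
    (asym0_todd_exp w Hw) (linear_growth_todd_exp w Hw) (Cdiff_todd_exp w)).
  destruct HW as [K [HK HW]].
  (* After cancellation only the Watson remainder of order [M] survives. *)
  apply Ctends_ext with (fun s => - k * (W (INR s) * RtoC (INR s ^ M))).
  - exists 1%nat. intros s Hs. destruct s as [|m]; [lia|]. set (s := INR (S m)).
    assert (Hs0 : (0 < s)%R) by (apply (lt_0_INR (S m)); lia).
    rewrite (Csum_Z_split (fun z => c z * RtoC (powerRZ s z))).
    rewrite log_power_sum_formula, HPs by exact Hw. fold k. fold J.
    change (RtoC (INR (S m))) with (RtoC s).
    rewrite (HP N) by (unfold N; lia).
    assert (E1 : watson_integral (todd_exp w) (todd_exp_coef w) (S n) 0 (RtoC s)
       = neg_sum (fun z => g z * RtoC (powerRZ s z)) M + W s).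
    { apply watson_expansion.
      - apply asym0_todd_exp, Hw.
      - apply linear_growth_todd_exp, Hw.
      - apply Cdiff_todd_exp.
      - exact Hs0.
      - intros i. unfold g. replace (Z.to_nat (- - Z.of_nat (S i))) with (S i) by lia.
        rewrite <- Cmult_assoc, <- RtoC_mult. do 2 f_equal.
        rewrite powerRZ_neg', <- pow_powerRZ. reflexivity. }
    assert (E2 : neg_sum (fun z => c z * RtoC (powerRZ s z)) M
       = - k * neg_sum (fun z => g z * RtoC (powerRZ s z)) M).
    { generalize M. intros M0. induction M0 as [|M0 IH]; simpl neg_sum; [ring|].
      rewrite IH. change (c (Z.neg (Pos.of_succ_nat M0))) with (- k * g (Z.neg (Pos.of_succ_nat M0))).
      ring. }
    assert (E3 : Csum (fun l => todd_exp_coef w (S n - l) * fp_exp (RtoC s) l) 0 (S n)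
       = Csum (fun l => q l * (RtoC (s ^ l) * RtoC (harmonic l))) 0 (S N)
         - Csum (fun l => q l * RtoC (s ^ l * ln s)) 0 (S N)).
    { rewrite (Csum_pad _ (S n) (S N)) by (unfold N; lia).
      replace (Csum (fun l => q l * (RtoC (s ^ l) * RtoC (harmonic l))) 0 (S N)
         - Csum (fun l => q l * RtoC (s ^ l * ln s)) 0 (S N))
       with (Csum (fun l => q l * (RtoC (s ^ l) * RtoC (harmonic l))) 0 (S N)
         + (- (1)) * Csum (fun l => q l * RtoC (s ^ l * ln s)) 0 (S N)) by ring.
      rewrite <- Csum_scal, <- Csum_plus. apply Csum_ext. intros l _. unfold q.
      destruct (l <=? S n)%nat; [|ring].
      rewrite fp_exp_nat by exact Hs0. rewrite (RtoC_mult (s ^ l)). ring. }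
    assert (E4 : Csum (fun j => c (Z.of_nat j) * RtoC (powerRZ s (Z.of_nat j))) 0 (S N)
       = k * (J + r_hat n w) + RtoC (harmonic n) * Csum (fun j => pc j * RtoC s ^ S j) 0 N
         - k * Csum (fun l => q l * (RtoC (s ^ l) * RtoC (harmonic l))) 0 (S N)).
    { rewrite (Csum_shift (fun l => q l * (RtoC (s ^ l) * RtoC (harmonic l)))).
      rewrite Csum_shift, harmonic_O.
      rewrite (Csum_ext (fun j => c (Z.of_nat (S j)) * RtoC (powerRZ s (Z.of_nat (S j))))
        (fun j => RtoC (harmonic n) * (pc j * RtoC s ^ S j)
                  + (- k) * (q (S j) * (RtoC (s ^ S j) * RtoC (harmonic (S j)))))).
      2:{ intros j _.
          change (c (Z.of_nat (S j))) with (RtoC (harmonic n) * pc (pred (Z.to_nat (Z.of_nat (S j))))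
            - k * (q (Z.to_nat (Z.of_nat (S j))) * RtoC (harmonic (Z.to_nat (Z.of_nat (S j)))))).
          rewrite Znat.Nat2Z.id, <- pow_powerRZ, <- RtoC_pow. simpl pred. ring. }
      rewrite Csum_plus, !Csum_scal. simpl. ring. }
    rewrite E1, E2, E3, E4.
    assert (E5 : Csum (fun l => k * q l * RtoC (s ^ l * ln s)) 0 (S N)
       = k * Csum (fun l => q l * RtoC (s ^ l * ln s)) 0 (S N)).
    { rewrite <- Csum_scal. apply Csum_ext. intros l _. ring. }
    rewrite E5. ring.
  - apply Ctends_eq with (- k * 0); [|ring]. apply Ctends_scal.
    (* From [(M / (s / 2))^M * s^M = (2 M)^M] and [1 / (s / 2) = 2 / s]. *)
    set (D := (K * (2 * INR M) ^ M * 2)%R).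
    apply Ctends_squeeze with (fun s => (D * / INR s)%R).
    + exists 1%nat. intros s Hs. assert (Hs0 : (0 < INR s)%R) by (apply (lt_0_INR s); lia).
      destruct (HW (RtoC (INR s)) Hs0) as [_ B]. change (Re (RtoC (INR s))) with (INR s) in B.
      replace (W (INR s) * RtoC (INR s ^ M) - 0) with (W (INR s) * RtoC (INR s ^ M)) by ring.
      assert (Hp : (0 < INR s ^ M)%R) by (apply pow_lt, Hs0).
      rewrite Cmod_mult, Cmod_RtoC by lra.
      apply Rle_trans with (1 := Rmult_le_compat_r _ _ _ (Rlt_le _ _ Hp) B). right. unfold D.
      replace (2 * INR M)%R with (INR M / (INR s / 2) * INR s)%R by (field; lra).
      rewrite Rpow_mult_distr. field. lra.
    + replace 0%R with (D * 0)%R by ring.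
      apply (filterlim_comp _ _ _ INR (fun y => (D * / y)%R) eventually (Rbar_locally p_infty)).
      * exact filterlim_INR.
      * apply (is_lim_scal_l Rinv D p_infty 0%R).
        exact (is_lim_inv (fun y => y) p_infty p_infty (is_lim_id p_infty) ltac:(easy)).
Qed.

Theorem theorem1p1 (n : nat) (w : C) (hw : (0 < Re w)%R) :
  ex_RInt_gen (V := C_R_CompleteNormedModule)
    (SR_integrand n w) (at_right 0) (Rbar_locally p_infty) /\
  stirling_ramanujan n w =
    RtoC ((-1) ^ (n + 1) * INR (fact n))
    * (RInt_gen (V := C_R_CompleteNormedModule)
         (SR_integrand n w) (at_right 0) (Rbar_locally p_infty)
       + r_hat n w).
Proof.
  pose proof (CInt_SR_integrand n w hw) as H. split.
  - exists (watson_integral todd ctodd_coef (S n) 0 w). exact H.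
  - rewrite (CInt_RInt_gen _ _ H). apply constant_term_eq, is_constant_term_log_power_sum, hw.
Qed.
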